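(* Let $0<q<1$ and let $a,b,c,d$ be nonzero complex numbers with $\max(|a|,|b|,|c|,|q/d|)<1$. Let $\alpha=q^{\alpha_0}$ with $0<\operatorname{Re}\alpha_0<1/2$, and put $\eta=\tfrac12(\alpha+\alpha^{-1})$. Let $v_\nu(x;a,b,c;d)$ and $\lambda_\nu$ be the functions defined in the context. Suppose that $\mu$ and $\nu$ are solutions $\varepsilon$ of the equation $$v_\varepsilon(\eta;a,b,c;d)=0 .$$ Then the following two relations hold. (i) If $\mu\neq\nu$, then $$\int_0^{\pi}\frac{v_\mu(\cos\theta;a,b,c;d)\,v_\nu(\cos\theta;a,b,c;d)\,(e^{2i\theta},e^{-2i\theta};q)_\infty}{(ae^{i\theta},ae^{-i\theta},be^{i\theta},be^{-i\theta},ce^{i\theta},ce^{-i\theta},qe^{i\theta}/d,qe^{-i\theta}/d;q)_\infty\,(\alpha e^{i\theta},\alpha e^{-i\theta},qe^{i\theta}/\alpha,qe^{-i\theta}/\alpha;q)_\infty}\,d\theta=0 .$$ (ii) If $\mu=\nu$, then $$\int_0^{\pi}\frac{\bigl(v_\nu(\cos\theta;a,b,c;d)\bigr)^2\,(e^{2i\theta},e^{-2i\theta};q)_\infty}{(ae^{i\theta},ae^{-i\theta},be^{i\theta},be^{-i\theta},ce^{i\theta},ce^{-i\theta},qe^{i\theta}/d,qe^{-i\theta}/d;q)_\infty\,(\alpha e^{i\theta},\alpha e^{-i\theta},qe^{i\theta}/\alpha,qe^{-i\theta}/\alpha;q)_\infty}\,d\theta$$ $$=\frac{1}{(q,q,\alpha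 a,qa/\alpha,\alpha b,qb/\alpha,\alpha c,qc/\alpha,q\alpha/d,q^2/(\alpha d);q)_\infty}\cdot\frac{-4\pi q^{1/2}d}{1-q}\cdot\frac{\partial}{\partial\lambda_\nu}v_\nu(\eta;a,b,c;d)\cdot\left(\frac{\nabla}{\nabla x}v_\nu(x;a,b,c;d)\right)\Big|_{x=\eta}.$$
   Context: Notation: $(a;q)_n=\prod_{k=1}^n(1-aq^{k-1})$, $(a;q)_\infty=\prod_{k\ge1}(1-aq^{k-1})$, $(a_1,\dots,a_r;q)_n=\prod_{j=1}^r(a_j;q)_n$ for $n=0,1,2,\dots$ or $n=\infty$, and $${}_4\varphi_3\!\left(\begin{matrix}a_1,a_2,a_3,a_4\\ b_1,b_2,b_3\end{matrix};q,t\right)=\sum_{n=0}^\infty\frac{(a_1,a_2,a_3,a_4;q)_n}{(q,b_1,b_2,b_3;q)_n}t^n .$$ For complex $\nu$ and $x=x(z)=\tfrac12(q^z+q^{-z})$ (so $x=\cos\theta$ when $q^z=e^{i\theta}$), define $$v_\nu(x;a,b,c;d)=\frac{(bcq^\nu,\,q^{1-\nu}/(ad),\,q^{1+z}/d,\,q^{1-z}/d;q)_\infty}{(bc,\,q/(ad);q)_\infty}\;{}_4\varphi_3\!\left(\begin{matrix}q^{-\nu},abcdq^{\nu-1},aq^z,aq^{-z}\\ ab,ac,ad\end{matrix};q,q\right)$$ $$+\frac{(q^{-\nu},\,abcdq^{\nu-1},\,qb/d,\,qc/d,\,aq^z,\,aq^{-z};q)_\infty}{(ab,\,ac,\,bc,\,ad/q;q)_\infty}\;{}_4\varphi_3\!\left(\begin{matrix}q^{1-\nu}/(ad),\,bcq^\nu,\,q^{1+z}/d,\,q^{1-z}/d\\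 qb/d,\,qc/d,\,q^2/(ad)\end{matrix};q,q\right).$$ When $ad$ is an integer power of $q$ the individual terms are singular but the singularity of the sum is removable, and the value is taken by continuity in the parameters. For fixed $\nu$ this is an entire function of $z$, even in $z$. When $|bcq^\nu|<1$, $v_\nu$ is $(q^{1+z}/d,q^{1-z}/d;q)_\infty$ times the very-well-poised ${}_8\varphi_7$-function $$u_\nu(x;a,b,c;d)=\frac{(qa/d,bcq^\nu,q^{1-\nu+z}/d,q^{1-\nu-z}/d;q)_\infty}{(q^{1-\nu}a/d,bc,q^{1+z}/d,q^{1-z}/d;q)_\infty}\sum_{n\ge0}\frac{1-Aq^{2n}}{1-A}\,\frac{(A,q^{-\nu},q^{1-\nu}/(bd),q^{1-\nu}/(cd),aq^z,aq^{-z};q)_n}{(q,aq/d,ab,ac,q^{1-\nu-z}/d,q^{1-\nu+z}/d;q)_n}(bcq^\nu)^n,\quad A=\frac{aq^{-\nu}}{d}.$$ The eigenvalue is $$\lambda_\nu=\frac{4q^{3/2}}{(1-q)^2}(1-q^{-\nu})(1-abcdq^{\nu-1}).$$ The function $v_\nu$ depends on $\nu$ only through $\lambda_\nu$ (analytically), and $\partial/\partial\lambda_\nu$ denotes the derivative of $v_\nu$ with respect to this variable, the other parameters being fixed. The divided difference is $\frac{\nabla f(z)}{\nabla x(z)}=\frac{f(z)-f(z-1)}{x(z)-x(z-1)}$. The symbol $\left(\frac{\nabla}{\nabla x}v_\nu\right)\big|_{x=\eta}$ denotes its value at $z=\alpha_0$, i.e. $\dfrac{v_\nu(\eta;a,b,c;d)-v_\nu(\eta_-;a,b,c;d)}{\eta-\eta_-}$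 with $\eta_-=\tfrac12(\alpha/q+q/\alpha)$.
   Formalization: In (i), ''μ≠ν'' is replaced by λ_μ≠λ_ν: since v_ν depends on ν only through λ_ν, for instance μ=ν+2πi/ln q gives v_μ=v_ν, and the integral is then the generally nonzero value in (ii), so (i) fails as literally stated. *)

(* Defs.v *)
From Stdlib Require Import Reals ZArith List Lra ClassicalEpsilon.
From Coquelicot Require Import Coquelicot.
Import ListNotations.
Open Scope C_scope.

(* Limit of [f] along the filter [F]; an unspecified value if it does not exist. *)
Definition Clim {T : Type} (F : (T -> Prop) -> Prop) (f : T -> C) : C :=
  iota (fun l : C_CompleteNormedModule => filterlim f F (locally l)).

Definition Cseries (f : nat -> C) : C := Clim eventually (sum_n f).

(* q^z = exp (z ln q), for q > 0 and z complex *)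
Definition qpow (q : R) (z : C) : C :=
  (exp (Re z * ln q) * cos (Im z * ln q), exp (Re z * ln q) * sin (Im z * ln q))%R.

Fixpoint qpoch (q : R) (a : C) (n : nat) : C :=
  match n with
  | O => 1
  | S k => qpoch q a k * (1 - a * q ^ k)
  end.

Definition qpoch_inf (q : R) (a : C) : C := Clim eventually (qpoch q a).

(* (a_1, ..., a_r; q)_n and (a_1, ..., a_r; q)_oo *)
Definition qpochs (q : R) (l : list C) (n : nat) : C :=
  fold_right (fun a p => qpoch q a n * p) 1 l.

Definition qpochs_inf (q : R) (l : list C) : C :=
  fold_right (fun a p => qpoch_inf q a * p) 1 l.

Definition phi43 (q : R) (a1 a2 a3 a4 b1 b2 b3 t : C) : C :=
  Cseries (fun n =>
    qpochs q [a1; a2; a3; a4] n / qpochs q [RtoC q; b1; b2; b3] n * t ^ n).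

(* x(z) = (q^z + q^(-z)) / 2 *)
Definition qx (q : R) (z : C) : C := (qpow q z + qpow q (- z)) / 2.

(* Functions of the variable x are represented as functions of z, through
   x = x(z).  [v_formula] is the two-term expression for v_nu(x(z); a, b, c; d),
   meaningful only when a d is not an integer power of q. *)
Definition v_formula (q : R) (nu z a b c d : C) : C :=
  qpochs_inf q [b * c * qpow q nu; qpow q (1 - nu) / (a * d);
                qpow q (1 + z) / d; qpow q (1 - z) / d]
  / qpochs_inf q [b * c; q / (a * d)]
  * phi43 q (qpow q (- nu)) (a * b * c * d * qpow q (nu - 1))
            (a * qpow q z) (a * qpow q (- z))
            (a * b) (a * c) (a * d) q
  + qpochs_inf q [qpow q (- nu); a * b * c * d * qpow q (nu - 1);
                  q * b / d; q * c / d; a * qpow q z; a * qpow q (- z)]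
    / qpochs_inf q [a * b; a * c; b * c; a * d / q]
    * phi43 q (qpow q (1 - nu) / (a * d)) (b * c * qpow q nu)
              (qpow q (1 + z) / d) (qpow q (1 - z) / d)
              (q * b / d) (q * c / d) (q ^ 2 / (a * d)) q.

(* If a d is an integer power of q, the singularity of [v_formula] is removable
   and the value is the limit in the parameter d; for d' <> d close to d,
   a d' is not an integer power of q. *)
Definition v (q : R) (nu z a b c d : C) : C :=
  if excluded_middle_informative (exists k : Z, a * d = powerRZ q k)
  then Clim (locally' d) (v_formula q nu z a b c)
  else v_formula q nu z a b c d.

Definition lambda (q : R) (a b c d nu : C) : C :=
  4 * Rpower q (3 / 2) / (1 - q) ^ 2
  * (1 - qpow q (- nu)) * (1 - a * b * c * d * qpow q (nu - 1)).

(* [D] is the derivative at [nu], with respect to the variable lambda_nu, of a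
   function [F] of nu which depends on nu only through lambda_nu.  The function
   [G] is unique because nu |-> lambda_nu maps C onto C when a b c d <> 0. *)
Definition is_derive_lambda (q : R) (a b c d : C) (F : C -> C) (nu D : C) : Prop :=
  exists G : C -> C,
    (forall eps : C, F eps = G (lambda q a b c d eps)) /\
    is_derive (K := C_AbsRing) (V := C_NormedModule) G (lambda q a b c d nu) D.

(* The divided difference (nabla f / nabla x)(z) *)
Definition nabla_x (q : R) (f : C -> C) (z : C) : C :=
  (f z - f (z - 1)) / (qx q z - qx q (z - 1)).

Definition expi (theta : R) : C := (cos theta, sin theta).

(* The point z with q^z = e^(i theta), hence x(z) = cos theta *)
Definition z_of_theta (q theta : R) : C := (0, theta / ln q)%R.

Lemma qpow_z_of_theta (q theta : R) :
  (0 < q < 1)%R -> qpow q (z_of_theta q theta) = expi theta.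
Proof.
intros [q0 q1].
assert (hl : (ln q < 0)%R) by (rewrite <- ln_1; apply ln_increasing; lra).
unfold qpow, z_of_theta, expi, Re, Im; simpl.
replace (theta / ln q * ln q)%R with theta by (field; lra).
now rewrite Rmult_0_l, exp_0, !Rmult_1_l.
Qed.

Lemma qx_z_of_theta (q theta : R) :
  (0 < q < 1)%R -> qx q (z_of_theta q theta) = cos theta.
Proof.
intros hq.
assert (hN : - z_of_theta q theta = z_of_theta q (- theta)).
{ unfold z_of_theta, Copp; simpl; f_equal; unfold Rdiv; ring. }
unfold qx; rewrite hN, !qpow_z_of_theta by assumption.
unfold expi; rewrite cos_neg, sin_neg.
apply injective_projections; simpl; field.
Qed.

Definition weight (q : R) (a b c d alpha : C) (theta : R) : C :=
  let e := expi theta in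
  let e' := expi (- theta) in
  qpochs_inf q [expi (2 * theta); expi (- (2 * theta))]
  / (qpochs_inf q [a * e; a * e'; b * e; b * e'; c * e; c * e'; q * e / d; q * e' / d]
     * qpochs_inf q [alpha * e; alpha * e'; q * e / alpha; q * e' / alpha]).

(* Main.v *)
Require Import Defs.
From Stdlib Require Import Reals ZArith List Lra Lia FunctionalExtensionality ClassicalEpsilon.
From Coquelicot Require Import Coquelicot.
Import ListNotations.
Open Scope C_scope.

(** Write s = q/d, t = a/s = ad/q, zeta = q^z, X = q^(-nu), Y = abcd q^(nu-1)
and p = (X + Y)/a, which is an affine function of lambda_nu.

As a function of zeta, v_nu is invariant under zeta -> 1/zeta and satisfies an
Askey-Wilson second-order q-difference equation whose eigenvalue is affine in p
([aw_op_vsum]): applied to either of the two series the difference operator telescopes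
([aw_op_qterm]) to a boundary term, and the two boundary terms cancel.  If the equations of
v_mu and v_nu, with eigenvalues L_mu and L_nu, are multiplied crosswise by v_nu, v_mu
and by the weight w, they give
   (L_mu - L_nu) v_mu v_nu w = J(zeta) + J(1/zeta)      on |zeta| = 1,
where J is an explicit factor times the Casorati determinant
v_mu(q zeta) v_nu(zeta) - v_mu(zeta) v_nu(q zeta) ([flux_eq]).  Moreover
J(1/(q zeta)) = - J(zeta) ([flux_anti]), so the integral of J over |zeta| = 1 is half
the difference of its integrals over the circles of radii 1 and 1/q.  Between these
circles J has only the simple poles 1/alpha and alpha/q, which come from the alpha
factors of the weight and contribute equally.  The outcome ([casorati_integral]) is a multiple of
v_mu(eta_-) v_nu(eta) - v_mu(eta) v_nu(eta_-).  It is zero if both functions vanish at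
eta, which is (i).  If v_nu(eta) = 0, division by L_mu - L_nu and the limit
lambda_mu -> lambda_nu give (ii).

Every function that occurs is built from a few generators by sums, products,
convergent series and infinite products.  Analytic properties are therefore proved once,
for a complete normed algebra of functions ([FunAlg]), and read off in particular algebras.
Uniform limits of Laurent polynomials on an annulus ([Laur]) replace holomorphic
functions of zeta: the residue formula across a simple pole is checked on monomials and
passes to the limit ([pole_Laur]).  First-order Taylor expansions with coefficients in
an algebra ([Jet]) provide the derivative in p, uniformly in zeta.  Nesting a second such
expansion in tau = d'/d settles the case where ad is an integer power of q: up to a
nonzero constant, v is the quotient of a series [vsum] by a theta function with a simple zero
at tau = 1, and [vsum] vanishes there because the terms of its two halves cancel in pairs
([qterm_resonance]).  The expansion of [vsum] divided by tau - 1 is then an expansion of v. *)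

(** * Limits, series and products in C *)

(** Limits in the product topology of [C], in which [Clim] is taken. *)
Definition Cto {T : Type} (F : (T -> Prop) -> Prop) (f : T -> C) (l : C) : Prop :=
  filterlim f F (locally (T := C_UniformSpace) l).

Lemma Cto_eps {T} (F : (T -> Prop) -> Prop) {FF : Filter F} (f : T -> C) l :
  Cto F f l <-> forall eps : posreal, F (fun x => (Cmod (f x - l) < eps)%R).
Proof.
exact (filterlim_locally_ball_norm (K := C_AbsRing) (U := C_NormedModule) f l).
Qed.

Ltac filt := solve [apply eventually_filter | apply locally_filter | typeclasses eauto].

Lemma Cto_Clim {T} (F : (T -> Prop) -> Prop) {FF : ProperFilter F} (f : T -> C) l :
  Cto F f l -> Clim F f = l.
Proof. intros H; apply (iota_filterlim_locally (V := C_CompleteNormedModule)); exact H. Qed.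

Lemma Cto_unique {T} (F : (T -> Prop) -> Prop) {FF : ProperFilter F} (f : T -> C) l l' :
  Cto F f l -> Cto F f l' -> l = l'.
Proof. intros H H'; rewrite <- (Cto_Clim _ _ _ H); exact (Cto_Clim _ _ _ H'). Qed.

Lemma Cto_plus {T} (F : (T -> Prop) -> Prop) {FF : Filter F} (f g : T -> C) l m :
  Cto F f l -> Cto F g m -> Cto F (fun x => f x + g x) (l + m).
Proof.
intros Hf Hg.
eapply (filterlim_comp_2 f g Cplus); [exact Hf|exact Hg|].
exact (filterlim_plus (K := C_AbsRing) (V := C_NormedModule) l m).
Qed.

Lemma Cto_mult {T} (F : (T -> Prop) -> Prop) {FF : Filter F} (f g : T -> C) l m :
  Cto F f l -> Cto F g m -> Cto F (fun x => f x * g x) (l * m).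
Proof.
intros Hf Hg; apply Cto_eps; auto; intros [eps He].
set (A := (Cmod l + Cmod m + 1)%R).
assert (HA : (0 < A)%R) by (unfold A; pose proof (Cmod_ge_0 l); pose proof (Cmod_ge_0 m); lra).
assert (Hd : (0 < Rmin 1 (eps / A))%R) by (apply Rmin_pos; [lra|now apply Rdiv_lt_0_compat]).
generalize (filter_and _ _ (proj1 (Cto_eps F f l) Hf (mkposreal _ Hd))
                           (proj1 (Cto_eps F g m) Hg (mkposreal _ Hd))); simpl.
apply filter_imp; intros x [H1 H2].
set (e := Rmin 1 (eps / A)) in *.
assert (He1 : (e <= 1)%R) by apply Rmin_l.
assert (He2 : (e * A <= eps)%R).
{ pose proof (Rmin_r 1 (eps / A)) as H; fold e in H.
  apply Rmult_le_compat_r with (r := A) in H; [|lra].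
  replace (eps / A * A)%R with eps in H by (field; lra); lra. }
replace (f x * g x - l * m)
  with ((f x - l) * (g x - m) + (l * (g x - m) + m * (f x - l))) by ring.
eapply Rle_lt_trans; [apply Cmod_triangle|].
eapply Rle_lt_trans; [apply Rplus_le_compat_l, Cmod_triangle|].
rewrite !Cmod_mult.
pose proof (Cmod_ge_0 l); pose proof (Cmod_ge_0 m).
pose proof (Cmod_ge_0 (f x - l)); pose proof (Cmod_ge_0 (g x - m)).
assert (Cmod (f x - l) * Cmod (g x - m) < e * 1)%R by nra.
assert (Cmod l * Cmod (g x - m) <= Cmod l * e)%R by nra.
assert (Cmod m * Cmod (f x - l) <= Cmod m * e)%R by nra.
unfold A in He2; lra.
Qed.

Lemma Cto_const {T} (F : (T -> Prop) -> Prop) {FF : Filter F} c : Cto F (fun _ => c) c.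
Proof. apply filterlim_const. Qed.

Lemma Cto_ext {T} (F : (T -> Prop) -> Prop) {FF : Filter F} (f g : T -> C) l :
  F (fun x => f x = g x) -> Cto F f l -> Cto F g l.
Proof. apply filterlim_ext_loc. Qed.

Lemma Cto_scal {T} (F : (T -> Prop) -> Prop) {FF : Filter F} (f : T -> C) c l :
  Cto F f l -> Cto F (fun x => c * f x) (c * l).
Proof. intros; apply Cto_mult; auto; now apply Cto_const. Qed.

Lemma Cto_minus {T} (F : (T -> Prop) -> Prop) {FF : Filter F} (f g : T -> C) l m :
  Cto F f l -> Cto F g m -> Cto F (fun x => f x - g x) (l - m).
Proof.
intros Hf Hg; apply Cto_plus; auto.
apply Cto_ext with (f := fun x => (-1) * g x); [exact FF|apply filter_forall; intro; ring|].
replace (- m) with ((-1) * m) by ring; now apply Cto_scal.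
Qed.

Lemma Cmod_tri_inv (x y : C) : (Cmod x - Cmod y <= Cmod (x - y))%R.
Proof.
pose proof (Cmod_triangle (x - y) y) as H.
replace (x - y + y) with x in H by ring; lra.
Qed.

Lemma Cto_inv {T} (F : (T -> Prop) -> Prop) {FF : Filter F} (f : T -> C) (l : C) :
  l <> 0 -> Cto F f l -> Cto F (fun x => / f x) (/ l).
Proof.
intros Hl Hf; apply Cto_eps; auto; intros eps.
assert (pl : (0 < Cmod l)%R) by (apply Cmod_gt_0; exact Hl).
assert (He : (0 < Rmin (Cmod l / 2) (eps * (Cmod l * Cmod l / 2)))%R).
{ apply Rmin_pos; [lra|]. apply Rmult_lt_0_compat; [apply eps|].
  apply Rmult_lt_0_compat; [|lra]. apply Rmult_lt_0_compat; lra. }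
generalize (proj1 (Cto_eps F f l) Hf (mkposreal _ He)); simpl.
apply filter_imp; intros x Hx.
assert (H1 := Rlt_le_trans _ _ _ Hx (Rmin_l _ _)).
assert (H2 := Rlt_le_trans _ _ _ Hx (Rmin_r _ _)).
assert (H3 : (Cmod l / 2 < Cmod (f x))%R).
{ pose proof (Cmod_tri_inv l (l - f x)) as H.
  replace (l - (l - f x)) with (f x) in H by ring.
  replace (l - f x) with (- (f x - l)) in H by ring; rewrite Cmod_opp in H; lra. }
assert (Hfx : f x <> 0) by (intro E; rewrite E, Cmod_0 in H3; lra).
replace (/ f x - / l) with (- (f x - l) / (f x * l)) by (field; auto).
rewrite Cmod_div, Cmod_opp, Cmod_mult by now apply Cmult_neq_0.
apply Rmult_lt_reg_r with (Cmod (f x) * Cmod l)%R; [apply Rmult_lt_0_compat; lra|].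
unfold Rdiv; rewrite Rmult_assoc, Rinv_l, Rmult_1_r
  by (apply Rgt_not_eq, Rmult_lt_0_compat; lra).
apply Rlt_le_trans with (1 := H2), Rmult_le_compat_l; [apply Rlt_le, eps|].
nra.
Qed.

Lemma Cto_bound {T} (F : (T -> Prop) -> Prop) {FF : ProperFilter F} (f : T -> C) l M :
  F (fun x => (Cmod (f x) <= M)%R) -> Cto F f l -> (Cmod l <= M)%R.
Proof.
intros Hb Hf; apply le_epsilon; intros eps He.
generalize (filter_and _ _ Hb (proj1 (Cto_eps F f l) Hf (mkposreal eps He))); simpl.
intros H; apply filter_ex in H; destruct H as [x [H1 H2]].
pose proof (Cmod_tri_inv l (l - f x)) as H.
replace (l - (l - f x)) with (f x) in H by ring.
replace (l - f x) with (- (f x - l)) in H by ring; rewrite Cmod_opp in H; lra.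
Qed.

Fixpoint csum (f : nat -> C) (n : nat) : C :=
  match n with O => 0 | S k => csum f k + f k end.

(** The factors are written [1 - f k], the shape of a q-shifted factorial. *)
Fixpoint pprod (f : nat -> C) (n : nat) : C :=
  match n with O => 1 | S k => pprod f k * (1 - f k) end.

Fixpoint rsum (f : nat -> R) (n : nat) : R :=
  match n with O => 0 | S k => rsum f k + f k end.

Definition has_sum (f : nat -> C) (l : C) : Prop := Cto eventually (csum f) l.

Lemma csum_sum_n f n : sum_n (G := C_AbelianMonoid) f n = csum f (S n).
Proof.
induction n as [|n IH]; [rewrite sum_O; symmetry; apply Cplus_0_l|].
rewrite sum_Sn, IH; reflexivity.
Qed.

Lemma rsum_sum_n f n : sum_n f n = rsum f (S n).
Proof.
induction n as [|n IH]; [rewrite sum_O; symmetry; apply Rplus_0_l|].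
rewrite sum_Sn, IH; reflexivity.
Qed.

Lemma Cto_shift (u : nat -> C) l :
  Cto eventually u l <-> Cto eventually (fun n => u (S n)) l.
Proof.
rewrite !Cto_eps by filt.
split; intros H eps; destruct (H eps) as [N HN].
- exists N; intros n Hn; apply HN; lia.
- exists (S N); intros [|n] Hn; [lia|]; apply HN; lia.
Qed.

Lemma has_sum_sum_n f l : has_sum f l <-> Cto eventually (sum_n (G := C_AbelianMonoid) f) l.
Proof.
unfold has_sum; rewrite Cto_shift; split; (apply Cto_ext; [filt|]);
  exists O; intros n _; [symmetry|]; apply csum_sum_n.
Qed.

Lemma has_sum_Cseries f l : has_sum f l -> Cseries f = l.
Proof.
intros H; apply has_sum_sum_n in H; unfold Cseries.
now apply Cto_Clim; [filt|].
Qed.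

Lemma has_sum_unique f l l' : has_sum f l -> has_sum f l' -> l = l'.
Proof. apply Cto_unique, eventually_filter. Qed.

Lemma csum_ext f g n : (forall k, (k < n)%nat -> f k = g k) -> csum f n = csum g n.
Proof.
induction n as [|n IH]; intros H; simpl; [easy|].
rewrite IH, H; auto.
Qed.

Lemma has_sum_ext f g l : (forall n, f n = g n) -> has_sum f l -> has_sum g l.
Proof.
intros H; apply Cto_ext; [filt|].
exists O; intros n _; now apply csum_ext.
Qed.

Lemma csum_plus f g n : csum (fun k => f k + g k) n = csum f n + csum g n.
Proof. induction n as [|n IH]; simpl; [ring|]. rewrite IH; ring. Qed.

Lemma csum_scal c f n : csum (fun k => c * f k) n = c * csum f n.
Proof. induction n as [|n IH]; simpl; [ring|]. rewrite IH; ring. Qed.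

Lemma has_sum_plus f g l m :
  has_sum f l -> has_sum g m -> has_sum (fun n => f n + g n) (l + m).
Proof.
intros Hf Hg; apply Cto_ext with (fun n => csum f n + csum g n);
  [filt| |apply Cto_plus; auto; filt].
exists O; intros n _; now rewrite csum_plus.
Qed.

Lemma has_sum_scal c f l : has_sum f l -> has_sum (fun n => c * f n) (c * l).
Proof.
intros Hf; apply Cto_ext with (fun n => c * csum f n);
  [filt| |apply Cto_scal; auto; filt].
exists O; intros n _; now rewrite csum_scal.
Qed.

Lemma csum_telescope (u : nat -> C) n : csum (fun k => u (S k) - u k) n = u n - u O.
Proof. induction n as [|n IH]; simpl; [ring|]. rewrite IH; ring. Qed.

Lemma rsum_le_series M S n :
  (forall k, (0 <= M k)%R) -> is_series M S -> (rsum M n <= S)%R.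
Proof.
intros HM HS.
assert (Hinc : forall k p, (rsum M k <= rsum M (p + k))%R).
{ intros k p; induction p as [|p IH]; simpl; [lra|]. specialize (HM (p + k)%nat); lra. }
assert (H : is_lim_seq (rsum M) S).
{ apply is_lim_seq_incr_1; eapply is_lim_seq_ext; [|exact HS].
  intros k; apply rsum_sum_n. }
apply (is_lim_seq_le_loc (fun _ => rsum M n) (rsum M) (rsum M n) S); auto.
- exists n; intros k Hk; replace k with ((k - n) + n)%nat by lia; apply Hinc.
- apply is_lim_seq_const.
Qed.

Lemma rsum_lim M S (eps : R) :
  is_series M S -> (0 < eps)%R -> exists n, (S - eps < rsum M n)%R.
Proof.
intros HS He.
assert (H : is_lim_seq (rsum M) S).
{ apply is_lim_seq_incr_1; eapply is_lim_seq_ext; [|exact HS].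
  intros k; apply rsum_sum_n. }
apply is_lim_seq_spec in H; destruct (H (mkposreal _ He)) as [n Hn]; simpl in Hn.
exists n; specialize (Hn n (le_n n)); apply Rabs_def2 in Hn; lra.
Qed.

Lemma csum_diff_bound f M n p :
  (forall k, (Cmod (f k) <= M k)%R) ->
  (Cmod (csum f (p + n) - csum f n) <= rsum M (p + n) - rsum M n)%R.
Proof.
intros H; induction p as [|p IH]; simpl.
- replace (csum f n - csum f n) with (RtoC 0) by ring; rewrite Cmod_0; lra.
- replace (csum f (p + n) + f (p + n)%nat - csum f n)
    with ((csum f (p + n) - csum f n) + f (p + n)%nat) by ring.
  eapply Rle_trans; [apply Cmod_triangle|]. specialize (H (p + n)%nat); lra.
Qed.

Lemma Cmod_pos_bound (f : nat -> C) M :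
  (forall k, (Cmod (f k) <= M k)%R) -> forall k, (0 <= M k)%R.
Proof. intros H k; eapply Rle_trans; [apply Cmod_ge_0|apply H]. Qed.

(** Weierstrass test with its remainder; the estimate is what makes the convergence uniform
in a parameter. *)
Lemma has_sum_tail f l M S n :
  (forall k, (Cmod (f k) <= M k)%R) -> is_series M S -> has_sum f l ->
  (Cmod (l - csum f n) <= S - rsum M n)%R.
Proof.
intros Hf HS Hl.
apply (Cto_bound eventually (fun k => csum f k - csum f n)).
- exists n; intros k Hk; replace k with ((k - n) + n)%nat by lia.
  eapply Rle_trans; [apply csum_diff_bound, Hf|].
  pose proof (rsum_le_series M S (k - n + n) (Cmod_pos_bound f M Hf) HS); lra.
- apply Cto_minus; [filt|exact Hl|].
  apply Cto_const, eventually_filter.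
Qed.

Lemma has_sum_bound f l M S :
  (forall k, (Cmod (f k) <= M k)%R) -> is_series M S -> has_sum f l -> (Cmod l <= S)%R.
Proof.
intros Hf HS Hl; generalize (has_sum_tail f l M S 0 Hf HS Hl); simpl.
replace (l - 0) with l by ring; intros; lra.
Qed.

Lemma has_sum_ex f M S :
  (forall k, (Cmod (f k) <= M k)%R) -> is_series M S -> exists l, has_sum f l.
Proof.
intros Hf HS.
destruct (ex_series_le (K := C_AbsRing) (V := C_CompleteNormedModule) f M Hf) as [l Hl];
  [now exists S|].
exists l; now apply has_sum_sum_n.
Qed.

(** * Complete normed algebras of functions *)

(** [nb B f M] reads: on the domain, [f] agrees with an element of norm at most [M] of a
complete normed algebra whose norm dominates the supremum.  [nb_series] is completeness;
since it only asks for pointwise convergence, limits can be identified pointwise. *)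
Record FunAlg (X : Type) := mkFunAlg {
  dom : X -> Prop;
  nb : (X -> C) -> R -> Prop;
  nb_ext : forall f g M, (forall x, dom x -> f x = g x) -> nb f M -> nb g M;
  nb_bound : forall f M, nb f M -> forall x, dom x -> (Cmod (f x) <= M)%R;
  nb_pos : forall f M, nb f M -> (0 <= M)%R;
  nb_le : forall f M M', nb f M -> (M <= M')%R -> nb f M';
  nb_const : forall c, nb (fun _ => c) (Cmod c);
  nb_plus : forall f g M M', nb f M -> nb g M' -> nb (fun x => f x + g x) (M + M');
  nb_mult : forall f g M M', nb f M -> nb g M' -> nb (fun x => f x * g x) (M * M');
  nb_series : forall (f : nat -> X -> C) F M S, (forall n, nb (f n) (M n)) ->
    is_series M S -> (forall x, dom x -> has_sum (fun n => f n x) (F x)) -> nb F S }.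

Arguments dom {X} _ _.
Arguments nb {X} _ _ _.
Arguments nb_ext {X} _ _ _ _ _ _.
Arguments nb_bound {X} _ _ _ _ _ _.
Arguments nb_pos {X} _ _ _ _.
Arguments nb_le {X} _ _ _ _ _ _.
Arguments nb_const {X} _ _.
Arguments nb_plus {X} _ _ _ _ _ _ _.
Arguments nb_mult {X} _ _ _ _ _ _ _.
Arguments nb_series {X} _ _ _ _ _ _ _ _.

Section AlgTheory.
Context {X : Type} (B : FunAlg X).

Lemma nb_one : nb B (fun _ => 1) 1.
Proof. apply (nb_le B _ (Cmod 1)); [apply nb_const|rewrite Cmod_1; lra]. Qed.

Lemma nb_scal c f M : nb B f M -> nb B (fun x => c * f x) (Cmod c * M).
Proof. intros H; exact (nb_mult B (fun _ => c) f _ _ (nb_const B c) H). Qed.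

Lemma nb_opp f M : nb B f M -> nb B (fun x => - f x) M.
Proof.
intros H; apply (nb_ext B (fun x => (-1) * f x)); [intros; ring|].
apply (nb_le B _ (Cmod (-1) * M)); [now apply nb_scal|].
rewrite Cmod_R, Rabs_left; lra.
Qed.

Lemma nb_minus f g M M' : nb B f M -> nb B g M' -> nb B (fun x => f x - g x) (M + M').
Proof. intros Hf Hg; apply nb_plus; [exact Hf|now apply nb_opp]. Qed.

Lemma nb_pow f M n : nb B f M -> nb B (fun x => f x ^ n) (M ^ n).
Proof.
intros H; induction n as [|n IH]; simpl.
- apply nb_one.
- now apply nb_mult.
Qed.

Lemma has_sum_geom (y : C) : (Cmod y < 1)%R -> has_sum (fun n => y ^ n) (/ (1 - y)).
Proof.
intros Hy.
assert (H1 : 1 - y <> 0).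
{ intros E; assert (Ey : y = 1) by (replace y with (1 - (1 - y)) by ring; rewrite E; ring).
  rewrite Ey, Cmod_1 in Hy; lra. }
apply Cto_ext with (fun n => / (1 - y) + (- / (1 - y)) * y ^ n).
- filt.
- exists O; intros n _; induction n as [|n IH]; simpl; [field; auto|].
  rewrite <- IH; field; auto.
- replace (/ (1 - y)) with (/ (1 - y) + (- / (1 - y)) * 0) at 1 by ring.
  apply Cto_plus; [filt|apply Cto_const, eventually_filter|].
  apply Cto_scal; [filt|].
  apply Cto_eps; [filt|]; intros [eps He]; simpl.
  destruct (pow_lt_1_zero (Cmod y)) with (y := eps) as [n Hn]; auto.
  { rewrite Rabs_pos_eq; auto; apply Cmod_ge_0. }
  exists n; intros k Hk; specialize (Hn k Hk).
  replace (y ^ k - 0) with (y ^ k) by ring; rewrite Cmod_pow.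
  now rewrite Rabs_pos_eq in Hn by (apply pow_le, Cmod_ge_0).
Qed.

Lemma is_series_geom_R (m : R) : (0 <= m < 1)%R -> is_series (fun n => (m ^ n)%R) (/ (1 - m))%R.
Proof. intros H; apply is_series_geom; rewrite Rabs_pos_eq; lra. Qed.

Lemma is_series_geom_M (M m : R) :
  (0 <= m < 1)%R -> is_series (fun n => (M * m ^ n)%R) (M / (1 - m))%R.
Proof. intros H; exact (is_series_scal (K := R_AbsRing) M _ _ (is_series_geom_R m H)). Qed.

Lemma nb_inv_1m f m : nb B f m -> (m < 1)%R -> nb B (fun x => / (1 - f x)) (/ (1 - m))%R.
Proof.
intros H Hm; pose proof (nb_pos B f m H) as H0.
apply (nb_series B (fun n x => f x ^ n) _ (fun n => (m ^ n)%R)).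
- intros n; now apply nb_pow.
- now apply is_series_geom_R.
- intros x Hx; apply has_sum_geom.
  pose proof (nb_bound B f m H x Hx); lra.
Qed.

Lemma pprod_S_diff u n :
  pprod u (S n) - pprod u n
  = - (pprod u n * u n).
Proof. simpl; ring. Qed.

(** Since 1 + M m^k <= exp (M m^k), this bounds every partial product of the factors 1 + M
m^k. *)
Definition pbound (M m : R) : R := exp (M / (1 - m)).

Lemma rsum_geom_le M m n :
  (0 <= M)%R -> (0 <= m < 1)%R -> (rsum (fun k => M * m ^ k)%R n <= M / (1 - m))%R.
Proof.
intros HM Hm; apply rsum_le_series; [|now apply is_series_geom_M].
intros k; apply Rmult_le_pos; auto; now apply pow_le.
Qed.

Lemma nb_pprod f M m n : (0 <= M)%R -> (0 <= m < 1)%R ->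
  (forall k, nb B (f k) (M * m ^ k)) ->
  nb B (fun x => pprod (fun k => f k x) n) (pbound M m).
Proof.
intros HM Hm H.
apply (nb_le B _ (exp (rsum (fun k => M * m ^ k)%R n))).
- induction n as [|n IH]; simpl.
  + rewrite exp_0; apply nb_one.
  + rewrite exp_plus; apply nb_mult; [exact IH|].
    apply (nb_le B _ (1 + M * m ^ n)); [|apply exp_ineq1_le].
    apply nb_minus; [|apply H]. apply nb_one.
- unfold pbound; destruct (rsum_geom_le M m n HM Hm) as [H1|H1].
  + now apply Rlt_le, exp_increasing.
  + rewrite H1; apply Rle_refl.
Qed.

End AlgTheory.

Definition iprod (f : nat -> C) : C := Clim eventually (pprod f).

(** Over a one-point type this algebra turns statements about norms into bounds on numbers.
*)
Definition Bdd {X} (D : X -> Prop) : FunAlg X.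
Proof.
refine (mkFunAlg X D (fun f M => (0 <= M)%R /\ forall x, D x -> (Cmod (f x) <= M)%R) _ _ _ _ _ _ _ _).
- intros f g M E [H0 H]; split; auto; intros x Hx; rewrite <- E; auto.
- now intros f M [_ H].
- now intros f M [H _].
- intros f M M' [H0 H] HM; split; [lra|]; intros x Hx; specialize (H x Hx); lra.
- intros c; split; [apply Cmod_ge_0|]; intros; apply Rle_refl.
- intros f g M M' [Hf0 Hf] [Hg0 Hg]; split; [lra|]; intros x Hx.
  eapply Rle_trans; [apply Cmod_triangle|]; apply Rplus_le_compat; auto.
- intros f g M M' [Hf0 Hf] [Hg0 Hg]; split; [now apply Rmult_le_pos|]; intros x Hx.
  rewrite Cmod_mult; apply Rmult_le_compat; auto; apply Cmod_ge_0.
- intros f F M S H HS HF; split.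
  + apply Rle_trans with (2 := rsum_le_series M S 0 (fun k => proj1 (H k)) HS); simpl; lra.
  + intros x Hx; apply (has_sum_bound (fun n => f n x) _ M S); auto.
    intros k; now apply H.
Defined.

(** The product converges because its successive increments are summable; the second part,
the product as 1 plus the sum of its increments, reduces membership of infinite products in
an algebra to completeness. *)
Lemma is_iprod f M m : (0 <= M)%R -> (0 <= m < 1)%R ->
  (forall k, (Cmod (f k) <= M * m ^ k)%R) ->
  Cto eventually (pprod f) (iprod f)
  /\ has_sum (fun n => - (pprod f n * f n)) (iprod f - 1).
Proof.
intros HM Hm Hf.
assert (Hn : forall n, (Cmod (- (pprod f n * f n))
                        <= pbound M m * M * m ^ n)%R).
{ intros n; rewrite Cmod_opp, Cmod_mult, Rmult_assoc.
  apply Rmult_le_compat; auto using Cmod_ge_0.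
  refine (nb_bound (Bdd (fun _ : unit => True)) _ _
            (nb_pprod (Bdd (fun _ => True)) (fun k (_ : unit) => f k) M m n HM Hm _) tt I).
  intros k; split; [apply Rmult_le_pos; auto; now apply pow_le|auto]. }
destruct (has_sum_ex _ _ _ Hn (is_series_geom_M _ m Hm)) as [l Hl].
assert (H : Cto eventually (pprod f) (l + 1)).
{ apply Cto_ext with (fun n => csum (fun n => - (pprod f n * f n)) n + 1).
  - filt.
  - exists O; intros n _.
    rewrite csum_ext with (g := fun n => pprod f (S n)
                                         - pprod f n)
      by (intros; now rewrite pprod_S_diff).
    rewrite csum_telescope; simpl; ring.
  - apply Cto_plus; auto; try filt; apply Cto_const, eventually_filter. }
unfold iprod; rewrite (Cto_Clim _ _ _ H); split; auto.
now replace (l + 1 - 1) with l by ring.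
Qed.

Definition ibound (M m : R) : R := (1 + pbound M m * M / (1 - m))%R.

Lemma nb_iprod {X} (B : FunAlg X) (f : nat -> X -> C) M m : (0 <= M)%R -> (0 <= m < 1)%R ->
  (forall k, nb B (f k) (M * m ^ k)) ->
  nb B (fun x => iprod (fun k => f k x)) (ibound M m).
Proof.
intros HM Hm Hf.
apply (nb_ext B (fun x => 1 + (iprod (fun k => f k x) - 1))); [intros; ring|].
apply nb_plus; [apply nb_one|].
apply (nb_series B (fun n x => - (pprod (fun k => f k x) n * f n x)) _
         (fun n => pbound M m * M * m ^ n)%R).
- intros n; apply nb_opp; rewrite Rmult_assoc; apply nb_mult; auto.
  now apply nb_pprod.
- now apply is_series_geom_M.
- intros x Hx; apply (is_iprod (fun k => f k x) M m); auto.
  intros k; now apply (nb_bound B (f k)).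
Qed.

(** * First-order Taylor expansions *)

(** The data of an expansion F(h, x) = j0 x + h j1 x + h^2 j2 h x and of the norms of its
coefficients. *)
Record jet (X : Type) := mkJet {
  j0 : X -> C; j1 : X -> C; j2 : C -> X -> C; n0 : R; n1 : R; n2 : R }.
Arguments mkJet {X}. Arguments j0 {X}. Arguments j1 {X}. Arguments j2 {X}.
Arguments n0 {X}. Arguments n1 {X}. Arguments n2 {X}.

Record is_jet {X} (B : FunAlg X) (r : R) (F : C * X -> C) (M : R) (w : jet X) : Prop := {
  jet0 : nb B (j0 w) (n0 w);
  jet1 : nb B (j1 w) (n1 w);
  jet2 : forall h, (Cmod h <= r)%R -> nb B (j2 w h) (n2 w);
  jet_norm : (n0 w + n1 w + n2 w <= M)%R;
  jet_eq : forall h x, (Cmod h <= r)%R -> dom B x ->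
    F (h, x) = j0 w x + h * (j1 w x + h * j2 w h x) }.

(** The norm n0 + n1 + n2 is submultiplicative because |h| <= 1.  If j0 = 0, then F / h has
the explicit limit j1 as h tends to 0, again an element of [B]; this is how derivatives and
removable singularities are handled. *)
Definition Jet {X} (B : FunAlg X) (r : R) (Hr : (0 < r <= 1)%R) : FunAlg (C * X).
Proof.
assert (H0 : (Cmod 0 <= r)%R) by (rewrite Cmod_0; lra).
refine (mkFunAlg (C * X) (fun p => (Cmod (fst p) <= r)%R /\ dom B (snd p))
  (fun F M => exists w, is_jet B r F M w) _ _ _ _ _ _ _ _).
- intros f g M E [w [H1 H2 H3 H4 H5]]; exists w; constructor; auto.
  intros h x Hh Hx; rewrite <- E; auto.
- intros f M [w [H1 H2 H3 H4 H5]] [h x] [Hh Hx]; simpl in Hh, Hx; rewrite H5 by auto.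
  pose proof (nb_bound B _ _ H1 x Hx); pose proof (nb_bound B _ _ H2 x Hx).
  pose proof (nb_bound B _ _ (H3 h Hh) x Hx).
  pose proof (Cmod_ge_0 h).
  pose proof (Cmod_ge_0 (j1 w x)); pose proof (Cmod_ge_0 (j2 w h x)).
  eapply Rle_trans; [apply Cmod_triangle|]; rewrite Cmod_mult.
  assert (Cmod (j1 w x + h * j2 w h x) <= n1 w + n2 w)%R.
  { eapply Rle_trans; [apply Cmod_triangle|]; rewrite Cmod_mult; nra. }
  pose proof (Cmod_ge_0 (j1 w x + h * j2 w h x)); nra.
- intros f M [w [H1 H2 H3 H4 H5]].
  pose proof (nb_pos B _ _ H1); pose proof (nb_pos B _ _ H2).
  pose proof (nb_pos B _ _ (H3 0 H0)); lra.
- intros f M M' [w [H1 H2 H3 H4 H5]] HM; exists w; constructor; auto; lra.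
- intros c; assert (Hz : nb B (fun _ => 0) 0)
    by (apply (nb_le B _ (Cmod 0)); [apply nb_const|rewrite Cmod_0; lra]).
  exists (mkJet (fun _ => c) (fun _ => 0) (fun _ _ => 0) (Cmod c) 0 0).
  constructor; simpl; auto; [apply nb_const|lra|]. intros; ring.
- intros f g M M' [v [H1 H2 H3 H4 H5]] [w [K1 K2 K3 K4 K5]].
  exists (mkJet (fun x => j0 v x + j0 w x) (fun x => j1 v x + j1 w x)
            (fun h x => j2 v h x + j2 w h x) (n0 v + n0 w) (n1 v + n1 w) (n2 v + n2 w)).
  constructor; simpl; try (intros; apply nb_plus; auto); [lra|].
  intros h x Hh Hx; rewrite H5, K5 by auto; ring.
- intros f g M M' [v [H1 H2 H3 H4 H5]] [w [K1 K2 K3 K4 K5]].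
  (* Collect the powers of h; terms beyond h^2 go into the last coefficient. *)
  exists (mkJet (fun x => j0 v x * j0 w x) (fun x => j0 v x * j1 w x + j1 v x * j0 w x)
            (fun h x => (j0 v x * j2 w h x + (j1 v x * j1 w x + j2 v h x * j0 w x))
               + h * ((j1 v x * j2 w h x + j2 v h x * j1 w x)
               + h * (j2 v h x * j2 w h x)))
           (n0 v * n0 w) (n0 v * n1 w + n1 v * n0 w)
           ((n0 v * n2 w + (n1 v * n1 w + n2 v * n0 w))
             + 1 * ((n1 v * n2 w + n2 v * n1 w) + 1 * (n2 v * n2 w)))).
  pose proof (nb_pos B _ _ H1); pose proof (nb_pos B _ _ H2).
  pose proof (nb_pos B _ _ (H3 0 H0)).
  pose proof (nb_pos B _ _ K1); pose proof (nb_pos B _ _ K2).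
  pose proof (nb_pos B _ _ (K3 0 H0)).
  constructor; simpl.
  + now apply nb_mult.
  + now apply nb_plus; apply nb_mult.
  + intros h Hh; specialize (H3 h Hh); specialize (K3 h Hh).
    assert (Hc : nb B (fun _ => h) 1)
      by (apply (nb_le B _ (Cmod h)); [apply nb_const|lra]).
    repeat first [apply (nb_plus B)|apply (nb_mult B)|assumption].
  + apply Rle_trans with ((n0 v + n1 v + n2 v) * (n0 w + n1 w + n2 w))%R; [right; ring|].
    apply Rmult_le_compat; auto; lra.
  + intros h x Hh Hx; rewrite H5, K5 by auto; ring.
- intros f F M S H HS HF.
  pose (w := fun n => proj1_sig (constructive_indefinite_description _ (H n))).
  assert (Hw : forall n, is_jet B r (f n) (M n) (w n))
    by (intros n; exact (proj2_sig (constructive_indefinite_description _ (H n)))).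
  clearbody w.
  assert (P0 : forall n, (0 <= n0 (w n))%R) by (intros n; exact (nb_pos B _ _ (jet0 _ _ _ _ _ (Hw n)))).
  assert (P1 : forall n, (0 <= n1 (w n))%R) by (intros n; exact (nb_pos B _ _ (jet1 _ _ _ _ _ (Hw n)))).
  assert (P2 : forall n, (0 <= n2 (w n))%R) by (intros n; exact (nb_pos B _ _ (jet2 _ _ _ _ _ (Hw n) 0 H0))).
  assert (PM : forall n, (n0 (w n) + n1 (w n) + n2 (w n) <= M n)%R)
    by (intros n; exact (jet_norm _ _ _ _ _ (Hw n))).
  assert (E : forall u, (forall n, (0 <= u n <= M n)%R) -> exists S', is_series u S').
  { intros u Hu; apply (ex_series_le (K := R_AbsRing) (V := R_CompleteNormedModule) u M).
    - intros n; change (Rabs (u n) <= M n)%R; rewrite Rabs_pos_eq; apply Hu.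
    - now exists S. }
  destruct (E (fun n => n0 (w n))) as [S0 HS0]; [intros n; specialize (P0 n); specialize (P1 n); specialize (P2 n); specialize (PM n); lra|].
  destruct (E (fun n => n1 (w n))) as [S1 HS1]; [intros n; specialize (P0 n); specialize (P1 n); specialize (P2 n); specialize (PM n); lra|].
  destruct (E (fun n => n2 (w n))) as [S2 HS2]; [intros n; specialize (P0 n); specialize (P1 n); specialize (P2 n); specialize (PM n); lra|].
  pose (lim := fun (u : nat -> C) => Clim eventually (csum u)).
  assert (Hlim : forall u m T, (forall n, (Cmod (u n) <= m n)%R) -> is_series m T -> has_sum u (lim u)).
  { intros u m T Hu HT; destruct (has_sum_ex u m T Hu HT) as [l Hl].
    unfold lim; rewrite (Cto_Clim eventually _ _ Hl); exact Hl. }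
  assert (L0 : forall x, dom B x -> has_sum (fun n => j0 (w n) x) (lim (fun n => j0 (w n) x))).
  { intros x Hx; apply (Hlim _ (fun n => n0 (w n)) S0); auto.
    intros n; exact (nb_bound B _ _ (jet0 _ _ _ _ _ (Hw n)) x Hx). }
  assert (L1 : forall x, dom B x -> has_sum (fun n => j1 (w n) x) (lim (fun n => j1 (w n) x))).
  { intros x Hx; apply (Hlim _ (fun n => n1 (w n)) S1); auto.
    intros n; exact (nb_bound B _ _ (jet1 _ _ _ _ _ (Hw n)) x Hx). }
  assert (L2 : forall h x, (Cmod h <= r)%R -> dom B x ->
             has_sum (fun n => j2 (w n) h x) (lim (fun n => j2 (w n) h x))).
  { intros h x Hh Hx; apply (Hlim _ (fun n => n2 (w n)) S2); auto.
    intros n; exact (nb_bound B _ _ (jet2 _ _ _ _ _ (Hw n) h Hh) x Hx). }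
  exists (mkJet (fun x => lim (fun n => j0 (w n) x)) (fun x => lim (fun n => j1 (w n) x))
            (fun h x => lim (fun n => j2 (w n) h x)) S0 S1 S2).
  constructor; simpl.
  + apply (nb_series B (fun n => j0 (w n)) _ (fun n => n0 (w n))); auto.
    intros n; exact (jet0 _ _ _ _ _ (Hw n)).
  + apply (nb_series B (fun n => j1 (w n)) _ (fun n => n1 (w n))); auto.
    intros n; exact (jet1 _ _ _ _ _ (Hw n)).
  + intros h Hh; apply (nb_series B (fun n => j2 (w n) h) _ (fun n => n2 (w n))); auto.
    intros n; exact (jet2 _ _ _ _ _ (Hw n) h Hh).
  + pose proof (is_series_plus _ _ _ _ (is_series_plus _ _ _ _ HS0 HS1) HS2) as HT.
    apply is_series_unique in HT; change (plus (plus S0 S1) S2) with (S0 + S1 + S2)%R in HT.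
    rewrite <- HT, <- (is_series_unique _ _ HS); apply Series_le; [|now exists S].
    intros n; specialize (P0 n); specialize (P1 n); specialize (P2 n); specialize (PM n).
    change (0 <= n0 (w n) + n1 (w n) + n2 (w n) <= M n)%R; lra.
  + intros h x Hh Hx; apply (has_sum_unique (fun n => f n (h, x))); [apply HF; simpl; auto|].
    apply has_sum_ext with (fun n => j0 (w n) x + h * (j1 (w n) x + h * j2 (w n) h x)).
    * intros n; symmetry; apply (jet_eq _ _ _ _ _ (Hw n)); auto.
    * apply has_sum_plus; auto. apply has_sum_scal, has_sum_plus; auto. now apply has_sum_scal, L2.
Defined.

(** * Uniform limits of Laurent polynomials *)

(** Two natural exponents stand for one integer exponent. *)
Inductive laurent : (C -> C) -> Prop :=
| laurent_mono c m n : laurent (fun z => c * (z ^ m * (/ z) ^ n))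
| laurent_plus f g : laurent f -> laurent g -> laurent (fun z => f z + g z).

Definition annulus (r1 r2 : R) (z : C) : Prop := (r1 <= Cmod z <= r2)%R.

Lemma laurent_mult f g : laurent f -> laurent g ->
  exists h, laurent h /\ forall z, h z = f z * g z.
Proof.
intros Hf Hg; induction Hf as [c m n|f1 f2 _ [h1 [H1 E1]] _ [h2 [H2 E2]]].
- induction Hg as [c' m' n'|g1 g2 _ [h1 [H1 E1]] _ [h2 [H2 E2]]].
  + exists (fun z => (c * c') * (z ^ (m + m') * (/ z) ^ (n + n'))).
    split; [constructor|]; intros z; rewrite !Cpow_add_r; ring.
  + exists (fun z => h1 z + h2 z); split; [now constructor|].
    intros z; rewrite E1, E2; ring.
- exists (fun z => h1 z + h2 z); split; [now constructor|].
  intros z; rewrite E1, E2; ring.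
Qed.

Lemma laurent_sum (f : nat -> C -> C) n : (forall k, laurent (f k)) ->
  laurent (fun z => csum (fun k => f k z) n).
Proof.
intros H; induction n as [|n IH]; simpl; [|now constructor].
assert (E : (fun _ : C => RtoC 0) = (fun z => 0 * (z ^ 0 * (/ z) ^ 0))).
{ apply functional_extensionality; intros; simpl; ring. }
rewrite E; constructor.
Qed.

(** The closure of the Laurent polynomials for the supremum norm on an annulus. *)
Definition Laur (r1 r2 : R) : FunAlg C.
Proof.
refine (mkFunAlg C (annulus r1 r2)
  (fun f M => (0 <= M)%R /\ (forall z, annulus r1 r2 z -> (Cmod (f z) <= M)%R) /\
     forall eps, (0 < eps)%R -> exists p, laurent p /\
       forall z, annulus r1 r2 z -> (Cmod (f z - p z) <= eps)%R) _ _ _ _ _ _ _ _).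
- intros f g M E [H0 [H1 H2]]; split; [auto|split].
  + intros z Hz; rewrite <- E; auto.
  + intros eps He; destruct (H2 eps He) as [p [Hp H]]; exists p; split; auto.
    intros z Hz; rewrite <- E; auto.
- intros f M [H0 [H1 H2]]; exact H1.
- intros f M [H0 [H1 H2]]; exact H0.
- intros f M M' [H0 [H1 H2]] HM; split; [lra|split]; auto.
  intros z Hz; specialize (H1 z Hz); lra.
- intros c; split; [apply Cmod_ge_0|split; [intros; apply Rle_refl|]].
  intros eps He; exists (fun z => c * (z ^ 0 * (/ z) ^ 0)); split; [constructor|].
  intros z Hz; simpl; replace (c - c * (1 * 1)) with (RtoC 0) by ring; rewrite Cmod_0; lra.
- intros f g M M' [H0 [H1 H2]] [K0 [K1 K2]]; split; [lra|split].
  + intros z Hz; eapply Rle_trans; [apply Cmod_triangle|]; apply Rplus_le_compat; auto.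
  + intros eps He; destruct (H2 (eps / 2)%R) as [p [Hp H]]; [lra|].
    destruct (K2 (eps / 2)%R) as [p' [Hp' K]]; [lra|].
    exists (fun z => p z + p' z); split; [now constructor|].
    intros z Hz; replace (f z + g z - (p z + p' z)) with ((f z - p z) + (g z - p' z)) by ring.
    eapply Rle_trans; [apply Cmod_triangle|]; specialize (H z Hz); specialize (K z Hz); lra.
- intros f g M M' [H0 [H1 H2]] [K0 [K1 K2]]; split; [now apply Rmult_le_pos|split].
  + intros z Hz; rewrite Cmod_mult; apply Rmult_le_compat; auto; apply Cmod_ge_0.
  + intros eps He.
    set (e := Rmin 1 (eps / (M + M' + 1))).
    assert (HMM : (0 < M + M' + 1)%R) by lra.
    assert (He0 : (0 < e)%R) by (apply Rmin_pos; [lra|now apply Rdiv_lt_0_compat]).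
    assert (He1 : (e <= 1)%R) by apply Rmin_l.
    assert (He2 : (e * (M + M' + 1) <= eps)%R).
    { pose proof (Rmin_r 1 (eps / (M + M' + 1))) as Hm; fold e in Hm.
      apply Rmult_le_compat_r with (r := (M + M' + 1)%R) in Hm; [|lra].
      replace (eps / (M + M' + 1) * (M + M' + 1))%R with eps in Hm by (field; lra); lra. }
    destruct (H2 e He0) as [p [Hp H]]; destruct (K2 e He0) as [p' [Hp' K]].
    destruct (laurent_mult p p' Hp Hp') as [h [Hh E]]; exists h; split; auto.
    intros z Hz; rewrite E.
    specialize (H z Hz); specialize (K z Hz); specialize (H1 z Hz); specialize (K1 z Hz).
    replace (f z * g z - p z * p' z)
      with (f z * (g z - p' z) + (g z * (f z - p z) + - ((f z - p z) * (g z - p' z)))) by ring.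
    eapply Rle_trans; [apply Cmod_triangle|].
    eapply Rle_trans; [apply Rplus_le_compat_l, Cmod_triangle|].
    rewrite Cmod_opp, !Cmod_mult.
    pose proof (Cmod_ge_0 (f z)); pose proof (Cmod_ge_0 (g z)).
    pose proof (Cmod_ge_0 (f z - p z)); pose proof (Cmod_ge_0 (g z - p' z)).
    assert (Cmod (f z) * Cmod (g z - p' z) <= M * e)%R by (apply Rmult_le_compat; auto).
    assert (Cmod (g z) * Cmod (f z - p z) <= M' * e)%R by (apply Rmult_le_compat; auto).
    assert (Cmod (f z - p z) * Cmod (g z - p' z) <= 1 * e)%R by (apply Rmult_le_compat; lra).
    lra.
- intros f F M S H HS HF.
  assert (PM : forall n, (0 <= M n)%R) by (intros n; apply (H n)).
  split; [|split].
  + apply Rle_trans with (2 := rsum_le_series M S 0 PM HS); simpl; lra.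
  + intros z Hz; apply (has_sum_bound (fun n => f n z) _ M S); auto.
    intros k; now apply H.
  + intros eps He.
    (* Cut the series at n, then approximate each of the n remaining terms within eps / (2 (n + 1)). *)
    destruct (rsum_lim M S (eps / 2) HS) as [n Hn]; [lra|].
    assert (Hp : forall k, exists p, laurent p /\ forall z, annulus r1 r2 z ->
               (Cmod (f k z - p z) <= (eps / 2) / (INR n + 1))%R).
    { intros k; apply (H k). apply Rdiv_lt_0_compat; [lra|]. pose proof (pos_INR n); lra. }
    pose (p := fun k => proj1_sig (constructive_indefinite_description _ (Hp k))).
    assert (Hp1 : forall k, laurent (p k) /\ forall z, annulus r1 r2 z ->
               (Cmod (f k z - p k z) <= (eps / 2) / (INR n + 1))%R)
      by (intros k; exact (proj2_sig (constructive_indefinite_description _ (Hp k)))).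
    clearbody p.
    exists (fun z => csum (fun k => p k z) n); split; [apply laurent_sum; apply Hp1|].
    intros z Hz.
    assert (T1 : (Cmod (F z - csum (fun k => f k z) n) <= S - rsum M n)%R).
    { apply (has_sum_tail (fun k => f k z)); auto. intros k; now apply H. }
    assert (T2 : forall j, (Cmod (csum (fun k => f k z) j - csum (fun k => p k z) j)
                  <= INR j * ((eps / 2) / (INR n + 1)))%R).
    { induction j as [|j IH]; [simpl; replace (0 - 0) with (RtoC 0) by ring; rewrite Cmod_0; lra|].
      rewrite S_INR; simpl csum.
      match goal with |- (Cmod (?a + ?b - (?c + ?d)) <= _)%R =>
        replace (a + b - (c + d)) with ((a - c) + (b - d)) by ring end.
      eapply Rle_trans; [apply Cmod_triangle|].
      pose proof (proj2 (Hp1 j) z Hz); lra. }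
    specialize (T2 n).
    assert (T3 : (INR n * ((eps / 2) / (INR n + 1)) <= eps / 2)%R).
    { pose proof (pos_INR n).
      apply Rmult_le_reg_r with (INR n + 1)%R; [lra|].
      replace (INR n * (eps / 2 / (INR n + 1)) * (INR n + 1))%R with (INR n * (eps / 2))%R
        by (field; lra). nra. }
    replace (F z - csum (fun k => p k z) n) with
      ((F z - csum (fun k => f k z) n) + (csum (fun k => f k z) n - csum (fun k => p k z) n)) by ring.
    eapply Rle_trans; [apply Cmod_triangle|]; lra.
Defined.

(** * Integrals over circles *)

Lemma norm_C_R (z : C) : norm (K := R_AbsRing) (V := C_R_NormedModule) z = Cmod z.
Proof.
unfold norm; simpl; unfold prod_norm, Cmod; f_equal.
change (norm (fst z)) with (Rabs (fst z)); change (norm (snd z)) with (Rabs (snd z)).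
now rewrite <- !(pow2_abs (fst z)), <- !(pow2_abs (snd z)).
Qed.

Lemma expi_plus s t : expi (s + t) = expi s * expi t.
Proof. unfold expi; rewrite cos_plus, sin_plus; apply injective_projections; simpl; ring. Qed.

Lemma expi_0 : expi 0 = 1.
Proof. unfold expi; now rewrite cos_0, sin_0. Qed.

Lemma Cmod_expi t : Cmod (expi t) = 1%R.
Proof.
unfold Cmod, expi; simpl fst; simpl snd.
replace (cos t ^ 2 + sin t ^ 2)%R with 1%R
  by (pose proof (sin2_cos2 t) as H; unfold Rsqr in H; simpl; lra).
apply sqrt_1.
Qed.

Lemma expi_neq_0 t : expi t <> 0.
Proof. apply Cmod_gt_0; rewrite Cmod_expi; lra. Qed.

Lemma expi_neg t : expi (- t) = / expi t.
Proof.
assert (H : expi (- t) * expi t = 1)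
  by (rewrite <- expi_plus; replace (- t + t)%R with 0%R by ring; apply expi_0).
replace (expi (- t)) with (expi (- t) * expi t / expi t) by (field; apply expi_neq_0).
rewrite H; field; apply expi_neq_0.
Qed.

Lemma expi_pow t n : expi t ^ n = expi (INR n * t).
Proof.
induction n as [|n IH]; [simpl; rewrite Rmult_0_l; now rewrite expi_0|].
rewrite S_INR, Cpow_S, IH, <- expi_plus; f_equal; ring.
Qed.

Definition circ (r t : R) : C := r * expi t.

Lemma Cmod_circ r t : (0 <= r)%R -> Cmod (circ r t) = r.
Proof. intros H; unfold circ; rewrite Cmod_mult, Cmod_expi, Cmod_R, Rabs_pos_eq; lra. Qed.

Lemma circ_neq_0 r t : (0 < r)%R -> circ r t <> 0.
Proof. intros H; apply Cmod_gt_0; rewrite Cmod_circ; lra. Qed.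

Lemma Cmod_le_sum (x y : R) : (Cmod (x, y) <= Rabs x + Rabs y)%R.
Proof.
replace (x, y) with ((x, 0%R) + (0%R, y)) by (apply injective_projections; simpl; ring).
eapply Rle_trans; [apply Cmod_triangle|apply Rplus_le_compat]; unfold Cmod; simpl fst; simpl snd;
  [replace (x ^ 2 + 0 ^ 2)%R with (Rsqr x) by (unfold Rsqr; ring)
  |replace (0 ^ 2 + y ^ 2)%R with (Rsqr y) by (unfold Rsqr; ring)];
  rewrite sqrt_Rsqr_abs; apply Rle_refl.
Qed.

Lemma Cto_expi t : Cto (locally t) expi (expi t).
Proof.
apply Cto_eps; [filt|]; intros [eps He]; simpl.
assert (He2 : (0 < eps / 2)%R) by lra.
generalize (filter_and _ _
  (proj1 (filterlim_locally cos (cos t)) (continuous_cos t) (mkposreal _ He2))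
  (proj1 (filterlim_locally sin (sin t)) (continuous_sin t) (mkposreal _ He2))).
apply filter_imp; intros x [H1 H2].
change (Rabs (cos x - cos t) < eps / 2)%R in H1.
change (Rabs (sin x - sin t) < eps / 2)%R in H2.
apply Rle_lt_trans with (Rabs (cos x - cos t) + Rabs (sin x - sin t))%R;
  [apply (Cmod_le_sum (cos x - cos t) (sin x - sin t))|lra].
Qed.

Lemma laurent_cont p r t : (0 < r)%R -> laurent p ->
  Cto (locally t) (fun x => p (circ r x)) (p (circ r t)).
Proof.
intros Hr Hp; induction Hp as [c m n|f g _ IHf _ IHg].
- assert (H1 : Cto (locally t) (circ r) (circ r t))
    by (apply Cto_scal; [filt|apply Cto_expi]).
  assert (H2 : Cto (locally t) (fun x => / circ r x) (/ circ r t))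
    by (apply Cto_inv; auto; [filt|now apply circ_neq_0]).
  apply Cto_scal; [filt|].
  apply Cto_mult; [filt| |].
  + induction m as [|m IH]; simpl; [apply Cto_const, locally_filter|].
    apply Cto_mult; auto; filt.
  + induction n as [|n IH]; simpl; [apply Cto_const, locally_filter|].
    apply Cto_mult; auto; filt.
- apply Cto_plus; auto; filt.
Qed.

(** Three-epsilon argument along the approximating Laurent polynomials. *)
Lemma Laur_cont r1 r2 f M r t : nb (Laur r1 r2) f M -> (0 < r)%R -> (r1 <= r <= r2)%R ->
  Cto (locally t) (fun x => f (circ r x)) (f (circ r t)).
Proof.
intros [_ [_ H]] Hr Hr12; apply Cto_eps; [filt|]; intros [eps He]; simpl.
destruct (H (eps / 3)%R) as [p [Hp Hf]]; [lra|].
assert (He3 : (0 < eps / 3)%R) by lra.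
generalize (proj1 (Cto_eps _ _ _) (laurent_cont p r t Hr Hp) (mkposreal _ He3)); simpl.
apply filter_imp; intros x Hx.
assert (Hc : forall y, (Cmod (f (circ r y) - p (circ r y)) <= eps / 3)%R)
  by (intros y; apply Hf; unfold annulus; rewrite Cmod_circ; lra).
pose proof (Hc x) as Hcx; pose proof (Hc t) as Hct.
rewrite <- Cmod_opp in Hct.
replace (f (circ r x) - f (circ r t)) with
  ((f (circ r x) - p (circ r x)) + ((p (circ r x) - p (circ r t)) + - (f (circ r t) - p (circ r t))))
  by ring.
eapply Rle_lt_trans; [apply Cmod_triangle|].
eapply Rle_lt_trans; [apply Rplus_le_compat_l, Cmod_triangle|]; lra.
Qed.

Definition cRInt (f : R -> C) (a b : R) (l : C) : Prop :=
  is_RInt (V := C_R_NormedModule) f a b l.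

Lemma cRInt_ex f a b : (forall t, Cto (locally t) f (f t)) -> exists l, cRInt f a b l.
Proof.
intros H; apply (ex_RInt_continuous (V := C_R_CompleteNormedModule)); intros t _; apply H.
Qed.

Lemma cRInt_plus f g a b l m :
  cRInt f a b l -> cRInt g a b m -> cRInt (fun t => f t + g t) a b (l + m).
Proof. intros; now apply (is_RInt_plus (V := C_R_NormedModule)). Qed.

Lemma cRInt_scal c f a b l : cRInt f a b l -> cRInt (fun t => c * f t) a b (c * l).
Proof.
intros H.
pose proof (is_RInt_fct_extend_fst (U := R_NormedModule) (V := R_NormedModule) f a b l H) as H1.
pose proof (is_RInt_fct_extend_snd (U := R_NormedModule) (V := R_NormedModule) f a b l H) as H2.
unfold cRInt.
apply (is_RInt_fct_extend_pair (U := R_NormedModule) (V := R_NormedModule)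
         (fun t => c * f t) a b); simpl.
- apply (is_RInt_minus (V := R_NormedModule)); now apply (is_RInt_scal (V := R_NormedModule)).
- apply (is_RInt_plus (V := R_NormedModule)); now apply (is_RInt_scal (V := R_NormedModule)).
Qed.

Lemma cRInt_ext f g a b l : (forall t, f t = g t) -> cRInt f a b l -> cRInt g a b l.
Proof. intros H; apply is_RInt_ext; auto. Qed.

Lemma cRInt_bound f a b l M : (a <= b)%R -> (forall t, (Cmod (f t) <= M)%R) ->
  cRInt f a b l -> (Cmod l <= (b - a) * M)%R.
Proof.
intros Hab Hf H; rewrite <- norm_C_R.
apply (norm_RInt_le_const (V := C_R_NormedModule) f a b); auto.
intros x _; rewrite norm_C_R; auto.
Qed.

Lemma cRInt_unique f a b l l' : cRInt f a b l -> cRInt f a b l' -> l = l'.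
Proof.
intros H H'.
rewrite <- (is_RInt_unique (V := C_R_CompleteNormedModule) _ _ _ _ H).
apply (is_RInt_unique (V := C_R_CompleteNormedModule) _ _ _ _ H').
Qed.

Lemma cRInt_neg f a b l : cRInt f a b l -> cRInt (fun t => f (- t)%R) (- b) (- a) l.
Proof.
intros H.
assert (H1 : is_RInt (V := C_R_NormedModule) f (- - a) (- - b) l) by now rewrite !Ropp_involutive.
apply (is_RInt_comp_opp (V := C_R_NormedModule)) in H1.
apply (is_RInt_swap (V := C_R_NormedModule)) in H1.
apply (is_RInt_opp (V := C_R_NormedModule)) in H1.
rewrite opp_opp in H1.
eapply is_RInt_ext; [|exact H1].
intros x _; simpl; rewrite opp_opp; reflexivity.
Qed.

(** The measure is the angle, so this is the contour integral of f(z) dz/(iz). *)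
Definition cint (r : R) (f : C -> C) (l : C) : Prop :=
  cRInt (fun t => f (circ r t)) (- PI) PI l.

Lemma cint_ex r1 r2 f M r : nb (Laur r1 r2) f M -> (0 < r)%R -> (r1 <= r <= r2)%R ->
  exists l, cint r f l.
Proof. intros; apply cRInt_ex; intros t; now apply (Laur_cont r1 r2 f M). Qed.

Lemma cint_bound r f l M : (0 <= r)%R -> (forall z, Cmod z = r -> (Cmod (f z) <= M)%R) ->
  cint r f l -> (Cmod l <= 2 * PI * M)%R.
Proof.
intros Hr Hf H; replace (2 * PI * M)%R with ((PI - - PI) * M)%R by ring.
apply (cRInt_bound (fun t => f (circ r t))); auto.
- pose proof PI_RGT_0; lra.
- intros t; apply Hf; now apply Cmod_circ.
Qed.

Lemma cint_ext r f g l : (0 <= r)%R -> (forall z, Cmod z = r -> f z = g z) ->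
  cint r f l -> cint r g l.
Proof. intros Hr H; apply cRInt_ext; intros t; apply H; now apply Cmod_circ. Qed.

Lemma cRInt_const c a b : cRInt (fun _ => c) a b ((b - a)%R * c).
Proof.
replace ((b - a)%R * c) with (scal (V := C_R_NormedModule) (b - a)%R c).
- apply (is_RInt_const (V := C_R_NormedModule)).
- apply injective_projections; simpl; unfold scal; simpl; unfold mult; simpl; ring.
Qed.

Lemma cRInt_expi (k : Z) : k <> 0%Z -> cRInt (fun t => expi (IZR k * t)) (- PI) PI 0.
Proof.
intros Hk; assert (Hk' : IZR k <> 0%R) by now apply IZR_neq.
assert (Hs : sin (IZR k * PI) = 0%R) by (apply sin_eq_0_1; now exists k).
unfold cRInt; apply (is_RInt_fct_extend_pair (U := R_NormedModule) (V := R_NormedModule)); simpl.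
- replace 0%R with (minus (sin (IZR k * PI) / IZR k) (sin (IZR k * - PI) / IZR k))%R.
  + apply (is_RInt_derive (V := R_CompleteNormedModule) (fun t => sin (IZR k * t) / IZR k)%R).
    * intros x _; auto_derive; auto; field; auto.
    * intros x _; apply (continuous_comp (fun t => IZR k * t)%R cos);
        [|apply continuous_cos].
      apply (continuous_scal_r (V := R_NormedModule) (IZR k) (fun t => t)), continuous_id.
  + rewrite Ropp_mult_distr_r_reverse, sin_neg, Hs; unfold minus, plus, opp; simpl; field; auto.
- replace 0%R with (minus (- cos (IZR k * PI) / IZR k) (- cos (IZR k * - PI) / IZR k))%R.
  + apply (is_RInt_derive (V := R_CompleteNormedModule) (fun t => - cos (IZR k * t) / IZR k)%R).
    * intros x _; auto_derive; auto; field; auto.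
    * intros x _; apply (continuous_comp (fun t => IZR k * t)%R sin);
        [|apply continuous_sin].
      apply (continuous_scal_r (V := R_NormedModule) (IZR k) (fun t => t)), continuous_id.
  + rewrite Ropp_mult_distr_r_reverse, cos_neg; unfold minus, plus, opp; simpl; field; auto.
Qed.

(** The integral of z^m z^(-n) over a circle centred at 0, whatever its radius. *)
Definition delta (m n : nat) : C := if Nat.eq_dec m n then 2 * PI else 0.

Lemma cint_mono r m n : (0 < r)%R -> cint r (fun z => z ^ m * (/ z) ^ n) (delta m n).
Proof.
intros Hr; unfold delta, cint.
destruct (Nat.eq_dec m n) as [<-|Hmn].
- apply cRInt_ext with (fun _ => 1).
  + intros t; rewrite <- Cpow_mult_l, Cinv_r, Cpow_1_l; auto; now apply circ_neq_0.
  + replace (2 * PI) with ((PI - - PI)%R * 1)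
      by (rewrite RtoC_minus, RtoC_opp; ring).
    apply cRInt_const.
- apply cRInt_ext with (fun t => (r ^ m * (/ r) ^ n) * expi (IZR (Z.of_nat m - Z.of_nat n) * t)).
  + intros t; unfold circ.
    assert (Hr' : RtoC r <> 0) by (intros E; apply RtoC_inj in E; lra).
    replace (/ (r * expi t)) with (/ r * expi (- t))
      by (rewrite expi_neg; field; split; auto; apply expi_neq_0).
    rewrite !Cpow_mult_l, !expi_pow.
    replace (IZR (Z.of_nat m - Z.of_nat n) * t)%R with (INR m * t + INR n * - t)%R
      by (rewrite minus_IZR, <- !INR_IZR_INZ; ring).
    rewrite expi_plus; ring.
  + replace (RtoC 0) with ((r ^ m * (/ r) ^ n) * 0) by ring.
    apply cRInt_scal, cRInt_expi; lia.
Qed.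

(** * The residue formula across a simple pole *)

Lemma nb_id r1 r2 : (0 <= r2)%R -> nb (Laur r1 r2) (fun z => z) r2.
Proof.
intros H; split; [auto|split]; [intros z Hz; apply Hz|].
intros eps He; exists (fun z => 1 * (z ^ 1 * (/ z) ^ 0)); split; [constructor|].
intros z _; simpl; replace (z - 1 * (z * 1 * 1)) with (RtoC 0) by ring; rewrite Cmod_0; lra.
Qed.

Lemma nb_cinv r1 r2 : (0 < r1)%R -> nb (Laur r1 r2) (fun z => / z) (/ r1)%R.
Proof.
intros H; split; [left; now apply Rinv_0_lt_compat|split].
- intros z [Hz _]; rewrite Cmod_inv by (apply Cmod_gt_0; lra).
  now apply Rinv_le_contravar.
- intros eps He; exists (fun z => 1 * (z ^ 0 * (/ z) ^ 1)); split; [constructor|].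
  intros z _; simpl; replace (/ z - 1 * (1 * (/ z * 1))) with (RtoC 0) by ring.
  rewrite Cmod_0; lra.
Qed.

Lemma laurent_Laur r1 r2 f M eps : nb (Laur r1 r2) f M -> (0 < eps)%R ->
  exists p, laurent p /\ forall z, annulus r1 r2 z -> (Cmod (f z - p z) <= eps)%R.
Proof. intros [_ [_ H]]; apply H. Qed.

Lemma eps_zero (x : C) K : (forall eps, (0 < eps)%R -> (Cmod x <= K * eps)%R) -> x = 0.
Proof.
intros H; apply Cmod_eq_0; apply Rle_antisym; [|apply Cmod_ge_0].
apply le_epsilon; intros e He.
assert (HK : (0 < Rabs K + 1)%R) by (pose proof (Rabs_pos K); lra).
specialize (H (e / (Rabs K + 1))%R (Rdiv_lt_0_compat _ _ He HK)).
assert (K * (e / (Rabs K + 1)) <= e)%R; [|lra].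
apply Rle_trans with ((Rabs K + 1) * (e / (Rabs K + 1)))%R; [|right; field; lra].
apply Rmult_le_compat_r; [left; now apply Rdiv_lt_0_compat|].
pose proof (Rle_abs K); lra.
Qed.

Lemma geom_zero (x : C) (m K : R) : (0 <= m < 1)%R ->
  (forall n, (Cmod x <= K * m ^ n)%R) -> x = 0.
Proof.
intros Hm H; apply (eps_zero x (Rabs K)); intros eps He.
destruct (pow_lt_1_zero m) with (y := eps) as [n Hn]; auto.
{ rewrite Rabs_pos_eq; lra. }
specialize (Hn n (le_n n)); specialize (H n).
assert (Hp : (0 <= m ^ n)%R) by (apply pow_le; lra).
rewrite Rabs_pos_eq in Hn by auto.
pose proof (Rle_abs K); pose proof (Rabs_pos K); nra.
Qed.

Section Pole.
Variables (q : R) (u : C).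
Hypotheses (Hq : (0 < q < 1)%R) (Hu : (q < Cmod u < 1)%R).

Let r := (/ q)%R.

Lemma pole_r : (1 < r)%R.
Proof. unfold r; rewrite <- Rinv_1; apply Rinv_lt_contravar; lra. Qed.

Lemma pole_u0 : u <> 0.
Proof. apply Cmod_gt_0; lra. Qed.

Lemma pole_nz z : Cmod z = 1%R \/ Cmod z = r -> 1 - u * z <> 0.
Proof.
intros Hz E.
assert (E1 : u * z = 1) by (replace (u * z) with (1 - (1 - u * z)) by ring; rewrite E; ring).
assert (E2 : (Cmod u * Cmod z = 1)%R) by (rewrite <- Cmod_mult, E1; apply Cmod_1).
destruct Hz as [Hz|Hz]; rewrite Hz in E2; [lra|].
unfold r in E2; assert (Cmod u = q)%R; [|lra].
replace (Cmod u) with (Cmod u * / q * q)%R by (field; lra); rewrite E2; ring.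
Qed.

(** Bounds of 1/(1 - u z) on the circles of radii 1 and 1/q; the pole 1/u lies between them.
*)
Definition pole_bd1 : R := (/ (1 - Cmod u))%R.
Definition pole_bd2 : R := (q / Cmod u * / (1 - q / Cmod u))%R.

Lemma nb_pole1 : nb (Laur 1 1) (fun z => / (1 - u * z)) pole_bd1.
Proof.
apply nb_inv_1m; [|lra].
apply (nb_le _ _ (Cmod u * 1)); [|lra].
apply nb_scal, nb_id; lra.
Qed.

Lemma nb_pole2 : nb (Laur r r) (fun z => / (1 - u * z)) pole_bd2.
Proof.
pose proof pole_r as Hr.
assert (H : nb (Laur r r) (fun z => / u * / z) (q / Cmod u)).
{ apply (nb_le _ _ (Cmod (/ u) * / r)); [apply nb_scal, nb_cinv; lra|].
  rewrite Cmod_inv by apply pole_u0. right; unfold r; field; lra. }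
assert (Hlt : (q / Cmod u < 1)%R)
  by (apply Rmult_lt_reg_r with (Cmod u); [lra|]; field_simplify; lra).
apply (nb_ext (Laur r r) (fun z => - ((/ u * / z) * / (1 - / u * / z)))).
- intros z Hz; simpl in Hz; unfold annulus in Hz.
  assert (Hz0 : z <> 0) by (apply Cmod_gt_0; lra).
  assert (Hn := pole_nz z); assert (1 - u * z <> 0) by (apply Hn; right; lra).
  field; repeat split; auto using pole_u0.
  intros E; apply H0; replace (1 - u * z) with (- (u * z - 1)) by ring; rewrite E; ring.
- apply nb_opp, nb_mult; auto; now apply nb_inv_1m.
Qed.

(** The residue formula for f(z)/(1 - u z) between the circles of radii 1 and 1/q. *)
Definition pole_ok (f : C -> C) : Prop := forall l1 l2,
  cint 1 (fun z => f z * / (1 - u * z)) l1 ->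
  cint r (fun z => f z * / (1 - u * z)) l2 ->
  l1 - l2 = 2 * PI * f (/ u).

Let mono m n (z : C) := z ^ m * (/ z) ^ n.

Lemma cint_mono_pole_ex m n :
  (exists l, cint 1 (fun z => mono m n z * / (1 - u * z)) l) /\
  (exists l, cint r (fun z => mono m n z * / (1 - u * z)) l).
Proof.
pose proof pole_r as Hr; split.
- apply (cint_ex 1 1 _ (1 ^ m * (/ 1) ^ n * pole_bd1)); try lra.
  apply nb_mult; [|apply nb_pole1].
  apply nb_mult; apply nb_pow; [apply nb_id; lra|apply nb_cinv; lra].
- apply (cint_ex r r _ (r ^ m * (/ r) ^ n * pole_bd2)); try lra.
  apply nb_mult; [|apply nb_pole2].
  apply nb_mult; apply nb_pow; [apply nb_id; lra|apply nb_cinv; lra].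
Qed.

Lemma cint_unique s f l l' : cint s f l -> cint s f l' -> l = l'.
Proof. apply cRInt_unique. Qed.

Lemma cint_plus s f g l m : cint s f l -> cint s g m -> cint s (fun z => f z + g z) (l + m).
Proof. apply cRInt_plus. Qed.

Lemma cint_scal s c f l : cint s f l -> cint s (fun z => c * f z) (c * l).
Proof. apply cRInt_scal. Qed.

(** Integrate z^m z^(-n)/(1 - u z) = z^m z^(-n) + u z^(m+1) z^(-n)/(1 - u z). *)
Lemma mono_rec_m s m n l l' : (s = 1%R \/ s = r) ->
  cint s (fun z => mono m n z * / (1 - u * z)) l ->
  cint s (fun z => mono (S m) n z * / (1 - u * z)) l' ->
  l = delta m n + u * l'.
Proof.
pose proof pole_r as Hr; intros Hs H H'.
assert (Hs0 : (0 < s)%R) by (destruct Hs; lra).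
apply (cint_unique s _ _ _ H).
apply cint_ext with (fun z => mono m n z + u * (mono (S m) n z * / (1 - u * z))); [lra| |].
- intros z Hz; unfold mono; rewrite Cpow_S; field; apply pole_nz; destruct Hs; [left|right]; lra.
- apply cint_plus; [now apply cint_mono|now apply cint_scal].
Qed.

(** The same identity as in [mono_rec_m], with the exponent of 1/z lowered instead. *)
Lemma mono_rec_n s m n l l' : (s = 1%R \/ s = r) ->
  cint s (fun z => mono m (S n) z * / (1 - u * z)) l ->
  cint s (fun z => mono m n z * / (1 - u * z)) l' ->
  l = delta m (S n) + u * l'.
Proof.
pose proof pole_r as Hr; intros Hs H H'.
assert (Hs0 : (0 < s)%R) by (destruct Hs; lra).
apply (cint_unique s _ _ _ H).
apply cint_ext with (fun z => mono m (S n) z + u * (mono m n z * / (1 - u * z))); [lra| |].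
- intros z Hz; unfold mono; rewrite Cpow_S; field; split.
  + apply pole_nz; destruct Hs; [left|right]; lra.
  + apply Cmod_gt_0; lra.
- apply cint_plus; [now apply cint_mono|now apply cint_scal].
Qed.

Lemma delta_diag n : delta n n = 2 * PI.
Proof. unfold delta; now destruct (Nat.eq_dec n n). Qed.

Lemma delta_neq m n : m <> n -> delta m n = 0.
Proof. unfold delta; now destruct (Nat.eq_dec m n). Qed.

(** Inside the circle through the pole, 1/(1 - u z) is the geometric series in u z, and only
its constant term has a nonzero mean. *)
Lemma pole_base1 l : cint 1 (fun z => mono 0 0 z * / (1 - u * z)) l -> l = 2 * PI.
Proof.
intros H.
destruct (proj1 (cint_mono_pole_ex 1 0)) as [l1 H1].
rewrite (mono_rec_m 1 0 0 l l1 (or_introl eq_refl) H H1), delta_diag.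
(* By the recurrence l1 = u^n l' with l' bounded in n. *)
assert (E : l1 = 0).
{ apply (geom_zero _ (Cmod u) (2 * PI * pole_bd1)); [lra|]; intros n.
  assert (Hn : exists l', cint 1 (fun z => mono (S n) 0 z * / (1 - u * z)) l' /\ l1 = u ^ n * l').
  { induction n as [|n [l' [Hl E]]]; [exists l1; split; auto; simpl; ring|].
    destruct (proj1 (cint_mono_pole_ex (S (S n)) 0)) as [l'' H''].
    exists l''; split; auto; rewrite E.
    rewrite (mono_rec_m 1 (S n) 0 l' l'' (or_introl eq_refl) Hl H''), delta_neq by lia.
    simpl; ring. }
  destruct Hn as [l' [Hl ->]]; rewrite Cmod_mult, Cmod_pow, Rmult_comm.
  apply Rmult_le_compat_r; [apply pow_le; lra|].
  refine (cint_bound 1 _ l' pole_bd1 _ _ Hl); [lra|]; intros z Hz.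
  unfold mono; rewrite !Cmod_mult, Cmod_pow, Hz, pow1; simpl; rewrite Cmod_1, !Rmult_1_l.
  apply (nb_bound _ _ _ nb_pole1); simpl; unfold annulus; lra. }
rewrite E; ring.
Qed.

(** Outside the circle through the pole, 1/(1 - u z) is a series in negative powers of z,
all of mean zero. *)
Lemma pole_base2 l : cint r (fun z => mono 0 0 z * / (1 - u * z)) l -> l = 0.
Proof.
intros H; pose proof pole_r as Hr.
assert (Hlt : (q / Cmod u < 1)%R)
  by (apply Rmult_lt_reg_r with (Cmod u); [lra|]; field_simplify; lra).
assert (Hge : (0 < q / Cmod u)%R) by (apply Rdiv_lt_0_compat; lra).
apply (geom_zero _ (q / Cmod u) (2 * PI * pole_bd2)); [lra|]; intros n.
assert (Hn : exists l', cint r (fun z => mono 0 n z * / (1 - u * z)) l' /\ l' = u ^ n * l).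
{ induction n as [|n [l' [Hl E]]]; [exists l; split; auto; simpl; ring|].
  destruct (proj2 (cint_mono_pole_ex 0 (S n))) as [l'' H''].
  exists l''; split; auto.
  rewrite (mono_rec_n r 0 n l'' l' (or_intror eq_refl) H'' Hl), delta_neq, E by lia.
  simpl; ring. }
destruct Hn as [l' [Hl E]].
assert (Hb : (Cmod l' <= 2 * PI * (q ^ n * pole_bd2))%R).
{ refine (cint_bound r _ l' _ _ _ Hl); [lra|]; intros z Hz.
  assert (Hz0 : z <> 0) by (apply Cmod_gt_0; lra).
  unfold mono; simpl; rewrite Cmult_1_l, Cmod_mult, Cmod_pow, Cmod_inv, Hz by auto.
  unfold r; rewrite Rinv_inv.
  apply Rmult_le_compat_l; [apply pow_le; lra|].
  apply (nb_bound _ _ _ nb_pole2); simpl; unfold annulus; lra. }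
rewrite E, Cmod_mult, Cmod_pow in Hb.
assert (Hun : (0 < Cmod u ^ n)%R) by (apply pow_lt; lra).
apply Rmult_le_reg_l with (Cmod u ^ n)%R; auto.
eapply Rle_trans; [exact Hb|]; right; unfold Rdiv; rewrite Rpow_mult_distr, pow_inv; field; lra.
Qed.

(** Both sides are multiplied by 1/u when f is multiplied by z, so the case f = 1 suffices.
*)
Lemma pole_mono m n : pole_ok (mono m n).
Proof.
revert m; induction n as [|n IHn].
- induction m as [|m IHm]; intros l1 l2 H1 H2.
  + rewrite (pole_base1 l1 H1), (pole_base2 l2 H2); unfold mono; simpl; ring.
  + destruct (cint_mono_pole_ex m 0) as [[k1 K1] [k2 K2]].
    pose proof (mono_rec_m 1 m 0 _ _ (or_introl eq_refl) K1 H1) as E1.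
    pose proof (mono_rec_m r m 0 _ _ (or_intror eq_refl) K2 H2) as E2.
    pose proof (IHm k1 k2 K1 K2) as E; rewrite E1, E2 in E.
    replace (l1 - l2) with (/ u * (delta m 0 + u * l1 - (delta m 0 + u * l2)))
      by (field; apply pole_u0).
    rewrite E; unfold mono; simpl; ring.
- intros m l1 l2 H1 H2.
  destruct (cint_mono_pole_ex m n) as [[k1 K1] [k2 K2]].
  pose proof (mono_rec_n 1 m n _ _ (or_introl eq_refl) H1 K1) as E1.
  pose proof (mono_rec_n r m n _ _ (or_intror eq_refl) H2 K2) as E2.
  pose proof (IHn m k1 k2 K1 K2) as E.
  rewrite E1, E2.
  replace (delta m (S n) + u * k1 - (delta m (S n) + u * k2)) with (u * (k1 - k2)) by ring.
  rewrite E; unfold mono; simpl.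
  replace (/ / u) with u by (field; apply pole_u0); ring.
Qed.

Lemma pole_laurent p : laurent p -> pole_ok p /\
  (exists l, cint 1 (fun z => p z * / (1 - u * z)) l) /\
  (exists l, cint r (fun z => p z * / (1 - u * z)) l).
Proof.
pose proof pole_r as Hr; intros Hp.
induction Hp as [c m n|f g _ [If [[a1 A1] [a2 A2]]] _ [Ig [[b1 B1] [b2 B2]]]].
- destruct (cint_mono_pole_ex m n) as [[k1 K1] [k2 K2]].
  assert (L1 : cint 1 (fun z => c * (z ^ m * (/ z) ^ n) * / (1 - u * z)) (c * k1))
    by (apply cint_ext with (fun z => c * (mono m n z * / (1 - u * z)));
        [lra|intros; unfold mono; ring|now apply cint_scal]).
  assert (L2 : cint r (fun z => c * (z ^ m * (/ z) ^ n) * / (1 - u * z)) (c * k2))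
    by (apply cint_ext with (fun z => c * (mono m n z * / (1 - u * z)));
        [lra|intros; unfold mono; ring|now apply cint_scal]).
  split; [|eauto].
  intros l1 l2 H1 H2; rewrite (cint_unique _ _ _ _ H1 L1), (cint_unique _ _ _ _ H2 L2).
  replace (c * k1 - c * k2) with (c * (k1 - k2)) by ring.
  rewrite (pole_mono m n k1 k2 K1 K2); unfold mono; ring.
- assert (L1 : cint 1 (fun z => (f z + g z) * / (1 - u * z)) (a1 + b1))
    by (apply cint_ext with (fun z => f z * / (1 - u * z) + g z * / (1 - u * z));
        [lra|intros; ring|now apply cint_plus]).
  assert (L2 : cint r (fun z => (f z + g z) * / (1 - u * z)) (a2 + b2))
    by (apply cint_ext with (fun z => f z * / (1 - u * z) + g z * / (1 - u * z));
        [lra|intros; ring|now apply cint_plus]).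
  split; [|eauto].
  intros l1 l2 H1 H2; rewrite (cint_unique _ _ _ _ H1 L1), (cint_unique _ _ _ _ H2 L2).
  replace (a1 + b1 - (a2 + b2)) with ((a1 - a2) + (b1 - b2)) by ring.
  rewrite (If _ _ A1 A2), (Ig _ _ B1 B2); ring.
Qed.

Lemma nb_restrict r1 r2 r1' r2' f M : (r1 <= r1')%R -> (r2' <= r2)%R ->
  nb (Laur r1 r2) f M -> nb (Laur r1' r2') f M.
Proof.
intros A1 A2 [H0 [H1 H2]]; split; [auto|split].
- intros z [Z1 Z2]; apply H1; split; lra.
- intros eps He; destruct (H2 eps He) as [p [Hp H]]; exists p; split; auto.
  intros z [Z1 Z2]; apply H; split; lra.
Qed.

Lemma pole_ex f M : nb (Laur 1 r) f M ->
  (exists l, cint 1 (fun z => f z * / (1 - u * z)) l) /\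
  (exists l, cint r (fun z => f z * / (1 - u * z)) l).
Proof.
pose proof pole_r as Hr; intros Hf; split.
- apply (cint_ex 1 1 _ (M * pole_bd1)); try lra.
  apply nb_mult; [|apply nb_pole1]; apply (nb_restrict 1 r); auto; lra.
- apply (cint_ex r r _ (M * pole_bd2)); try lra.
  apply nb_mult; [|apply nb_pole2]; apply (nb_restrict 1 r); auto; lra.
Qed.

(** Both sides are continuous in f for the supremum norm, and the formula holds for Laurent
polynomials. *)
Lemma pole_Laur f M : nb (Laur 1 r) f M -> pole_ok f.
Proof.
pose proof pole_r as Hr; intros Hf l1 l2 H1 H2.
assert (Hu' : annulus 1 r (/ u)).
{ unfold annulus; rewrite Cmod_inv by apply pole_u0; unfold r; split.
  - rewrite <- Rinv_1; apply Rinv_le_contravar; lra.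
  - apply Rinv_le_contravar; lra. }
assert (E : l1 - l2 - 2 * PI * f (/ u) = 0).
{ apply (eps_zero _ (2 * PI * pole_bd1 + 2 * PI * pole_bd2 + 2 * PI)); intros eps He.
  destruct (laurent_Laur 1 r f M eps Hf He) as [p [Hp Hfp]].
  destruct (pole_laurent p Hp) as [Hok [[a1 A1] [a2 A2]]].
  assert (D : forall s k a bd, s = 1%R \/ s = r -> 
     nb (Laur s s) (fun z => / (1 - u * z)) bd ->
     cint s (fun z => f z * / (1 - u * z)) k -> cint s (fun z => p z * / (1 - u * z)) a ->
     (Cmod (k - a) <= 2 * PI * bd * eps)%R).
  { intros s k a bd Hs Hbd K A.
    assert (D : cint s (fun z => (f z - p z) * / (1 - u * z)) (k + (-1) * a)).
    { apply cint_ext with (fun z => f z * / (1 - u * z) + (-1) * (p z * / (1 - u * z)));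
        [destruct Hs; lra|intros; ring|].
      apply cint_plus; auto; now apply cint_scal. }
    replace (k - a) with (k + (-1) * a) by ring.
    rewrite Rmult_assoc, (Rmult_comm bd).
    refine (cint_bound s _ _ _ _ _ D); [destruct Hs; lra|].
    intros z Hz; rewrite Cmod_mult; apply Rmult_le_compat; try apply Cmod_ge_0.
    - apply Hfp; unfold annulus; destruct Hs; lra.
    - apply (nb_bound _ _ _ Hbd); simpl; unfold annulus; lra. }
  pose proof (D 1%R l1 a1 _ (or_introl eq_refl) nb_pole1 H1 A1) as D1.
  pose proof (D r l2 a2 _ (or_intror eq_refl) nb_pole2 H2 A2) as D2.
  pose proof (Hfp _ Hu') as D3.
  replace (l1 - l2 - 2 * PI * f (/ u)) with
    ((l1 - a1) + (- (l2 - a2) + ((a1 - a2) - 2 * PI * f (/ u)))) by ring.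
  rewrite (Hok _ _ A1 A2).
  replace (2 * PI * p (/ u) - 2 * PI * f (/ u)) with (- ((2 * PI) * (f (/ u) - p (/ u)))) by ring.
  eapply Rle_trans; [apply Cmod_triangle|].
  eapply Rle_trans; [apply Rplus_le_compat_l, Cmod_triangle|].
  rewrite !Cmod_opp, (Cmod_mult (2 * PI)).
  replace (Cmod (2 * PI)) with (2 * PI)%R
    by (rewrite <- RtoC_mult, Cmod_R, Rabs_pos_eq; pose proof PI_RGT_0; lra).
  assert (2 * PI * Cmod (f (/ u)%C - p (/ u)%C) <= 2 * PI * eps)%R
    by (apply Rmult_le_compat_l; auto; pose proof PI_RGT_0; lra).
  lra. }
replace (l1 - l2) with ((l1 - l2 - 2 * PI * f (/ u)) + 2 * PI * f (/ u)) by ring.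
rewrite E; ring.
Qed.

End Pole.

(** * Infinite q-shifted factorials *)

Lemma pprod_ext f g n : (forall k, f k = g k) -> pprod f n = pprod g n.
Proof. intros H; induction n as [|n IH]; simpl; [easy|]. now rewrite IH, H. Qed.

Lemma pprod_head f n : pprod f (S n) = (1 - f O) * pprod (fun k => f (S k)) n.
Proof.
induction n as [|n IH]; [simpl; ring|].
change (pprod f (S (S n))) with (pprod f (S n) * (1 - f (S n))); rewrite IH; simpl; ring.
Qed.

Lemma pprod_add f m n : pprod f (m + n) = pprod f m * pprod (fun k => f (m + k)%nat) n.
Proof.
induction n as [|n IH]; [rewrite Nat.add_0_r; simpl; ring|].
rewrite Nat.add_succ_r; simpl; rewrite IH; ring.
Qed.

Lemma pprod_mult f g n :
  pprod f n * pprod g n = pprod (fun k => f k + g k - f k * g k) n.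
Proof. induction n as [|n IH]; simpl; [ring|]. rewrite <- IH; ring. Qed.

Lemma qpoch_pprod q a n : qpoch q a n = pprod (fun k => a * q ^ k) n.
Proof. induction n as [|n IH]; simpl; [easy|]. now rewrite IH. Qed.

Lemma qpoch_inf_iprod q a : qpoch_inf q a = iprod (fun k => a * q ^ k).
Proof.
unfold qpoch_inf, iprod; f_equal.
apply functional_extensionality; intros n; apply qpoch_pprod.
Qed.

Section QP.
Variable q : R.
Hypothesis Hq : (0 < q < 1)%R.

Lemma q_C_neq_0 : RtoC q <> 0.
Proof. intros E; apply RtoC_inj in E; lra. Qed.

Lemma Cmod_q : Cmod q = q.
Proof. rewrite Cmod_R, Rabs_pos_eq; lra. Qed.

Lemma Cmod_qpow_nat n : Cmod (q ^ n) = (q ^ n)%R.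
Proof. now rewrite Cmod_pow, Cmod_q. Qed.

Lemma Cmod_term a k : (Cmod (a * q ^ k) <= Cmod a * q ^ k)%R.
Proof. rewrite Cmod_mult, Cmod_qpow_nat; apply Rle_refl. Qed.

Lemma qi_lim a : Cto eventually (fun n => qpoch q a n) (qpoch_inf q a).
Proof.
rewrite qpoch_inf_iprod.
apply Cto_ext with (pprod (fun k => a * q ^ k)).
- filt.
- exists O; intros n _; symmetry; apply qpoch_pprod.
- apply (is_iprod (fun k => a * q ^ k) (Cmod a) q); [apply Cmod_ge_0|lra|apply Cmod_term].
Qed.

Lemma qpoch_head a n : qpoch q a (S n) = (1 - a) * qpoch q (a * q) n.
Proof.
rewrite !qpoch_pprod, pprod_head; f_equal; [simpl; ring|].
apply pprod_ext; intros k; simpl; ring.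
Qed.

Lemma qpoch_add a m n : qpoch q a (m + n) = qpoch q a m * qpoch q (a * q ^ m) n.
Proof.
rewrite !qpoch_pprod, pprod_add; f_equal.
apply pprod_ext; intros k; rewrite Cpow_add_r; ring.
Qed.

Lemma qi_shift a m : qpoch_inf q a = qpoch q a m * qpoch_inf q (a * q ^ m).
Proof.
apply (Cto_unique eventually (fun n => qpoch q a (m + n))).
- apply Cto_eps; [filt|]; intros eps.
  destruct (proj1 (Cto_eps _ _ _) (qi_lim a) eps) as [N HN].
  exists N; intros n Hn; apply HN; lia.
- apply Cto_ext with (fun n => qpoch q a m * qpoch q (a * q ^ m) n).
  + filt.
  + exists O; intros n _; symmetry; apply qpoch_add.
  + apply Cto_scal; [filt|apply qi_lim].
Qed.

Lemma qi_step a : qpoch_inf q a = (1 - a) * qpoch_inf q (a * q).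
Proof. rewrite (qi_shift a 1); simpl; rewrite !Cmult_1_r, Cmult_1_l; easy. Qed.

Lemma qi_one : qpoch_inf q 1 = 0.
Proof. rewrite qi_step; ring. Qed.

Lemma one_minus_neq_0 (y : C) : (Cmod y < 1)%R -> 1 - y <> 0.
Proof.
intros Hy E; assert (Ey : y = 1) by (replace y with (1 - (1 - y)) by ring; rewrite E; ring).
rewrite Ey, Cmod_1 in Hy; lra.
Qed.

Lemma Cmod_aqk a k : (Cmod a < 1)%R -> (Cmod (a * q ^ k) < 1)%R.
Proof.
intros Ha; eapply Rle_lt_trans; [apply Cmod_term|].
pose proof (Cmod_ge_0 a); assert (0 < q ^ k <= 1)%R; [|nra].
split; [apply pow_lt; lra|].
rewrite <- (pow1 k); apply pow_incr; lra.
Qed.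

Lemma nb_qi {X} (B : FunAlg X) f M : nb B f M ->
  nb B (fun x => qpoch_inf q (f x)) (ibound M q).
Proof.
intros H; apply (nb_ext B (fun x => iprod (fun k => f x * q ^ k))).
- intros x _; symmetry; apply qpoch_inf_iprod.
- apply (nb_iprod B (fun k x => f x * q ^ k)); [apply (nb_pos B f M H)|lra|].
  intros k; apply nb_mult; auto.
  apply (nb_le B _ (Cmod (q ^ k))); [apply nb_const|rewrite Cmod_qpow_nat; lra].
Qed.

Let y (a : C) (k : nat) : C := - (a * q ^ k * / (1 - a * q ^ k)).

Lemma inv_pprod a n : (Cmod a < 1)%R -> qpoch q a n * pprod (y a) n = 1.
Proof.
intros Ha; induction n as [|n IH]; simpl; [ring|].
transitivity ((qpoch q a n * pprod (y a) n) * ((1 - a * q ^ n) * (1 - y a n))); [ring|].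
rewrite IH; unfold y.
field; apply one_minus_neq_0; now apply Cmod_aqk.
Qed.

Lemma qi_inv_eq a : (Cmod a < 1)%R -> qpoch_inf q a * iprod (y a) = 1.
Proof.
intros Ha.
apply (Cto_unique eventually (fun n => qpoch q a n * pprod (y a) n)).
- apply Cto_mult; [filt|apply qi_lim|].
  apply (is_iprod (y a) (Cmod a * / (1 - Cmod a)) q).
  + apply Rmult_le_pos; [apply Cmod_ge_0|left; apply Rinv_0_lt_compat; lra].
  + lra.
  + intros k; unfold y; pose proof (Cmod_aqk a k Ha) as Hk.
    rewrite Cmod_opp, Cmod_mult, Cmod_inv by now apply one_minus_neq_0.
    rewrite Rmult_assoc, (Rmult_comm (/ _)), <- Rmult_assoc.
    apply Rmult_le_compat; try apply Cmod_ge_0; [|apply Cmod_term|].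
    * left; apply Rinv_0_lt_compat, Cmod_gt_0; now apply one_minus_neq_0.
    * apply Rinv_le_contravar; [lra|].
      eapply Rle_trans; [|apply Cmod_tri_inv]; rewrite Cmod_1.
      apply Rplus_le_compat_l, Ropp_le_contravar; eapply Rle_trans; [apply Cmod_term|].
      rewrite <- (Rmult_1_r (Cmod a)) at 2; apply Rmult_le_compat_l; [apply Cmod_ge_0|].
      rewrite <- (pow1 k); apply pow_incr; lra.
- apply Cto_ext with (fun _ => 1); [filt| |apply Cto_const, eventually_filter].
  exists O; intros n _; symmetry; now apply inv_pprod.
Qed.

Lemma qi_neq_0 a : (Cmod a < 1)%R -> qpoch_inf q a <> 0.
Proof.
intros Ha E; pose proof (qi_inv_eq a Ha) as H; rewrite E in H.
apply C1_nz; rewrite <- H; ring.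
Qed.

Lemma qi_inv a : (Cmod a < 1)%R -> / qpoch_inf q a = iprod (y a).
Proof.
intros Ha; pose proof (qi_inv_eq a Ha) as H.
replace (iprod (y a)) with (/ qpoch_inf q a * (qpoch_inf q a * iprod (y a)))
  by (field; now apply qi_neq_0).
rewrite H; ring.
Qed.

(** 1/(x;q)_oo is the infinite product of the factors 1 + x q^k/(1 - x q^k). *)
Lemma nb_qi_inv {X} (B : FunAlg X) f m : nb B f m -> (m < 1)%R ->
  nb B (fun x => / qpoch_inf q (f x)) (ibound (m * / (1 - m)) q).
Proof.
intros H Hm; pose proof (nb_pos B f m H) as H0.
apply (nb_ext B (fun x => iprod (fun k => y (f x) k))).
- intros x Hx; symmetry; apply qi_inv.
  pose proof (nb_bound B f m H x Hx); lra.
- apply (nb_iprod B (fun k x => y (f x) k)); [|lra|].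
  + apply Rmult_le_pos; auto; left; apply Rinv_0_lt_compat; lra.
  + intros k; unfold y.
    assert (Hk0 : (0 < q ^ k <= 1)%R).
    { split; [apply pow_lt; lra|]; rewrite <- (pow1 k); apply pow_incr; lra. }
    assert (Hk : nb B (fun x => f x * q ^ k) (m * q ^ k)).
    { apply nb_mult; auto.
      apply (nb_le B _ (Cmod (q ^ k))); [apply nb_const|rewrite Cmod_qpow_nat; lra]. }
    assert (Hk1 : (m * q ^ k <= m)%R) by nra.
    apply nb_opp; rewrite Rmult_assoc, (Rmult_comm (/ _)), <- Rmult_assoc.
    apply nb_mult; auto. apply nb_inv_1m; auto. now apply (nb_le B _ (m * q ^ k)).
Qed.

End QP.

(** * The Casorati determinant of two solutions *)

Lemma nb_dilate r1 r2 k f M : (0 < k)%R -> (0 < r1)%R -> nb (Laur r1 r2) f M ->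
  nb (Laur (r1 / k) (r2 / k)) (fun z => f (k * z)) M.
Proof.
intros Hk Hr [H0 [H1 H2]].
assert (Hann : forall z, annulus (r1 / k) (r2 / k) z -> annulus r1 r2 (k * z)).
{ intros z [Z1 Z2]; unfold annulus; rewrite Cmod_mult, Cmod_R, Rabs_pos_eq by lra; split.
  - apply Rmult_le_compat_l with (r := k) in Z1; [|lra].
    replace (k * (r1 / k))%R with r1 in Z1 by (field; lra); lra.
  - apply Rmult_le_compat_l with (r := k) in Z2; [|lra].
    replace (k * (r2 / k))%R with r2 in Z2 by (field; lra); lra. }
assert (Hk0 : RtoC k <> 0) by (intros E; apply RtoC_inj in E; lra).
split; [auto|split; [intros z Hz; auto|]].
intros eps He; destruct (H2 eps He) as [p [Hp H]].
assert (Hp' : exists p', laurent p' /\ forall z : C, z <> 0 -> p' z = p (k * z)).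
{ clear - Hp Hk0; induction Hp as [c m n|f g _ [f' [F1 F2]] _ [g' [G1 G2]]].
  - exists (fun z => (c * (k ^ m * (/ k) ^ n)) * (z ^ m * (/ z) ^ n)); split; [constructor|].
    intros z Hz; replace (/ (k * z)) with (/ k * / z) by (field; split; auto).
    rewrite !Cpow_mult_l; ring.
  - exists (fun z => f' z + g' z); split; [now constructor|].
    intros z Hz; now rewrite F2, G2. }
destruct Hp' as [p' [Hp' E]].
exists p'; split; auto; intros z Hz; rewrite E; auto.
apply Cmod_gt_0; destruct Hz as [Hz _]; assert (0 < r1 / k)%R by now apply Rdiv_lt_0_compat.
lra.
Qed.

Section Star.
Variable q : R.
Hypothesis Hq : (0 < q < 1)%R.
Variables a b c s al : C.
Hypotheses (Ha : (Cmod a < 1)%R) (Hb : (Cmod b < 1)%R) (Hc : (Cmod c < 1)%R)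
  (Hs : (Cmod s < 1)%R) (Hs0 : s <> 0) (Hal : (q < Cmod al * Cmod al)%R) (Hal1 : (Cmod al < 1)%R).

Let qi := qpoch_inf q.
Let al' := q / al.

(** [wfac e] is the contribution of a parameter [e] to the denominator of the weight; [nfac
e] is what is left of it without the factor 1 - e z, and is invariant under z -> 1/(q z).
Besides a, b, c and s = q/d, the parameters are alpha and q/alpha. *)
Definition wfac (e z : C) : C := qi (e * z) * qi (e * / z).
Definition nfac (e z : C) : C := qi (e * z * q) * qi (e * / z).

Definition wfun (z : C) : C :=
  qi (z * z) * qi (/ z * / z)
  / (wfac a z * wfac b z * wfac c z * wfac s z * wfac al z * wfac al' z).

(** The product of [wfun] and [shift_coef] without its two poles, see [wfun_shift_coef]. *)
Definition flux_coef (z : C) : C :=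
  - (q / s) * z * (qi (z * z * q * q) * qi (/ z * / z))
  * / (nfac a z * nfac b z * nfac c z * nfac s z * nfac al z * nfac al' z).

(** The coefficient of v(q z) in the q-difference equation satisfied by v. *)
Definition shift_coef (z : C) : C :=
  - (q * z / s) * ((1 - a * z) * (1 - b * z) * (1 - c * z) * (1 - s * z))
  / ((1 - z * z) * (1 - z * z * q)).

Lemma al_gt_q : (q < Cmod al)%R.
Proof. pose proof (Cmod_ge_0 al); nra. Qed.

Lemma al_neq_0 : al <> 0.
Proof. apply Cmod_gt_0; pose proof al_gt_q; lra. Qed.

Lemma Cmod_al' : Cmod al' = (q / Cmod al)%R.
Proof. unfold al'; rewrite Cmod_div by apply al_neq_0; now rewrite Cmod_q. Qed.

Lemma al'_bounds : (q < Cmod al' < Cmod al)%R.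
Proof.
rewrite Cmod_al'; pose proof al_gt_q; split; apply Rmult_lt_reg_r with (Cmod al); try lra;
  field_simplify; try lra; nra.
Qed.

Lemma al'_lt_1 : (Cmod al' < 1)%R.
Proof. pose proof al'_bounds; lra. Qed.

Lemma circ_e e z : (Cmod e < 1)%R -> Cmod z = 1%R -> (Cmod (e * z) < 1)%R.
Proof. intros He Hz; rewrite Cmod_mult, Hz; lra. Qed.

Lemma unit_neq_0 z : Cmod z = 1%R -> z <> 0.
Proof. intros Hz; apply Cmod_gt_0; lra. Qed.

Lemma unit_inv z : Cmod z = 1%R -> Cmod (/ z) = 1%R.
Proof. intros Hz; rewrite Cmod_inv, Hz by now apply unit_neq_0. apply Rinv_1. Qed.

Lemma nfac_neq_0 e z : (Cmod e < 1)%R -> (1 <= Cmod z <= / q)%R -> nfac e z <> 0.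
Proof.
intros He [Hz1 Hz2]; assert (Hz0 : z <> 0) by (apply Cmod_gt_0; lra).
pose proof (Cmod_ge_0 e).
apply Cmult_neq_0; apply qi_neq_0; auto; rewrite ?Cmod_mult, ?Cmod_q by auto.
- apply Rle_lt_trans with (Cmod e * (/ q * q))%R; [|rewrite Rinv_l; lra].
  rewrite Rmult_assoc; apply Rmult_le_compat_l; [auto|apply Rmult_le_compat_r; lra].
- rewrite Cmod_inv by auto.
  assert (/ Cmod z <= 1)%R by (rewrite <- Rinv_1; apply Rinv_le_contravar; lra).
  apply Rle_lt_trans with (Cmod e * 1)%R; [apply Rmult_le_compat_l; auto|lra].
Qed.

Lemma wfac_nfac e z : wfac e z = (1 - e * z) * nfac e z.
Proof. unfold wfac, nfac, qi; rewrite (qi_step q Hq (e * z)); ring. Qed.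

Lemma nfac_sym (e z : C) : z <> 0 -> nfac e (/ (q * z)) = nfac e z.
Proof.
intros Hz; unfold nfac; pose proof (q_C_neq_0 q Hq).
replace (e * / (q * z) * q) with (e * / z) by (field; auto).
replace (e * / / (q * z)) with (e * z * q) by (field; auto); ring.
Qed.

Lemma wfac_inv (e z : C) : z <> 0 -> wfac e (/ z) = wfac e z.
Proof. intros Hz; unfold wfac; replace (/ / z) with z by (field; auto); ring. Qed.

Lemma wfun_inv (z : C) : z <> 0 -> wfun (/ z) = wfun z.
Proof.
intros Hz; unfold wfun; rewrite !wfac_inv by auto; replace (/ / z) with z by (field; auto).
unfold Cdiv; ring.
Qed.

Lemma unit_sq_neq z : Cmod z = 1%R -> 1 - z * z * q <> 0.
Proof. intros Hz; apply one_minus_neq_0; rewrite !Cmod_mult, Hz, Cmod_q by auto; lra. Qed.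

(** [shift_coef] cancels the factor 1 - e z of the weight for e = a, b, c, s; for alpha and q/alpha
this factor remains, as a pole. *)
Lemma wfun_shift_coef z : Cmod z = 1%R -> z * z <> 1 ->
  wfun z * shift_coef z = flux_coef z * / ((1 - al * z) * (1 - al' * z)).
Proof.
intros Hz Hz1.
assert (Hz2 : 1 - z * z <> 0)
  by (intros E; apply Hz1; replace (z * z) with (1 - (1 - z * z)) by ring; rewrite E; ring).
pose proof (unit_sq_neq z Hz) as Hz3.
assert (Hzq : (1 <= Cmod z <= / q)%R)
  by (rewrite Hz; split; [lra|rewrite <- Rinv_1; apply Rinv_le_contravar; lra]).
pose proof al'_lt_1 as Hal'.
unfold wfun, shift_coef, flux_coef; rewrite !wfac_nfac.
unfold qi; rewrite (qi_step q Hq (z * z)), (qi_step q Hq (z * z * q)).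
pose proof (nfac_neq_0 a z Ha Hzq); pose proof (nfac_neq_0 b z Hb Hzq).
pose proof (nfac_neq_0 c z Hc Hzq); pose proof (nfac_neq_0 s z Hs Hzq).
pose proof (nfac_neq_0 al z Hal1 Hzq); pose proof (nfac_neq_0 al' z Hal' Hzq).
pose proof (one_minus_neq_0 _ (circ_e a z Ha Hz)); pose proof (one_minus_neq_0 _ (circ_e b z Hb Hz)).
pose proof (one_minus_neq_0 _ (circ_e c z Hc Hz)); pose proof (one_minus_neq_0 _ (circ_e s z Hs Hz)).
pose proof (one_minus_neq_0 _ (circ_e al z Hal1 Hz)).
pose proof (one_minus_neq_0 _ (circ_e al' z Hal' Hz)).
generalize dependent (nfac a z); generalize dependent (nfac b z);
generalize dependent (nfac c z); generalize dependent (nfac s z);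
generalize dependent (nfac al z); generalize dependent (nfac al' z).
generalize (qpoch_inf q (z * z * q * q)), (qpoch_inf q (/ z * / z)).
clearbody al'.
intros; field; auto 20.
Qed.

Section Pair.
Variables (v1 v2 : C -> C) (M1 M2 : R) (L1 L2 : C) (c0 : C -> C).
Hypotheses (Hv1 : nb (Laur q (/ q)) v1 M1) (Hv2 : nb (Laur q (/ q)) v2 M2).
Hypotheses (Ev1 : forall z : C, z <> 0 -> v1 (/ z) = v1 z)
           (Ev2 : forall z : C, z <> 0 -> v2 (/ z) = v2 z).
Hypothesis (Eq1 : forall z, Cmod z = 1%R -> z * z <> 1 ->
  shift_coef z * v1 (q * z) + shift_coef (/ z) * v1 (q * / z) = (L1 + c0 z) * v1 z).
Hypothesis (Eq2 : forall z, Cmod z = 1%R -> z * z <> 1 ->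
  shift_coef z * v2 (q * z) + shift_coef (/ z) * v2 (q * / z) = (L2 + c0 z) * v2 z).

Definition casorati (z : C) : C := v1 (q * z) * v2 z - v1 z * v2 (q * z).
(** The function J of the introductory comment; [al] and [al'] are alpha and q/alpha. *)
Definition flux (z : C) : C := flux_coef z * casorati z * / ((1 - al * z) * (1 - al' * z)).

(** At z = 1 and z = -1 the equations are not available, but there the weight and both
fluxes vanish, through the factor (z^2, z^(-2); q)_oo. *)
Lemma flux_eq z : Cmod z = 1%R ->
  (L1 - L2) * (v1 z * v2 z * wfun z) = flux z + flux (/ z).
Proof.
intros Hz; pose proof (unit_neq_0 z Hz) as Hz0; pose proof (unit_inv z Hz) as Hzi.
destruct (excluded_middle_informative (z * z = 1)) as [E|E].
- assert (E' : / z * / z = 1)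
    by (replace (/ z * / z) with (/ (z * z)) by (field; auto); rewrite E; field).
  unfold flux, flux_coef, wfun, qi; rewrite E'.
  replace (/ / z * / / z) with (z * z) by (field; auto).
  rewrite E, qi_one by auto; unfold Cdiv; ring.
- assert (E' : / z * / z <> 1).
  { intros E'; apply E; replace (z * z) with (/ (/ z * / z)) by (field; auto); rewrite E'; field. }
  unfold flux.
  replace (flux_coef z * casorati z * / ((1 - al * z) * (1 - al' * z)))
    with ((flux_coef z * / ((1 - al * z) * (1 - al' * z))) * casorati z) by ring.
  replace (flux_coef (/ z) * casorati (/ z) * / ((1 - al * / z) * (1 - al' * / z)))
    with ((flux_coef (/ z) * / ((1 - al * / z) * (1 - al' * / z))) * casorati (/ z)) by ring.
  rewrite <- !wfun_shift_coef by auto; rewrite wfun_inv by auto.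
  unfold casorati; rewrite Ev1, Ev2 by auto.
  transitivity (wfun z * (((L1 + c0 z) * v1 z) * v2 z - v1 z * ((L2 + c0 z) * v2 z))); [ring|].
  rewrite <- Eq1, <- Eq2 by auto; ring.
Qed.

(** The factor multiplying the Casorati determinant is invariant, and the determinant
changes sign because v1 and v2 are even. *)
Lemma flux_anti (z : C) : z <> 0 -> flux (/ (q * z)) = - flux z.
Proof.
intros Hz; pose proof (q_C_neq_0 q Hq) as Hq0; pose proof al_neq_0 as Hal0.
assert (Hqz : q * z <> 0) by now apply Cmult_neq_0.
unfold flux, casorati.
replace (v1 (q * / (q * z))) with (v1 z)
  by (rewrite <- (Ev1 z) by auto; f_equal; field; auto).
replace (v2 (q * / (q * z))) with (v2 z)
  by (rewrite <- (Ev2 z) by auto; f_equal; field; auto).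
rewrite (Ev1 (q * z)), (Ev2 (q * z)) by auto.
unfold flux_coef; rewrite !nfac_sym by auto.
replace (/ (q * z) * / (q * z) * q * q) with (/ z * / z) by (field; auto).
replace (/ / (q * z) * / / (q * z)) with (z * z * q * q) by (field; auto).
replace (/ ((1 - al * / (q * z)) * (1 - al' * / (q * z))))
  with (q * z * z * / ((1 - al * z) * (1 - al' * z))).
- set (I1 := / ((1 - al * z) * (1 - al' * z))); set (I2 := / (_ * _ * _ * _ * _ * _)).
  field; auto.
- unfold al'.
  replace ((1 - al * / (q * z)) * (1 - q / al * / (q * z)))
    with (/ (q * z * z) * ((1 - al * z) * (1 - q / al * z))) by (field; auto).
  set (U := (1 - al * z) * (1 - q / al * z)).
  assert (Hn : q * z * z <> 0) by now repeat apply Cmult_neq_0.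
  destruct (Ceq_dec U 0) as [EU|EU].
  + assert (Hi : forall x : C, x = 0 -> / x = 0).
    { intros x ->; apply injective_projections; simpl; unfold Rdiv; ring. }
    rewrite EU, (Hi (/ _ * 0)) by ring; rewrite (Hi 0) by easy; ring.
  + field; auto.
Qed.

Lemma nb_flux_coef : exists M, nb (Laur 1 (/ q)) flux_coef M.
Proof.
assert (Hqi : (1 < / q)%R) by (rewrite <- Rinv_1; apply Rinv_lt_contravar; lra).
assert (Hz : nb (Laur 1 (/ q)) (fun z => z) (/ q)) by (apply nb_id; lra).
assert (Hi : nb (Laur 1 (/ q)) (fun z => / z) (/ 1)) by (apply nb_cinv; lra).
rewrite Rinv_1 in Hi.
assert (Hcst : forall k, nb (Laur 1 (/ q)) (fun _ => k) (Cmod k)) by (intros; apply nb_const).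
assert (Hn : forall e, (Cmod e < 1)%R -> exists M, nb (Laur 1 (/ q)) (fun z => / nfac e z) M).
{ intros e He; eexists.
  apply (nb_ext _ (fun z => / qi (e * z * q) * / qi (e * / z))).
  - intros z Hzz; unfold nfac; field.
    pose proof (nfac_neq_0 e z He Hzz) as H; unfold nfac in H; split;
      intros E; apply H; rewrite E; ring.
  - apply nb_mult.
    + apply (nb_qi_inv q Hq _ (fun z => e * z * q) (Cmod e)); auto.
      apply (nb_le _ _ (Cmod e * / q * Cmod q)); [apply nb_mult; auto; now apply nb_mult|].
      rewrite Cmod_q by auto; right; field; lra.
    + apply (nb_qi_inv q Hq _ (fun z => e * / z) (Cmod e)); auto.
      apply (nb_le _ _ (Cmod e * 1)); [now apply nb_mult|lra]. }
destruct (Hn a Ha) as [Ka Na]; destruct (Hn b Hb) as [Kb Nb]; destruct (Hn c Hc) as [Kc' Nc'].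
destruct (Hn s Hs) as [Ks Ns]; destruct (Hn al Hal1) as [Kal Nal].
destruct (Hn al' al'_lt_1) as [Kal' Nal'].
eexists; unfold flux_coef.
apply nb_mult; [apply nb_mult; [apply nb_mult; [apply Hcst|exact Hz]|apply nb_mult]|].
- apply (nb_qi q Hq _ (fun z => z * z * q * q)).
  apply (nb_mult _ (fun z => z * z * q) (fun _ => RtoC q)); [|apply Hcst].
  apply (nb_mult _ (fun z => z * z) (fun _ => RtoC q)); [|apply Hcst].
  exact (nb_mult _ (fun z => z) (fun z => z) _ _ Hz Hz).
- apply (nb_qi q Hq _ (fun z => / z * / z)); exact (nb_mult _ (fun z => / z) (fun z => / z) _ _ Hi Hi).
- apply (nb_ext _ (fun z => / nfac a z * / nfac b z * / nfac c z * / nfac s z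
                            * / nfac al z * / nfac al' z)).
  + intros z Hzz; pose proof al'_lt_1 as Hl.
    pose proof (nfac_neq_0 a z Ha Hzz); pose proof (nfac_neq_0 b z Hb Hzz).
    pose proof (nfac_neq_0 c z Hc Hzz); pose proof (nfac_neq_0 s z Hs Hzz).
    pose proof (nfac_neq_0 al z Hal1 Hzz); pose proof (nfac_neq_0 al' z Hl Hzz).
    field; auto 20.
  + repeat (apply nb_mult; [|eassumption]); eassumption.
Qed.

Lemma nb_casorati : exists M, nb (Laur 1 (/ q)) casorati M.
Proof.
assert (H : forall v M, nb (Laur q (/ q)) v M ->
  nb (Laur 1 (/ q)) v M /\ nb (Laur 1 (/ q)) (fun z => v (q * z)) M).
{ intros v M Hv; split.
  - apply (nb_restrict q (/ q)); auto; lra.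
  - apply (nb_restrict (q / q) (/ q / q)); [right; field; lra| |apply nb_dilate; auto; lra].
    assert (0 < / q)%R by (apply Rinv_0_lt_compat; lra).
    assert (1 < / q)%R by (rewrite <- Rinv_1; apply Rinv_lt_contravar; lra).
    unfold Rdiv; nra. }
destruct (H _ _ Hv1), (H _ _ Hv2).
eexists; unfold casorati; apply nb_minus; apply nb_mult; eassumption.
Qed.

(** The integral A over |z| = 1 and the integral A' over |z| = 1/q satisfy A' = - A by the
reflection z -> 1/(q z), and A - A' is the sum of the residues at 1/alpha and alpha/q, which
the same reflection shows to be equal. *)
Lemma cint_flux :
  cint 1 flux (2 * PI * (flux_coef (/ al) * casorati (/ al) / (1 - q / (al * al)))).
Proof.
pose proof (q_C_neq_0 q Hq) as Hq0; pose proof al_neq_0 as Hal0.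
pose proof al_gt_q as Hga; pose proof al'_bounds as Hb'.
set (N := fun z => flux_coef z * casorati z).
assert (HN : exists M, nb (Laur 1 (/ q)) N M).
{ destruct nb_flux_coef as [K1 H1], nb_casorati as [K2 H2]; eexists; now apply nb_mult; eauto. }
destruct HN as [M HN].
assert (Hal'0 : al' <> 0) by (apply Cmod_gt_0; lra).
assert (Hu : (q < Cmod al < 1)%R) by lra.
assert (Hu' : (q < Cmod al' < 1)%R) by lra.
assert (Hdiff : al - al' <> 0).
{ intros E; assert (E1 : al = al') by (replace al with ((al - al') + al') by ring; rewrite E; ring).
  assert (Cmod al = Cmod al') by now rewrite <- E1. lra. }
destruct (pole_ex q al Hq Hu N M HN) as [[l1 H1] [l2 H2]].
destruct (pole_ex q al' Hq Hu' N M HN) as [[k1 K1] [k2 K2]].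
pose proof (pole_Laur q al Hq Hu N M HN l1 l2 H1 H2) as E1.
pose proof (pole_Laur q al' Hq Hu' N M HN k1 k2 K1 K2) as E2.
assert (Hfl : forall r, (r = 1 \/ r = / q)%R -> forall l k,
  cint r (fun z => N z * / (1 - al * z)) l -> cint r (fun z => N z * / (1 - al' * z)) k ->
  cint r flux (/ (al - al') * (al * l + - al' * k))).
{ intros r Hr l k H K.
  assert (Hr0 : (0 <= r)%R)
    by (destruct Hr as [->| ->]; [lra|left; apply Rinv_0_lt_compat; lra]).
  apply cint_ext with (fun z => / (al - al') *
     (al * (N z * / (1 - al * z)) + - al' * (N z * / (1 - al' * z)))); auto.
  - intros z Hz; unfold flux; fold (N z).
    assert (1 - al * z <> 0) by (apply (pole_nz q al Hq Hu); destruct Hr; [left|right]; lra).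
    assert (1 - al' * z <> 0) by (apply (pole_nz q al' Hq Hu'); destruct Hr; [left|right]; lra).
    clearbody al'. field; auto.
  - apply cint_scal, cint_plus; now apply cint_scal. }
pose proof (Hfl 1%R (or_introl eq_refl) _ _ H1 K1) as F1.
pose proof (Hfl (/ q)%R (or_intror eq_refl) _ _ H2 K2) as F2.
set (A := / (al - al') * (al * l1 + - al' * k1)) in *.
set (A' := / (al - al') * (al * l2 + - al' * k2)) in *.
(* The reflection z -> 1/(q z) maps one circle onto the other. *)
assert (EA : A' = - A).
{ apply (cint_unique (/ q) flux); auto.
  unfold cint in F1 |- *. apply cRInt_neg in F1; rewrite Ropp_involutive in F1.
  replace (- A) with ((-1) * A) by ring.
  apply cRInt_ext with (fun t => (-1) * flux (circ 1 (- t))); [|now apply cRInt_scal].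
  intros t; unfold circ.
  assert (Hiq : RtoC (/ q)%R <> 0).
  { rewrite RtoC_inv by lra; intros E; apply C1_nz; rewrite <- (Cinv_r q Hq0), E; ring. }
  assert (Het := expi_neq_0 t).
  replace (RtoC 1 * expi (- t)) with (/ (q * (RtoC (/ q)%R * expi t))).
  { rewrite flux_anti; [ring|now apply Cmult_neq_0]. }
  rewrite expi_neg, RtoC_inv by lra. field; auto. }
(* The same reflection maps 1/alpha to alpha/q, the inverse of al'. *)
assert (Esym : N (/ al') = - (al * al / q) * N (/ al)).
{ assert (Hf := flux_anti (/ al)).
  unfold N.
  replace (/ al') with (/ (q * / al)) by (unfold al'; field; auto).
  assert (Hia : / al <> 0)
    by (intros E; apply C1_nz; rewrite <- (Cinv_r al Hal0), E; ring).
  unfold flux_coef; rewrite !nfac_sym by auto; unfold casorati.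
  replace (v1 (q * / (q * / al))) with (v1 (/ al))
    by (rewrite <- (Ev1 (/ al)) by auto; f_equal; field; auto).
  replace (v2 (q * / (q * / al))) with (v2 (/ al))
    by (rewrite <- (Ev2 (/ al)) by auto; f_equal; field; auto).
  rewrite (Ev1 (q * / al)), (Ev2 (q * / al)) by now apply Cmult_neq_0.
  replace (/ (q * / al) * / (q * / al) * q * q) with (/ / al * / / al) by (field; auto).
  replace (/ / (q * / al) * / / (q * / al)) with (/ al * / al * q * q) by (field; auto).
  set (I2 := / (_ * _ * _ * _ * _ * _)).
  field; auto. }
assert (Hden : 1 - q / (al * al) <> 0).
{ intros E; apply Hdiff; unfold al'.
  replace (al - q / al) with (al * (1 - q / (al * al))) by (field; auto); rewrite E; ring. }
replace (2 * PI * (flux_coef (/ al) * casorati (/ al) / (1 - q / (al * al)))) with A; auto.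
assert (E3 : A + A = / (al - al') * (al * (l1 - l2) + - al' * (k1 - k2))).
{ transitivity (A - A'); [rewrite EA; ring|]; unfold A, A'; ring. }
rewrite E1, E2, Esym in E3.
assert (E4 : A = / 2 * (A + A)) by field.
rewrite E4, E3; fold (N (/ al)); unfold al' in *; field.
repeat split; auto; intros E; apply Hden.
replace (1 - q / (al * al)) with ((al * al - q) / (al * al)) by (field; auto).
rewrite E; field; auto.
Qed.

Theorem casorati_integral :
  cRInt (fun t => (L1 - L2) * (v1 (expi t) * v2 (expi t) * wfun (expi t))) 0 PI
    (2 * PI * (flux_coef (/ al) * casorati (/ al) / (1 - q / (al * al)))).
Proof.
pose proof cint_flux as H; set (A := 2 * PI * _) in *; clearbody A.
unfold cint in H.
assert (H' : cRInt (fun t => flux (expi t)) (- PI) PI A)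
  by (apply cRInt_ext with (2 := H); intros t; f_equal; unfold circ; ring).
pose proof PI_RGT_0 as Hpi.
assert (Hex : exists A, cRInt (fun t => flux (expi t)) (- PI) PI A) by (now exists A).
destruct (ex_RInt_Chasles_1 (V := C_R_CompleteNormedModule) (fun t => flux (expi t))
            (- PI) 0 PI (conj (Rlt_le (- PI) 0 ltac:(lra)) (Rlt_le 0 PI Hpi)) Hex) as [B HB].
destruct (ex_RInt_Chasles_2 (V := C_R_CompleteNormedModule) (fun t => flux (expi t))
            (- PI) 0 PI (conj (Rlt_le (- PI) 0 ltac:(lra)) (Rlt_le 0 PI Hpi)) Hex) as [B' HB'].
assert (E : A = B + B').
{ apply (cRInt_unique _ _ _ _ _ H').
  exact (is_RInt_Chasles (V := C_R_NormedModule) _ _ _ _ _ _ HB HB'). }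
apply cRInt_neg in HB; rewrite Ropp_0, Ropp_involutive in HB.
rewrite E, Cplus_comm.
apply cRInt_ext with (fun t => flux (expi t) + flux (expi (- t))).
- intros t; rewrite flux_eq by apply Cmod_expi; now rewrite expi_neg.
- now apply cRInt_plus.
Qed.

End Pair.
End Star.

(** * The two series of v *)

Section Series.
Variable q : R.
Hypothesis Hq : (0 < q < 1)%R.

Definition quad (p k x : C) : C := p * x - k * (x * x).
(** (x u, y u; q)_n in terms of p = x + y and k = x y, the form that is analytic in p alone.
*)
Definition ppoch (p k u : C) (n : nat) : C := pprod (fun j => quad p k (u * q ^ j)) n.
Definition ppoch_inf (p k u : C) : C := iprod (fun j => quad p k (u * q ^ j)).

(** Up to a factor independent of n, the term of index n of one of the two series of v, the
factors in front being included and 1/(x; q)_n being written (x q^n; q)_oo/(x; q)_oo.  In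
this form nothing is divided, and the exchange of u and w, t and 1/t, exchanges the two
series. *)
Definition qterm (b c p k y u w t : C) (n : nat) : C :=
  (ppoch_inf p k w * ppoch_inf y 1 w) * (ppoch p k u n * ppoch y 1 u n)
  * (qpoch_inf q (u * b * q ^ n) * qpoch_inf q (u * c * q ^ n)
     * (qpoch_inf q (q * q ^ n) * qpoch_inf q (q * t * q ^ n))).

(** With t = a/s, the two series of v carry the factors 1/(t, q/t; q)_oo and 1/(1/t, qt;
q)_oo = - t/(t, q/t; q)_oo. *)
Definition vterm (b c p k y a s t : C) (n : nat) : C :=
  q ^ n * (qterm b c p k y s a (/ t) n - t * qterm b c p k y a s t n).

Definition vsum (b c p k y a s t : C) : C := Clim eventually (csum (vterm b c p k y a s t)).

Section Membership.
Context {X : Type} (B : FunAlg X).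

Lemma nb_qn f M n : nb B f M -> nb B (fun x => f x * q ^ n) (M * q ^ n).
Proof.
intros H; apply nb_mult; auto.
apply (nb_le B _ (Cmod (q ^ n))); [apply nb_const|].
rewrite Cmod_qpow_nat by auto; apply Rle_refl.
Qed.

Lemma qn_bounds n : (0 < q ^ n <= 1)%R.
Proof.
split; [apply pow_lt; lra|]; rewrite <- (pow1 n); apply pow_incr; lra.
Qed.

Lemma nb_qn' f M n : nb B f M -> nb B (fun x => f x * q ^ n) M.
Proof.
intros H; apply (nb_le B _ (M * q ^ n)); [now apply nb_qn|].
pose proof (nb_pos B _ _ H); pose proof (qn_bounds n); nra.
Qed.

Lemma nb_quad p k u Mp Mk Mu j : nb B p Mp -> nb B k Mk -> nb B u Mu ->
  nb B (fun x => quad (p x) (k x) (u x * q ^ j)) ((Mp * Mu + Mk * (Mu * Mu)) * q ^ j).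
Proof.
intros Hp Hk Hu; pose proof (nb_pos B _ _ Hu); pose proof (nb_pos B _ _ Hk).
pose proof (qn_bounds j).
apply (nb_le B _ (Mp * (Mu * q ^ j) + Mk * ((Mu * q ^ j) * (Mu * q ^ j)))).
- apply nb_minus; apply nb_mult; auto; [now apply nb_qn|].
  apply (nb_mult B (fun x => u x * q ^ j) (fun x => u x * q ^ j)); now apply nb_qn.
- assert (Mk * (Mu * q ^ j * (Mu * q ^ j)) <= Mk * (Mu * Mu) * q ^ j)%R; [|lra].
  replace (Mk * (Mu * q ^ j * (Mu * q ^ j)))%R with (Mk * (Mu * Mu) * (q ^ j * q ^ j))%R by ring.
  apply Rmult_le_compat_l; [|nra]. apply Rmult_le_pos; nra.
Qed.

Lemma nb_P p k u Mp Mk Mu : nb B p Mp -> nb B k Mk -> nb B u Mu ->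
  exists M, nb B (fun x => ppoch_inf (p x) (k x) (u x)) M /\
            forall n, nb B (fun x => ppoch (p x) (k x) (u x) n) M.
Proof.
intros Hp Hk Hu.
set (K := (Mp * Mu + Mk * (Mu * Mu))%R).
assert (HK : (0 <= K)%R).
{ pose proof (nb_pos B _ _ Hp); pose proof (nb_pos B _ _ Hk); pose proof (nb_pos B _ _ Hu).
  unfold K; apply Rplus_le_le_0_compat; repeat apply Rmult_le_pos; auto. }
assert (Hj : forall j, nb B (fun x => quad (p x) (k x) (u x * q ^ j)) (K * q ^ j))
  by (intros; now apply nb_quad).
exists (Rmax (ibound K q) (pbound K q)); split.
- apply (nb_le B _ (ibound K q)); [|apply Rmax_l].
  apply (nb_iprod B (fun j x => quad (p x) (k x) (u x * q ^ j))); auto; lra.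
- intros n; apply (nb_le B _ (pbound K q)); [|apply Rmax_r].
  apply (nb_pprod B (fun j x => quad (p x) (k x) (u x * q ^ j))); auto; lra.
Qed.

Lemma nb_qterm b c p k y u w t Mp Mk My Mu Mw Mt :
  nb B p Mp -> nb B k Mk -> nb B y My -> nb B u Mu -> nb B w Mw -> nb B t Mt ->
  exists M, forall n, nb B (fun x => qterm b c (p x) (k x) (y x) (u x) (w x) (t x) n) M.
Proof.
intros Hp Hk Hy Hu Hw Ht.
assert (H1 : nb B (fun _ => 1) 1) by apply nb_one.
destruct (nb_P p k w _ _ _ Hp Hk Hw) as [A1 [HA1 _]].
destruct (nb_P y (fun _ => 1) w _ _ _ Hy H1 Hw) as [A2 [HA2 _]].
destruct (nb_P p k u _ _ _ Hp Hk Hu) as [A3 [_ HA3]].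
destruct (nb_P y (fun _ => 1) u _ _ _ Hy H1 Hu) as [A4 [_ HA4]].
assert (Hc : forall e, nb B (fun x => u x * e) (Mu * Cmod e)) 
  by (intros e; apply nb_mult; auto; apply nb_const).
assert (Hqt : nb B (fun x => q * t x) (Cmod q * Mt)) by (now apply nb_scal).
eexists; intros n; unfold qterm.
apply nb_mult; [apply nb_mult; apply nb_mult; eauto|].
apply nb_mult; apply nb_mult.
- apply (nb_qi q Hq B (fun x => u x * b * q ^ n)), nb_qn', Hc.
- apply (nb_qi q Hq B (fun x => u x * c * q ^ n)), nb_qn', Hc.
- apply (nb_qi q Hq B (fun _ => q * q ^ n)), (nb_qn' (fun _ => RtoC q)), nb_const.
- apply (nb_qi q Hq B (fun x => q * t x * q ^ n)), nb_qn', Hqt.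
Qed.

Lemma nb_vterm b c p k y a s t Mp Mk My Ma Ms Mt Mi :
  nb B p Mp -> nb B k Mk -> nb B y My -> nb B a Ma -> nb B s Ms ->
  nb B t Mt -> nb B (fun x => / t x) Mi ->
  exists M, forall n,
    nb B (fun x => vterm b c (p x) (k x) (y x) (a x) (s x) (t x) n) (M * q ^ n).
Proof.
intros Hp Hk Hy Ha Hs Ht Hi.
destruct (nb_qterm b c p k y s a (fun x => / t x) _ _ _ _ _ _ Hp Hk Hy Hs Ha Hi) as [K1 H1].
destruct (nb_qterm b c p k y a s t _ _ _ _ _ _ Hp Hk Hy Ha Hs Ht) as [K2 H2].
exists (K1 + Mt * K2)%R; intros n; unfold vterm.
apply (nb_ext B (fun x => (qterm b c (p x) (k x) (y x) (s x) (a x) (/ t x) n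
         - t x * qterm b c (p x) (k x) (y x) (a x) (s x) (t x) n) * q ^ n));
  [intros; ring|].
apply nb_qn, nb_minus; [apply H1|apply nb_mult; auto].
Qed.

End Membership.

Lemma vsum_sum b c p k y a s t : has_sum (vterm b c p k y a s t) (vsum b c p k y a s t).
Proof.
pose (B := Bdd (fun _ : unit => True)).
destruct (nb_vterm B b c (fun _ => p) (fun _ => k) (fun _ => y) (fun _ => a) (fun _ => s)
  (fun _ => t) _ _ _ _ _ _ _ (nb_const B p) (nb_const B k) (nb_const B y) (nb_const B a)
  (nb_const B s) (nb_const B t) (nb_const B (/ t))) as [M HM].
destruct (has_sum_ex (vterm b c p k y a s t) (fun n => M * q ^ n)%R (M / (1 - q))%R) as [l Hl].
- intros n; exact (nb_bound B _ _ (HM n) tt I).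
- apply is_series_geom_M; lra.
- unfold vsum; rewrite (Cto_Clim eventually _ _ Hl); exact Hl.
Qed.

Lemma qterm_sum b c p k y u w t : exists l, has_sum (fun n => q ^ n * qterm b c p k y u w t n) l.
Proof.
pose (B := Bdd (fun _ : unit => True)).
destruct (nb_qterm B b c (fun _ => p) (fun _ => k) (fun _ => y) (fun _ => u) (fun _ => w)
  (fun _ => t) _ _ _ _ _ _ (nb_const B p) (nb_const B k) (nb_const B y) (nb_const B u)
  (nb_const B w) (nb_const B t)) as [M HM].
apply (has_sum_ex _ (fun n => M * q ^ n)%R (M / (1 - q))%R).
- intros n; rewrite Cmod_mult, Cmod_qpow_nat, Rmult_comm by auto.
  apply Rmult_le_compat_r; [apply pow_le; lra|exact (nb_bound B _ _ (HM n) tt I)].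
- apply is_series_geom_M; lra.
Qed.

Lemma nb_vsum {X} (B : FunAlg X) b c p k y a s t Mp Mk My Ma Ms Mt Mi :
  nb B p Mp -> nb B k Mk -> nb B y My -> nb B a Ma -> nb B s Ms ->
  nb B t Mt -> nb B (fun x => / t x) Mi ->
  exists M, nb B (fun x => vsum b c (p x) (k x) (y x) (a x) (s x) (t x)) M.
Proof.
intros Hp Hk Hy Ha Hs Ht Hi.
destruct (nb_vterm B b c p k y a s t _ _ _ _ _ _ _ Hp Hk Hy Ha Hs Ht Hi) as [M HM].
exists (M / (1 - q))%R.
apply (nb_series B (fun n x => vterm b c (p x) (k x) (y x) (a x) (s x) (t x) n) _
         (fun n => M * q ^ n)%R); auto.
- apply is_series_geom_M; lra.
- intros x _; apply vsum_sum.
Qed.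

Lemma ppoch_add p k u m n : ppoch p k u (m + n) = ppoch p k u m * ppoch p k (u * q ^ m) n.
Proof.
unfold ppoch; rewrite pprod_add; f_equal; apply pprod_ext; intros j.
now rewrite Cpow_add_r, Cmult_assoc.
Qed.

Lemma ppoch_lim p k u : Cto eventually (ppoch p k u) (ppoch_inf p k u).
Proof.
pose (B := Bdd (fun _ : unit => True)).
apply (is_iprod (fun j => quad p k (u * q ^ j))
         (Cmod p * Cmod u + Cmod k * (Cmod u * Cmod u)) q); [|lra|].
- apply Rplus_le_le_0_compat; repeat apply Rmult_le_pos; apply Cmod_ge_0.
- intros j; refine (nb_bound B (fun _ => quad p k (u * q ^ j)) _ _ tt I).
  apply (nb_quad B (fun _ => p) (fun _ => k) (fun _ => u)); apply nb_const.
Qed.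

Lemma ppoch_inf_shift p k u m : ppoch_inf p k u = ppoch p k u m * ppoch_inf p k (u * q ^ m).
Proof.
apply (Cto_unique eventually (fun n => ppoch p k u (m + n))).
- apply Cto_eps; [filt|]; intros eps.
  destruct (proj1 (Cto_eps _ _ _) (ppoch_lim p k u) eps) as [N HN].
  exists N; intros n Hn; apply HN; lia.
- apply Cto_ext with (fun n => ppoch p k u m * ppoch p k (u * q ^ m) n).
  + filt.
  + exists O; intros n _; symmetry; apply ppoch_add.
  + apply Cto_scal; [filt|apply ppoch_lim].
Qed.

(** When u = w q^m, moving factors between finite and infinite products identifies the term
of index n + m of one series with the term of index n of the other. *)
Lemma qterm_resonance b c p k y w m n :
  qterm b c p k y w (w * q ^ m) (/ q ^ m) (n + m) = qterm b c p k y (w * q ^ m) w (q ^ m) n.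
Proof.
pose proof (Cpow_nz q m (q_C_neq_0 q Hq)) as Hqm.
unfold qterm; rewrite (Nat.add_comm n m), !ppoch_add, (ppoch_inf_shift p k w m), (ppoch_inf_shift y 1 w m).
rewrite !Cpow_add_r.
replace (q * / q ^ m * (q ^ m * q ^ n)) with (q * q ^ n) by (field; auto).
replace (w * q ^ m * b * q ^ n) with (w * b * (q ^ m * q ^ n)) by ring.
replace (w * q ^ m * c * q ^ n) with (w * c * (q ^ m * q ^ n)) by ring.
replace (q * q ^ m * q ^ n) with (q * (q ^ m * q ^ n)) by ring.
ring.
Qed.

Lemma qi_neg_pow j : qpoch_inf q (/ q ^ j) = 0.
Proof.
pose proof (Cpow_nz q j (q_C_neq_0 q Hq)) as Hqj.
rewrite (qi_shift q Hq _ (S j)); simpl.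
replace (1 - / q ^ j * q ^ j) with (RtoC 0) by (field; auto); ring.
Qed.

(** The factor (q^(n+1-m); q)_oo vanishes. *)
Lemma qterm_resonance_0 b c p k y u w m n : (n < m)%nat -> qterm b c p k y u w (/ q ^ m) n = 0.
Proof.
intros H; unfold qterm.
replace (q * / q ^ m * q ^ n) with (/ q ^ (m - S n)).
- rewrite qi_neg_pow; ring.
- pose proof (q_C_neq_0 q Hq) as Hq0.
  replace m with ((m - S n) + S n)%nat at 2 by lia.
  rewrite Cpow_add_r, Cpow_S; field; repeat split; auto; now apply Cpow_nz.
Qed.

Lemma has_sum_shift (f : nat -> C) m l : (forall n, (n < m)%nat -> f n = 0) ->
  has_sum (fun n => f (n + m)%nat) l -> has_sum f l.
Proof.
intros H0 H; apply Cto_eps; [filt|]; intros eps.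
destruct (proj1 (Cto_eps _ _ _) H eps) as [N HN].
assert (E : forall n, csum f (n + m) = csum (fun n => f (n + m)%nat) n).
{ induction n as [|n IH]; simpl; [|now rewrite IH].
  clear - H0; induction m as [|m IH]; simpl; [easy|].
  rewrite IH by (intros; apply H0; lia); rewrite H0 by lia; ring. }
exists (N + m)%nat; intros n Hn; replace n with ((n - m) + m)%nat by lia.
rewrite E; apply HN; lia.
Qed.

Lemma sum_resonance b c p k y w m l :
  has_sum (fun n => q ^ n * qterm b c p k y (w * q ^ m) w (q ^ m) n) l ->
  has_sum (fun n => q ^ n * qterm b c p k y w (w * q ^ m) (/ q ^ m) n) (q ^ m * l).
Proof.
intros H; apply (has_sum_shift (fun n => q ^ n * qterm b c p k y w (w * q ^ m) (/ q ^ m) n) m).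
- intros n Hn; rewrite qterm_resonance_0 by auto; ring.
- apply has_sum_ext with (2 := has_sum_scal (q ^ m) _ _ H).
  intros n; rewrite qterm_resonance, Cpow_add_r; ring.
Qed.

Lemma vsum_split b c p k y a s t l1 l2 :
  has_sum (fun n => q ^ n * qterm b c p k y s a (/ t) n) l1 ->
  has_sum (fun n => q ^ n * qterm b c p k y a s t n) l2 ->
  vsum b c p k y a s t = l1 - t * l2.
Proof.
intros H1 H2; apply (has_sum_unique _ _ _ (vsum_sum b c p k y a s t)).
replace (l1 - t * l2) with (l1 + (- t) * l2) by ring.
apply has_sum_ext with (2 := has_sum_plus _ _ _ _ H1 (has_sum_scal (- t) _ _ H2)).
intros n; unfold vterm; ring.
Qed.

(** The two cases t = q^m and t = q^(-m) are exchanged by a <-> s. *)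
Lemma vsum_resonance_pos b c p k y s m : vsum b c p k y (s * q ^ m) s (q ^ m) = 0.
Proof.
destruct (qterm_sum b c p k y (s * q ^ m) s (q ^ m)) as [l Hl].
rewrite (vsum_split _ _ _ _ _ _ _ _ _ _ (sum_resonance _ _ _ _ _ _ _ _ Hl) Hl); ring.
Qed.

Lemma vsum_resonance_neg b c p k y a m : vsum b c p k y a (a * q ^ m) (/ q ^ m) = 0.
Proof.
pose proof (Cpow_nz q m (q_C_neq_0 q Hq)) as Hqm.
destruct (qterm_sum b c p k y (a * q ^ m) a (q ^ m)) as [l Hl].
assert (Hl' : has_sum (fun n => q ^ n * qterm b c p k y (a * q ^ m) a (/ / q ^ m) n) l)
  by (replace (/ / q ^ m) with (q ^ m) by (field; auto); exact Hl).
rewrite (vsum_split _ _ _ _ _ _ _ _ _ _ Hl' (sum_resonance _ _ _ _ _ _ _ _ Hl)); field; auto.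
Qed.

End Series.

(** * The q-difference equation *)

(** The partial-fraction identity behind the action of the Askey-Wilson operator on the
basis (a z, a/z; q)_n; both sides are symmetric in b, c, d. *)
Lemma aw_core (b c d e z : C) : z <> 0 -> 1 - z * z <> 0 ->
  e * ((1 - b * z) * (1 - c * z) * (1 - d * z) * (1 - e * z) / (z * (1 - z * z))
    + (1 - b * / z) * (1 - c * / z) * (1 - d * / z) * (1 - e * / z)
      / (/ z * (1 - / z * / z)))
  = (1 - b * e) * (1 - c * e) * (1 - d * e)
    - (1 - b * c * d * e) * ((1 - e * z) * (1 - e * / z)).
Proof.
intros Hz H1.
assert (z * z - 1 <> 0).
{ intros E; apply H1; replace (1 - z * z) with (- (z * z - 1)) by ring; rewrite E; ring. }
field; auto.
Qed.

Section DiffEq.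
Variable q : R.
Hypothesis Hq : (0 < q < 1)%R.

Lemma qn_to_0 : Cto eventually (fun n => q ^ n) 0.
Proof.
apply Cto_eps; [filt|]; intros [eps He]; simpl.
destruct (pow_lt_1_zero q) with (y := eps) as [n Hn]; auto.
{ rewrite Rabs_pos_eq; lra. }
exists n; intros m Hm; specialize (Hn m Hm).
replace (q ^ m - 0) with (q ^ m) by ring; rewrite Cmod_qpow_nat by auto.
rewrite Rabs_pos_eq in Hn; auto; apply pow_le; lra.
Qed.

Lemma qi_0 : qpoch_inf q 0 = 1.
Proof.
apply (Cto_unique eventually (qpoch q 0)); [now apply qi_lim|].
apply Cto_ext with (fun _ => 1); [filt| |apply Cto_const, eventually_filter].
exists O; intros n _; induction n as [|n IH]; simpl; [easy|].
rewrite <- IH; ring.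
Qed.

Lemma jet_cont {X} (B : FunAlg X) r Hr F M h x : nb (Jet B r Hr) F M ->
  (Cmod h <= r)%R -> dom B x -> (Cmod (F (h, x) - F (RtoC 0, x)) <= M * Cmod h)%R.
Proof.
intros [w [H1 H2 H3 H4 H5]] Hh Hx.
assert (H0 : (Cmod 0 <= r)%R) by (rewrite Cmod_0; lra).
rewrite !H5 by auto.
replace (j0 w x + h * (j1 w x + h * j2 w h x) - (j0 w x + 0 * (j1 w x + 0 * j2 w 0 x)))
  with ((j1 w x + h * j2 w h x) * h) by ring.
rewrite Cmod_mult; apply Rmult_le_compat_r; [apply Cmod_ge_0|].
pose proof (nb_bound B _ _ H2 x Hx); pose proof (nb_bound B _ _ (H3 h Hh) x Hx).
pose proof (nb_pos B _ _ H1); pose proof (Cmod_ge_0 (j2 w h x)).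
eapply Rle_trans; [apply Cmod_triangle|]; rewrite Cmod_mult.
pose proof (Cmod_ge_0 h); nra.
Qed.

Lemma one_01 : (0 < 1 <= 1)%R. Proof. lra. Qed.

Lemma nb_jet_h {X} (B : FunAlg X) r Hr : nb (Jet B r Hr) (fun p => fst p) 1.
Proof.
assert (Hz : nb B (fun _ => 0) 0)
  by (apply (nb_le B _ (Cmod 0)); [apply nb_const|rewrite Cmod_0; lra]).
exists (mkJet (fun _ => 0) (fun _ => 1) (fun _ _ => 0) 0 1 0).
constructor; simpl; auto; [apply nb_one|lra|intros; ring].
Qed.

(** Continuity of (x; q)_oo, from the expansion of (l + h; q)_oo in h. *)
Lemma qi_cont {S} (F : (S -> Prop) -> Prop) {FF : Filter F} (f : S -> C) l :
  Cto F f l -> Cto F (fun x => qpoch_inf q (f x)) (qpoch_inf q l).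
Proof.
intros Hf; apply Cto_eps; auto; intros [eps He]; simpl.
pose (B := Bdd (fun _ : unit => True)).
pose proof (nb_qi q Hq (Jet B 1 one_01) _ _
  (nb_plus (Jet B 1 one_01) (fun _ => l) (fun p => fst p) _ _ (nb_const _ l)
     (nb_jet_h B 1 one_01))) as H.
set (M := ibound _ q) in H.
assert (HM : (0 <= M)%R) by (apply (nb_pos _ _ _ H)).
assert (Hd : (0 < Rmin 1 (eps / (M + 1)))%R)
  by (apply Rmin_pos; [lra|apply Rdiv_lt_0_compat; lra]).
generalize (proj1 (Cto_eps F f l) Hf (mkposreal _ Hd)); simpl.
apply filter_imp; intros x Hx.
pose proof (Rmin_l 1 (eps / (M + 1))); pose proof (Rmin_r 1 (eps / (M + 1))).
pose proof (jet_cont B 1 one_01 _ M (f x - l) tt H ltac:(lra) I) as Hc; simpl in Hc.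
replace (l + (f x - l)) with (f x) in Hc by ring; rewrite Cplus_0_r in Hc.
eapply Rle_lt_trans; [exact Hc|].
assert (Hx2 : (Cmod (f x - l) < eps / (M + 1))%R) by lra.
apply Rle_lt_trans with (M * (eps / (M + 1)))%R; [apply Rmult_le_compat_l; lra|].
apply Rmult_lt_reg_r with (M + 1)%R; [lra|]; field_simplify; [nra|lra].
Qed.

(** The coefficient of v(z) in the q-difference equation is minus the eigenvalue minus [diag_coef]
at z and at 1/z. *)
Definition diag_coef (a b c s z : C) : C :=
  (1 - a * z) * (1 - b * z) * (1 - c * z) * (1 - q * z / s)
  / ((1 - z * z) * (1 - z * z * q)).

(** The Askey-Wilson operator minus its eigenvalue [L], in the gauge where s = q/d enters
[shift_coef] like a, b, c. *)
Definition aw_op (a b c s L : C) (f : C -> C) (z : C) : C :=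
  shift_coef q a b c s z * f (q * z) + shift_coef q a b c s (/ z) * f (q * / z)
  - (L + diag_coef a b c s z + diag_coef a b c s (/ z)) * f z.

Definition zsym (z : C) : C := z + / z.

Lemma ppoch_xy x y u n : ppoch q (x + y) (x * y) u n = qpoch q (u * x) n * qpoch q (u * y) n.
Proof.
rewrite !qpoch_pprod, pprod_mult; apply pprod_ext; intros j; unfold quad; ring.
Qed.

Lemma ppoch_inf_xy x y u : ppoch_inf q (x + y) (x * y) u = qpoch_inf q (u * x) * qpoch_inf q (u * y).
Proof.
apply (Cto_unique eventually (ppoch q (x + y) (x * y) u)); [apply ppoch_lim; auto|].
apply Cto_ext with (fun n => qpoch q (u * x) n * qpoch q (u * y) n).
- filt.
- exists O; intros n _; symmetry; apply ppoch_xy.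
- apply Cto_mult; [filt|apply qi_lim; auto|apply qi_lim; auto].
Qed.

Lemma ppoch_zsym (u z : C) n : z <> 0 -> ppoch q (zsym z) 1 u n = qpoch q (u * z) n * qpoch q (u * / z) n.
Proof. intros Hz; rewrite <- (Cinv_r z Hz); apply ppoch_xy. Qed.

Lemma ppoch_inf_zsym (u z : C) : z <> 0 -> ppoch_inf q (zsym z) 1 u = qpoch_inf q (u * z) * qpoch_inf q (u * / z).
Proof. intros Hz; rewrite <- (Cinv_r z Hz); apply ppoch_inf_xy. Qed.

Lemma ppoch_shift (a z : C) m : z <> 0 ->
  (1 - a * z) * ppoch q (zsym (q * z)) 1 a (S m)
  = ppoch q (zsym z) 1 a m * ((1 - a * z * q ^ m) * (1 - a * z * q ^ m * q) * (1 - a * / (q * z))).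
Proof.
intros Hz; pose proof (q_C_neq_0 q Hq) as Hq0.
rewrite !ppoch_zsym by (auto; now apply Cmult_neq_0).
rewrite (qpoch_head q (a * / (q * z))).
replace (a * / (q * z) * q) with (a * / z) by (field; auto).
transitivity (((1 - a * z) * qpoch q (a * z * q) (S m))
              * ((1 - a * / (q * z)) * qpoch q (a * / z) m)).
- replace (a * (q * z)) with (a * z * q) by ring; ring.
- rewrite <- (qpoch_head q (a * z)).
  simpl; ring.
Qed.

Lemma ppoch_inf_shift_z (s z : C) : z <> 0 ->
  (1 - s * z) * ppoch_inf q (zsym (q * z)) 1 s = ppoch_inf q (zsym z) 1 s * (1 - s * / (q * z)).
Proof.
intros Hz; pose proof (q_C_neq_0 q Hq) as Hq0.
rewrite !ppoch_inf_zsym by (auto; now apply Cmult_neq_0).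
rewrite (qi_step q Hq (s * / (q * z))).
replace (s * / (q * z) * q) with (s * / z) by (field; auto).
rewrite (qi_step q Hq (s * z)).
replace (s * (q * z)) with (s * z * q) by ring; ring.
Qed.

(** The part of [qterm] that depends on z. *)
Definition pair_basis (a s : C) (n : nat) (z : C) : C := ppoch_inf q (zsym z) 1 s * ppoch q (zsym z) 1 a n.

Lemma shift_coef_diag_coef_0 (a b c s z : C) : z <> 0 -> s <> 0 ->
  1 - a * z <> 0 -> 1 - s * z <> 0 -> 1 - z * z <> 0 -> 1 - z * z * q <> 0 ->
  shift_coef q a b c s z * pair_basis a s 0 (q * z) - diag_coef a b c s z * pair_basis a s 0 z = 0.
Proof.
intros Hz Hs H1 H2 H3 H4; pose proof (q_C_neq_0 q Hq) as Hq0.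
unfold pair_basis; simpl.
replace (ppoch_inf q (zsym (q * z)) 1 s)
  with (ppoch_inf q (zsym z) 1 s * (1 - s * / (q * z)) / (1 - s * z))
  by (rewrite <- ppoch_inf_shift_z by auto; field; auto).
unfold shift_coef, diag_coef, ppoch; simpl; field; auto 10.
Qed.

(** A shift z -> q z changes only the first and last factors of each product, so all terms
are multiples of the basis element of index m. *)
Lemma shift_coef_diag_coef_S (a b c s z : C) m : z <> 0 -> s <> 0 ->
  1 - a * z <> 0 -> 1 - s * z <> 0 -> 1 - z * z <> 0 -> 1 - z * z * q <> 0 ->
  shift_coef q a b c s z * pair_basis a s (S m) (q * z) - diag_coef a b c s z * pair_basis a s (S m) z
  = pair_basis a s m z * (- (a * (1 - q * q ^ m) / q)
      * ((1 - b * z) * (1 - c * z) * (1 - q / s * z) * (1 - a * q ^ m * z) / (z * (1 - z * z)))).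
Proof.
intros Hz Hs H1 H2 H3 H4; pose proof (q_C_neq_0 q Hq) as Hq0.
unfold pair_basis.
replace (ppoch_inf q (zsym (q * z)) 1 s)
  with (ppoch_inf q (zsym z) 1 s * (1 - s * / (q * z)) / (1 - s * z))
  by (rewrite <- ppoch_inf_shift_z by auto; field; auto).
replace (ppoch q (zsym (q * z)) 1 a (S m))
  with (ppoch q (zsym z) 1 a m * ((1 - a * z * q ^ m) * (1 - a * z * q ^ m * q) * (1 - a * / (q * z)))
        / (1 - a * z))
  by (rewrite <- ppoch_shift by auto; field; auto).
replace (ppoch q (zsym z) 1 a (S m))
  with (ppoch q (zsym z) 1 a m * ((1 - a * q ^ m * z) * (1 - a * q ^ m * / z)))
  by (rewrite !ppoch_zsym by auto; simpl; ring).
generalize (ppoch_inf q (zsym z) 1 s) (ppoch q (zsym z) 1 a m) (q ^ m); intros u v w.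
unfold shift_coef, diag_coef; field; auto 10.
Qed.

Section Point.
Variables a b c s p k t z L : C.
Hypotheses (Ha0 : a <> 0) (Hs0 : s <> 0) (Hk : k = b * c / (a * s)) (Ht : t = a / s)
  (HL : L = - (1 - a * p + a * a * k)).
Hypotheses (Ha : (Cmod a < 1)%R) (Hs : (Cmod s < 1)%R) (Hz : Cmod z = 1%R) (Hz1 : z * z <> 1).

Lemma pt_z0 : z <> 0. Proof. now apply unit_neq_0. Qed.
Lemma pt_sq : 1 - z * z <> 0.
Proof.
intros E; apply Hz1; replace (z * z) with (1 - (1 - z * z)) by ring; rewrite E; ring.
Qed.
Lemma pt_sq' : 1 - / z * / z <> 0.
Proof.
pose proof pt_z0; intros E; apply pt_sq.
replace (1 - z * z) with (- (z * z) * (1 - / z * / z)) by (field; auto); rewrite E; ring.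
Qed.
Lemma pt_sqq : 1 - z * z * q <> 0. Proof. now apply unit_sq_neq. Qed.
Lemma pt_sqq' : 1 - / z * / z * q <> 0.
Proof. apply unit_sq_neq; auto; now apply unit_inv. Qed.
Lemma pt_e e : (Cmod e < 1)%R -> 1 - e * z <> 0 /\ 1 - e * / z <> 0.
Proof.
intros He; split; apply one_minus_neq_0; apply circ_e; auto; now apply unit_inv.
Qed.
Lemma pt_zi0 : / z <> 0. Proof. apply unit_neq_0; now apply unit_inv. Qed.
Lemma zsym_inv (x : C) : x <> 0 -> zsym (/ x) = zsym x.
Proof. intros Hx; unfold zsym; field; auto. Qed.

Lemma pair_basis_inv n : pair_basis a s n (/ z) = pair_basis a s n z.
Proof. unfold pair_basis; now rewrite zsym_inv by apply pt_z0. Qed.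

(** The two lines are the contributions of the indices m + 1 and m, by [aw_core]. *)
Lemma aw_op_pair_basis_S m :
  q ^ S m * aw_op a b c s L (pair_basis a s (S m)) z
  = pair_basis a s m z
    * ((1 - quad p k (a * q ^ S m)) * ((1 - a * q ^ m * z) * (1 - a * q ^ m * / z))
       - (1 - a * b * q ^ m) * (1 - a * c * q ^ m) * ((1 - q * q ^ m) * (1 - q * t * q ^ m))).
Proof.
pose proof (q_C_neq_0 q Hq) as Hq0.
pose proof pt_z0; pose proof pt_sq; pose proof pt_sq'; pose proof pt_sqq; pose proof pt_sqq'.
pose proof pt_zi0; destruct (pt_e a Ha); destruct (pt_e s Hs).
pose proof (shift_coef_diag_coef_S a b c s z m) as E1; pose proof (shift_coef_diag_coef_S a b c s (/ z) m) as E2.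
rewrite !pair_basis_inv in E2.
specialize (E1 ltac:(auto) ltac:(auto) ltac:(auto) ltac:(auto) ltac:(auto) ltac:(auto)).
specialize (E2 ltac:(auto) ltac:(auto) ltac:(auto) ltac:(auto) ltac:(auto) ltac:(auto)).
unfold aw_op.
transitivity (q ^ S m * ((shift_coef q a b c s z * pair_basis a s (S m) (q * z) - diag_coef a b c s z * pair_basis a s (S m) z)
  + (shift_coef q a b c s (/ z) * pair_basis a s (S m) (q * / z) - diag_coef a b c s (/ z) * pair_basis a s (S m) z)
  - L * pair_basis a s (S m) z)); [ring|].
rewrite E1, E2.
pose proof (aw_core b c (q / s) (a * q ^ m) z ltac:(auto) ltac:(auto)) as Hcore.
replace (pair_basis a s (S m) z)
  with (pair_basis a s m z * ((1 - a * q ^ m * z) * (1 - a * q ^ m * / z)))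
  by (unfold pair_basis; rewrite !ppoch_zsym by auto; simpl; ring).
set (X1 := (1 - b * z) * (1 - c * z) * (1 - q / s * z) * (1 - a * q ^ m * z) / (z * (1 - z * z)))
  in *.
set (X2 := (1 - b * / z) * (1 - c * / z) * (1 - q / s * / z) * (1 - a * q ^ m * / z)
           / (/ z * (1 - / z * / z))) in *.
rewrite Cpow_S.
transitivity (pair_basis a s m z * (- (1 - q * q ^ m) * (a * q ^ m * (X1 + X2))
   - q * q ^ m * L * ((1 - a * q ^ m * z) * (1 - a * q ^ m * / z)))); [field; auto|].
rewrite Hcore; f_equal.
rewrite HL, Hk, Ht; unfold quad; field; auto.
Qed.

Lemma aw_op_pair_basis_0 : aw_op a b c s L (pair_basis a s 0) z = pair_basis a s 0 z * (1 - quad p k a).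
Proof.
pose proof (q_C_neq_0 q Hq) as Hq0.
pose proof pt_z0; pose proof pt_sq; pose proof pt_sq'; pose proof pt_sqq; pose proof pt_sqq'.
pose proof pt_zi0; destruct (pt_e a Ha); destruct (pt_e s Hs).
pose proof (shift_coef_diag_coef_0 a b c s z) as E1; pose proof (shift_coef_diag_coef_0 a b c s (/ z)) as E2.
rewrite !pair_basis_inv in E2.
specialize (E1 ltac:(auto) ltac:(auto) ltac:(auto) ltac:(auto) ltac:(auto) ltac:(auto)).
specialize (E2 ltac:(auto) ltac:(auto) ltac:(auto) ltac:(auto) ltac:(auto) ltac:(auto)).
unfold aw_op.
transitivity ((shift_coef q a b c s z * pair_basis a s 0 (q * z) - diag_coef a b c s z * pair_basis a s 0 z)
  + (shift_coef q a b c s (/ z) * pair_basis a s 0 (q * / z) - diag_coef a b c s (/ z) * pair_basis a s 0 z)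
  - L * pair_basis a s 0 z); [ring|].
rewrite E1, E2, HL; unfold quad; ring.
Qed.

(** [tele (S m)] carries the finite product in p, k at index m + 1 but that in z at index m;
[tele 0] is 0 because it would contain (1; q)_oo. *)
Definition tele (n : nat) : C :=
  match n with
  | O => 0
  | S m => (ppoch_inf q p k s * ppoch q p k a (S m)) * pair_basis a s m z
      * (qpoch_inf q (a * b * q ^ m) * qpoch_inf q (a * c * q ^ m)
         * (qpoch_inf q (q * q ^ m) * qpoch_inf q (q * t * q ^ m)))
  end.

Lemma aw_op_scal K f x : aw_op a b c s L (fun w => K * f w) x = K * aw_op a b c s L f x.
Proof. unfold aw_op; ring. Qed.

Lemma aw_op_ext f g x : (forall w, f w = g w) -> aw_op a b c s L f x = aw_op a b c s L g x.
Proof. intros H; unfold aw_op; now rewrite !H. Qed.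

(** Because the operator maps the basis element of index n to a combination of those of
indices n and n - 1. *)
Lemma aw_op_qterm n :
  q ^ n * aw_op a b c s L (fun w => qterm q b c p k (zsym w) a s t n) z = tele (S n) - tele n.
Proof.
set (K := ppoch_inf q p k s * ppoch q p k a n
   * (qpoch_inf q (a * b * q ^ n) * qpoch_inf q (a * c * q ^ n)
         * (qpoch_inf q (q * q ^ n) * qpoch_inf q (q * t * q ^ n)))).
rewrite (aw_op_ext _ (fun w => K * pair_basis a s n w)) by (intros w; unfold qterm, K, pair_basis; ring).
rewrite aw_op_scal.
destruct n as [|m].
- rewrite aw_op_pair_basis_0; unfold tele, K, ppoch; simpl pprod; simpl Cpow.
  rewrite (Cmult_1_r a); ring.
- transitivity (K * (q ^ S m * aw_op a b c s L (pair_basis a s (S m)) z)); [ring|].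
  rewrite aw_op_pair_basis_S; unfold tele, K.
  rewrite (qi_step q Hq (a * b * q ^ m)), (qi_step q Hq (a * c * q ^ m)).
  rewrite (qi_step q Hq (q * q ^ m)), (qi_step q Hq (q * t * q ^ m)).
  replace (a * b * q ^ m * q) with (a * b * q ^ S m) by (rewrite Cpow_S; ring).
  replace (a * c * q ^ m * q) with (a * c * q ^ S m) by (rewrite Cpow_S; ring).
  replace (q * q ^ m * q) with (q * q ^ S m) by (rewrite Cpow_S; ring).
  replace (q * t * q ^ m * q) with (q * t * q ^ S m) by (rewrite Cpow_S; ring).
  change (ppoch q p k a (S (S m))) with (ppoch q p k a (S m) * (1 - quad p k (a * q ^ S m))).
  replace (pair_basis a s (S m) z)
    with (pair_basis a s m z * ((1 - a * q ^ m * z) * (1 - a * q ^ m * / z)))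
    by (unfold pair_basis; rewrite !ppoch_zsym by apply pt_z0; simpl; ring).
  ring.
Qed.

(** The limit is symmetric in a and s, which is why the boundary terms of the two series
cancel. *)
Lemma tele_lim : Cto eventually tele
  ((ppoch_inf q p k s * ppoch_inf q (zsym z) 1 s) * (ppoch_inf q p k a * ppoch_inf q (zsym z) 1 a)).
Proof.
apply Cto_shift; unfold tele.
assert (Hv : forall x, Cto eventually (fun n => qpoch_inf q (x * q ^ n)) 1).
{ intros x; rewrite <- qi_0; apply qi_cont; [filt|].
  replace (RtoC 0) with (x * 0) by ring.
  apply Cto_scal; [filt|apply qn_to_0]. }
pose proof (proj1 (Cto_shift _ _) (ppoch_lim q Hq p k a)) as H1.
pose proof (ppoch_lim q Hq (zsym z) 1 a) as H2.
assert (HF : Filter (eventually)) by filt.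
replace ((ppoch_inf q p k s * ppoch_inf q (zsym z) 1 s) * (ppoch_inf q p k a * ppoch_inf q (zsym z) 1 a))
  with ((ppoch_inf q p k s * ppoch_inf q p k a) * (ppoch_inf q (zsym z) 1 s * ppoch_inf q (zsym z) 1 a) * ((1 * 1) * (1 * 1)))
  by ring.
exact (Cto_mult _ _ _ _ _
  (Cto_mult _ _ _ _ _ (Cto_scal _ _ (ppoch_inf q p k s) _ H1) (Cto_scal _ _ (ppoch_inf q (zsym z) 1 s) _ H2))
  (Cto_mult _ _ _ _ _ (Cto_mult _ _ _ _ _ (Hv (a * b)) (Hv (a * c)))
                      (Cto_mult _ _ _ _ _ (Hv (RtoC q)) (Hv (q * t))))).
Qed.

End Point.
End DiffEq.

Section WEq.
Variable q : R.
Hypothesis Hq : (0 < q < 1)%R.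

Definition eigval (a p k : C) : C := - (1 - a * p + a * a * k).

(** Up to the factor a/s the operator is symmetric in a and s, so [aw_op_qterm] applies to both
series. *)
Lemma aw_op_swap (a b c s p k z : C) (f : C -> C) :
  a <> 0 -> s <> 0 -> k = b * c / (a * s) ->
  Cmod z = 1%R -> z * z <> 1 ->
  aw_op q a b c s (eigval a p k) f z = a / s * aw_op q s b c a (eigval s p k) f z.
Proof.
intros Ha Hs Hk Hz Hz1.
pose proof (pt_z0 z Hz) as Z0. pose proof (pt_sq z Hz1) as Z1.
pose proof (pt_sq' z Hz Hz1) as Z2. pose proof (pt_sqq q Hq z Hz) as Z3.
pose proof (pt_sqq' q Hq z Hz) as Z4.
pose proof (q_C_neq_0 q Hq) as Hq0.
assert (EK : forall x, 1 - x * x <> 0 -> 1 - x * x * q <> 0 ->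
  shift_coef q a b c s x = a / s * shift_coef q s b c a x).
{ intros x X1 X2; unfold shift_coef; field; auto. }
assert (EL : eigval a p k + diag_coef q a b c s z + diag_coef q a b c s (/ z)
  = a / s * (eigval s p k + diag_coef q s b c a z + diag_coef q s b c a (/ z))).
{ unfold eigval, diag_coef; rewrite Hk.
  assert (Z5 : z * z - 1 <> 0)
    by (intros E; apply Z1; replace (1 - z * z) with (- (z * z - 1)) by ring; rewrite E; ring).
  assert (Z6 : z * z - q <> 0).
  { intros E; apply Z4; replace (1 - / z * / z * q) with ((z * z - q) / (z * z)) by (field; auto).
    rewrite E; field; auto. }
  field; repeat split; auto. }
unfold aw_op; rewrite !EK, EL by auto; ring.
Qed.

(** The two telescoping sums have the boundary terms t E and t E, with E the limit in
[tele_lim]. *)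
Lemma aw_op_vsum (a b c s p k t z : C) :
  a <> 0 -> s <> 0 -> k = b * c / (a * s) -> t = a / s ->
  (Cmod a < 1)%R -> (Cmod s < 1)%R -> Cmod z = 1%R -> z * z <> 1 ->
  aw_op q a b c s (eigval a p k) (fun w => vsum q b c p k (zsym w) a s t) z = 0.
Proof.
intros Ha0 Hs0 Hk Ht Ha Hs Hz Hz1.
pose (U := fun n w => vterm q b c p k (zsym w) a s t n).
assert (H1 : has_sum (fun n => aw_op q a b c s (eigval a p k) (U n) z)
  (aw_op q a b c s (eigval a p k) (fun w => vsum q b c p k (zsym w) a s t) z)).
{ unfold aw_op.
  apply has_sum_ext with (fun n => (shift_coef q a b c s z * U n (q * z)
    + shift_coef q a b c s (/ z) * U n (q * / z))
    + - (eigval a p k + diag_coef q a b c s z + diag_coef q a b c s (/ z)) * U n z); [intros n; ring|].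
  refine (eq_ind _ (has_sum _) (has_sum_plus _ _ _ _ (has_sum_plus _ _ _ _
    (has_sum_scal _ _ _ (vsum_sum q Hq b c p k (zsym (q * z)) a s t))
    (has_sum_scal _ _ _ (vsum_sum q Hq b c p k (zsym (q * / z)) a s t)))
    (has_sum_scal _ _ _ (vsum_sum q Hq b c p k (zsym z) a s t))) _ _); ring. }
assert (Hti : / t = s / a) by (rewrite Ht; field; auto).
assert (Hk' : k = b * c / (s * a)) by (rewrite Hk; field; auto).
apply (has_sum_unique _ _ _ H1).
apply Cto_ext with (fun n => t * (tele q s b c a p k (/ t) z n - tele q a b c s p k t z n)).
- filt.
- exists O; intros n _.
  transitivity (csum (fun n => t * (tele q s b c a p k (/ t) z (S n) - tele q a b c s p k t z (S n))
     - t * (tele q s b c a p k (/ t) z n - tele q a b c s p k t z n)) n).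
  + rewrite (csum_telescope
      (fun n => t * (tele q s b c a p k (/ t) z n - tele q a b c s p k t z n))); simpl; ring.
  + apply csum_ext; intros j _.
    pose proof (aw_op_qterm q Hq a b c s p k t z (eigval a p k) Ha0 Hs0 Hk Ht eq_refl Ha Hs Hz Hz1 j) as E1.
    pose proof (aw_op_qterm q Hq s b c a p k (/ t) z (eigval s p k) Hs0 Ha0 Hk' Hti eq_refl Hs Ha Hz Hz1 j)
      as E2.
    set (g1 := fun w => qterm q b c p k (zsym w) a s t j) in *.
    set (g2 := fun w => qterm q b c p k (zsym w) s a (/ t) j) in *.
    transitivity (q ^ j * aw_op q a b c s (eigval a p k) g2 z
                  - t * (q ^ j * aw_op q a b c s (eigval a p k) g1 z)).
    * rewrite (aw_op_swap a b c s p k z g2) by auto.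
      rewrite E1, <- Ht.
      transitivity (t * (q ^ j * aw_op q s b c a (eigval s p k) g2 z)
         - t * (tele q a b c s p k t z (S j) - tele q a b c s p k t z j)); [rewrite E2|]; ring.
    * unfold aw_op, U, vterm, g1, g2; ring.
- pose proof (tele_lim q Hq a b c s p k t z) as L1.
  pose proof (tele_lim q Hq s b c a p k (/ t) z) as L2.
  replace (RtoC 0) with (t * ((ppoch_inf q p k a * ppoch_inf q (zsym z) 1 a) * (ppoch_inf q p k s * ppoch_inf q (zsym z) 1 s)
     - (ppoch_inf q p k s * ppoch_inf q (zsym z) 1 s) * (ppoch_inf q p k a * ppoch_inf q (zsym z) 1 a))) by ring.
  apply Cto_scal; [filt|].
  apply Cto_minus; auto; filt.
Qed.
End WEq.

(** * Comparison with the two-term formula *)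

Section QPow.
Variable q : R.
Hypothesis Hq : (0 < q < 1)%R.

Lemma qpow_plus u v : qpow q (u + v) = qpow q u * qpow q v.
Proof.
unfold qpow, Re, Im; simpl.
rewrite !Rmult_plus_distr_r, exp_plus, cos_plus, sin_plus.
apply injective_projections; simpl; ring.
Qed.

Lemma qpow_0 : qpow q 0 = 1.
Proof.
unfold qpow, Re, Im; simpl; rewrite !Rmult_0_l, exp_0, cos_0, sin_0.
apply injective_projections; simpl; ring.
Qed.

Lemma qpow_1 : qpow q 1 = q.
Proof.
unfold qpow, Re, Im; simpl; rewrite Rmult_0_l, Rmult_1_l, exp_ln, cos_0, sin_0 by lra.
apply injective_projections; simpl; ring.
Qed.

Lemma qpow_neg_mult z : qpow q (- z) * qpow q z = 1.
Proof. rewrite <- qpow_plus; replace (- z + z) with (RtoC 0) by ring; apply qpow_0. Qed.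

Lemma qpow_neq_0 z : qpow q z <> 0.
Proof. intros E; pose proof (qpow_neg_mult z) as H; rewrite E in H; apply C1_nz; rewrite <- H; ring. Qed.

Lemma qpow_neg z : qpow q (- z) = / qpow q z.
Proof.
pose proof (qpow_neq_0 z).
replace (qpow q (- z)) with (qpow q (- z) * qpow q z / qpow q z) by (field; auto).
rewrite qpow_neg_mult; field; auto.
Qed.

Lemma qpow_minus_1 z : qpow q (z - 1) = qpow q z / q.
Proof.
unfold Cminus; rewrite qpow_plus, qpow_neg, qpow_1; reflexivity.
Qed.

Lemma qpow_1_minus z : qpow q (1 - z) = q / qpow q z.
Proof.
unfold Cminus; rewrite qpow_plus, qpow_neg, qpow_1; reflexivity.
Qed.

Lemma qpow_1_plus z : qpow q (1 + z) = q * qpow q z.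
Proof. now rewrite qpow_plus, qpow_1. Qed.

Lemma Cmod_qpow z : Cmod (qpow q z) = exp (Re z * ln q).
Proof.
unfold qpow.
replace (exp (Re z * ln q) * cos (Im z * ln q), exp (Re z * ln q) * sin (Im z * ln q))%R
  with (exp (Re z * ln q) * expi (Im z * ln q))
  by (unfold expi; apply injective_projections; simpl; ring).
rewrite Cmod_mult, Cmod_expi, Cmod_R, Rabs_pos_eq; [ring|left; apply exp_pos].
Qed.

(** The simple zeros of this theta function at the integer powers of q are the singularities
of the two-term formula. *)
Definition theta_fun (t : C) : C := qpoch_inf q t * qpoch_inf q (q / t).
Definition v_const (a b c : C) : C :=
  qpoch_inf q (a * b) * qpoch_inf q (a * c) * qpoch_inf q (b * c) * qpoch_inf q q.

(** If K = 0 the value of [Cseries f] does not matter, even when the series diverges. *)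
Lemma Cseries_scal K f l : has_sum (fun n => K * f n) l -> K * Cseries f = l.
Proof.
intros H; destruct (Ceq_dec K 0) as [->|HK].
- rewrite Cmult_0_l; apply (has_sum_unique (fun n => 0 * f n)); auto.
  apply Cto_ext with (fun _ => 0); [filt| |apply Cto_const, eventually_filter].
  exists O; intros n _; induction n as [|n IH]; simpl; [easy|rewrite <- IH; ring].
- rewrite (has_sum_Cseries f (/ K * l)); [field; auto|].
  apply has_sum_ext with (2 := has_sum_scal (/ K) _ _ H); intros n; field; auto.
Qed.

Lemma qpoch_ratio x n : qpoch_inf q x <> 0 ->
  / qpoch q x n = qpoch_inf q (x * q ^ n) / qpoch_inf q x.
Proof.
intros H; rewrite (qi_shift q Hq x n) in *.
assert (qpoch q x n <> 0) by (intros E; apply H; rewrite E; ring).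
assert (qpoch_inf q (x * q ^ n) <> 0) by (intros E; apply H; rewrite E; ring).
field; auto.
Qed.

Lemma qpoch_nz x n : qpoch_inf q x <> 0 -> qpoch q x n <> 0.
Proof. rewrite (qi_shift q Hq x n); intros H E; apply H; rewrite E; ring. Qed.

Lemma Cmult_nz_l (x y : C) : x * y <> 0 -> x <> 0.
Proof. intros H E; apply H; rewrite E; ring. Qed.
Lemma Cmult_nz_r (x y : C) : x * y <> 0 -> y <> 0.
Proof. intros H E; apply H; rewrite E; ring. Qed.

(** p and k are the sum and the product of X/a and Y/a, so every pair of q-shifted
factorials with arguments containing X and Y becomes one [ppoch] or [ppoch_inf]. *)
Lemma v_formula_vsum (nu z a b c d : C) (s t p k : C) :
  a <> 0 -> d <> 0 -> s = q / d -> t = a / s ->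
  p = (qpow q (- nu) + a * b * c * d * qpow q (nu - 1)) / a -> k = b * c / (a * s) ->
  (Cmod (a * b) < 1)%R -> (Cmod (a * c) < 1)%R -> (Cmod (b * c) < 1)%R ->
  (Cmod (s * b) < 1)%R -> (Cmod (s * c) < 1)%R -> theta_fun t <> 0 ->
  v_formula q nu z a b c d = vsum q b c p k (zsym (qpow q z)) a s t / (theta_fun t * v_const a b c).
Proof.
intros Ha Hd Es Et Ep Ek Hab Hac Hbc Hsb Hsc Hth.
pose proof (q_C_neq_0 q Hq) as Hq0.
assert (Hs : s <> 0) by (rewrite Es; intros E; apply Hq0;
  replace (RtoC q) with (q / d * d) by (field; auto); rewrite E; ring).
assert (Ht0 : t <> 0) by (rewrite Et; intros E; apply Ha;
  replace a with (a / s * s) by (field; auto); rewrite E; ring).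
pose proof (qpow_neq_0 nu) as Hn; pose proof (qpow_neq_0 z) as Hz.
set (zt := qpow q z) in *.
set (X := qpow q (- nu)) in *.
set (Y := a * b * c * d * qpow q (nu - 1)) in *.
assert (EX : X = / qpow q nu) by apply qpow_neg.
assert (EY : Y = a * b * c * d * qpow q nu / q)
  by (unfold Y; rewrite qpow_minus_1; field; auto).
assert (Ep' : p = X / a + Y / a) by (rewrite Ep; field; auto).
assert (Ek' : k = (X / a) * (Y / a))
  by (rewrite Ek, EX, EY, Es; field; auto).
assert (N1 : qpoch_inf q t <> 0) by exact (Cmult_nz_l _ _ Hth).
assert (N2 : qpoch_inf q (q / t) <> 0) by exact (Cmult_nz_r _ _ Hth).
assert (N3 : 1 - t <> 0 /\ qpoch_inf q (t * q) <> 0)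
  by (rewrite (qi_step q Hq) in N1; split; [exact (Cmult_nz_l _ _ N1)|exact (Cmult_nz_r _ _ N1)]).
destruct N3 as [N3 N4].
assert (N12 : t - 1 <> 0)
  by (intros E; apply N3; replace (1 - t) with (- (t - 1)) by ring; rewrite E; ring).
assert (N5 : qpoch_inf q (a * b) <> 0) by (now apply qi_neq_0).
assert (N6 : qpoch_inf q (a * c) <> 0) by (now apply qi_neq_0).
assert (N7 : qpoch_inf q (b * c) <> 0) by (now apply qi_neq_0).
assert (N8 : qpoch_inf q (s * b) <> 0) by (now apply qi_neq_0).
assert (N9 : qpoch_inf q (s * c) <> 0) by (now apply qi_neq_0).
assert (N10 : qpoch_inf q q <> 0) by (apply qi_neq_0; auto; rewrite Cmod_q by auto; lra).
destruct (qterm_sum q Hq b c p k (zsym zt) s a (/ t)) as [l1 H1].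
destruct (qterm_sum q Hq b c p k (zsym zt) a s t) as [l2 H2].
rewrite (vsum_split q Hq b c p k (zsym zt) a s t l1 l2 H1 H2).
unfold v_formula, phi43; fold X; fold Y.
rewrite qpow_1_minus, qpow_1_plus, qpow_1_minus, (qpow_neg z); fold zt.
replace (b * c * qpow q nu) with (s * (Y / a)) by (rewrite EY, Es; field; auto).
replace (q / qpow q nu / (a * d)) with (s * (X / a)) by (rewrite EX, Es; field; auto).
replace (q * zt / d) with (s * zt) by (rewrite Es; field; auto).
replace (q / zt / d) with (s * / zt) by (rewrite Es; field; auto).
match goal with |- ?A * Cseries ?f + ?B * Cseries ?g = _ =>
  set (K1 := A); set (K2 := B); set (f1 := f); set (f2 := g) end.
assert (F1 : has_sum (fun n => K1 * f1 n) (- t / (theta_fun t * v_const a b c) * l2)).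
{ apply has_sum_ext with (2 := has_sum_scal (- t / (theta_fun t * v_const a b c)) _ _ H2).
  intros n; unfold f1, K1, qpochs, qpochs_inf; simpl fold_right.
  unfold qterm; rewrite Ep', Ek', (ppoch_inf_xy q Hq), ppoch_xy, ppoch_inf_zsym, ppoch_zsym by auto.
  replace (a * (X / a)) with X by (field; auto).
  replace (a * (Y / a)) with Y by (field; auto).
  replace (q / (a * d)) with (/ t) by (rewrite Et, Es; field; auto).
  replace (a * d) with (t * q) by (rewrite Et, Es; field; auto).
  rewrite (qi_step q Hq (/ t)).
  replace (/ t * q) with (q / t) by (unfold Cdiv; ring).
  unfold theta_fun, v_const; rewrite (qi_step q Hq t).
  assert (Q1 := qpoch_ratio (a * b) n N5); assert (Q2 := qpoch_ratio (a * c) n N6).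
  assert (Q3 := qpoch_ratio q n N10); assert (Q4 := qpoch_ratio (t * q) n N4).
  replace (q * t * q ^ n) with (t * q * q ^ n) by ring.
  assert (N11 : 1 - / t <> 0).
  { intros E; apply N3; replace (1 - t) with (- t * (1 - / t)) by (field; auto); rewrite E; ring. }
  set (A := qpoch q X n * (qpoch q Y n * (qpoch q (a * zt) n * (qpoch q (a * / zt) n * 1)))).
  transitivity ((qpoch_inf q (s * (Y / a)) * (qpoch_inf q (s * (X / a))
     * (qpoch_inf q (s * zt) * (qpoch_inf q (s * / zt) * 1))))
     * A * q ^ n * / (qpoch_inf q (b * c) * ((1 - / t) * qpoch_inf q (q / t)))
     * ((/ qpoch q q n) * (/ qpoch q (a * b) n) * (/ qpoch q (a * c) n) * (/ qpoch q (t * q) n))).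
  - rewrite Q1, Q2, Q3, Q4; unfold A.
    field; repeat split; auto.
  - assert (M1 := qpoch_nz q n N10); assert (M2 := qpoch_nz _ n N5).
    assert (M3 := qpoch_nz _ n N6); assert (M4 := qpoch_nz _ n N4).
    field; repeat split; auto. }
assert (F2 : has_sum (fun n => K2 * f2 n) (/ (theta_fun t * v_const a b c) * l1)).
{ apply has_sum_ext with (2 := has_sum_scal (/ (theta_fun t * v_const a b c)) _ _ H1).
  intros n; unfold f2, K2, qpochs, qpochs_inf; simpl fold_right.
  unfold qterm; rewrite Ep', Ek', (ppoch_inf_xy q Hq), ppoch_xy, ppoch_inf_zsym, ppoch_zsym by auto.
  replace (a * (X / a)) with X by (field; auto).
  replace (a * (Y / a)) with Y by (field; auto).
  replace (q * b / d) with (s * b) by (rewrite Es; field; auto).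
  replace (q * c / d) with (s * c) by (rewrite Es; field; auto).
  replace (a * d / q) with t by (rewrite Et, Es; field; auto).
  replace (q * (q * 1) / (a * d)) with (q / t) by (rewrite Et, Es; field; auto).
  replace (q * / t) with (q / t) by (unfold Cdiv; ring).
  unfold theta_fun, v_const.
  assert (Q1 := qpoch_ratio (s * b) n N8); assert (Q2 := qpoch_ratio (s * c) n N9).
  assert (Q3 := qpoch_ratio q n N10); assert (Q4 := qpoch_ratio (q / t) n N2).
  set (A := qpoch q (s * (X / a)) n * (qpoch q (s * (Y / a)) n * (qpoch q (s * zt) n * (qpoch q (s * / zt) n * 1)))).
  transitivity ((qpoch_inf q X * (qpoch_inf q Y
     * (qpoch_inf q (s * b) * (qpoch_inf q (s * c) * (qpoch_inf q (a * zt) * (qpoch_inf q (a * / zt) * 1))))))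
     * A * q ^ n * / (qpoch_inf q (a * b) * (qpoch_inf q (a * c) * (qpoch_inf q (b * c) * qpoch_inf q t)))
     * ((/ qpoch q q n) * (/ qpoch q (s * b) n) * (/ qpoch q (s * c) n) * (/ qpoch q (q / t) n))).
  - rewrite Q1, Q2, Q3, Q4; unfold A.
    field; repeat split; auto.
  - assert (M1 := qpoch_nz q n N10); assert (M2 := qpoch_nz _ n N8).
    assert (M3 := qpoch_nz _ n N9); assert (M4 := qpoch_nz _ n N2).
    field; repeat split; auto. }
rewrite (Cseries_scal K1 f1 _ F1), (Cseries_scal K2 f2 _ F2).
field; split; auto.
unfold v_const; repeat apply Cmult_neq_0; auto.
Qed.

End QPow.

(** * Extension of v to all values of the spectral parameter *)

Definition pnbhd (d : C) : (C -> Prop) -> Prop := locally' (T := C_UniformSpace) d.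

Lemma pnbhd_iff d (P : C -> Prop) :
  pnbhd d P <-> exists eps : posreal, forall y : C, (Cmod (y - d) < eps)%R -> y <> d -> P y.
Proof.
split.
- intros [eps H]; exists eps; intros y Hy Hyd; apply H; auto.
  assert (Hm := Rmax_Cmod (y - d)).
  pose proof (Rmax_l (Rabs (fst (y - d))) (Rabs (snd (y - d)))).
  pose proof (Rmax_r (Rabs (fst (y - d))) (Rabs (snd (y - d)))).
  split; [change (Rabs (fst (y - d)%C) < eps)%R|change (Rabs (snd (y - d)%C) < eps)%R]; lra.
- intros [eps H].
  pose proof (locally_ball_norm (K := C_AbsRing) (V := C_NormedModule) d eps) as Hb.
  unfold pnbhd, locally', within.
  revert Hb; apply filter_imp; intros y Hy Hyd; now apply H.
Qed.

Global Instance pnbhd_filter d : ProperFilter (pnbhd d).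
Proof.
constructor; [|apply within_filter, locally_filter].
intros P HP; apply pnbhd_iff in HP; destruct HP as [[eps He] H]; simpl in H.
exists (d + (eps / 2)%R); apply H.
- replace (d + (eps / 2)%R - d) with (RtoC (eps / 2)%R) by ring.
  rewrite Cmod_R, Rabs_pos_eq; lra.
- intros E; assert (E2 : RtoC (eps / 2)%R = 0)
    by (replace (RtoC (eps / 2)%R) with (d + (eps / 2)%R - d) by ring; rewrite E; ring).
  apply RtoC_inj in E2; lra.
Qed.

Lemma pnbhd_small d (r : R) : (0 < r)%R -> pnbhd d (fun y => (Cmod (y - d) < r)%R /\ y <> d).
Proof. intros Hr; apply pnbhd_iff; exists (mkposreal r Hr); auto. Qed.

Lemma Cto_id d : Cto (pnbhd d) (fun h => h) d.
Proof.
apply Cto_eps; [filt|]; intros eps.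
apply pnbhd_iff; exists eps; auto.
Qed.

Lemma nb_jet_lift {X} (B : FunAlg X) r Hr f M :
  nb B f M -> nb (Jet B r Hr) (fun x => f (snd x)) M.
Proof.
intros H.
assert (Hz : nb B (fun _ => 0) 0)
  by (apply (nb_le B _ (Cmod 0)); [apply nb_const|rewrite Cmod_0; lra]).
exists (mkJet f (fun _ => 0) (fun _ _ => 0) M 0 0).
constructor; simpl; auto; [lra|intros; ring].
Qed.

Lemma one_plus_neq_0 h : (Cmod h <= 1 / 2)%R -> 1 + h <> 0.
Proof.
intros Hh; replace (1 + h) with (1 - - h) by ring; apply one_minus_neq_0.
rewrite Cmod_opp; lra.
Qed.

Lemma half_01 : (0 < 1 / 2 <= 1)%R. Proof. lra. Qed.

(** 1/(1 + h) = 1 - h + h^2/(1 + h). *)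
Lemma nb_jet_inv {X} (B : FunAlg X) :
  nb (Jet B (1 / 2) half_01) (fun x => / (1 + fst x)) (1 + 1 + 2).
Proof.
exists (mkJet (fun _ => 1) (fun _ => -1) (fun h _ => / (1 + h)) 1 1 2).
constructor; simpl.
- apply nb_one.
- apply (nb_le B _ (Cmod (-1))); [apply nb_const|rewrite Cmod_R, Rabs_left; lra].
- intros h Hh; apply (nb_le B _ (Cmod (/ (1 + h)))); [apply nb_const|].
  pose proof (one_plus_neq_0 h Hh) as Hn.
  rewrite Cmod_inv by auto; replace 2%R with (/ (1 / 2))%R by field.
  apply Rinv_le_contravar; [lra|].
  pose proof (Cmod_tri_inv 1 (- h)) as Ht; rewrite Cmod_1, Cmod_opp in Ht.
  replace (1 - - h) with (1 + h) in Ht by ring; lra.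
- lra.
- intros h x Hh _; pose proof (one_plus_neq_0 h Hh); field; auto.
Qed.

Section Reg.
Variable q : R.
Hypothesis Hq : (0 < q < 1)%R.
Variables a b c d : C.
Hypotheses (Ha0 : a <> 0) (Hb0 : b <> 0) (Hc0 : c <> 0) (Hd0 : d <> 0).
Hypotheses (Ha : (Cmod a < 1)%R) (Hb : (Cmod b < 1)%R) (Hc : (Cmod c < 1)%R)
  (Hs : (Cmod (q / d) < 1)%R).

(** The parameters s, t and k of the series at the given d; at d tau they are s/tau, t tau
and k tau. *)
Definition spar : C := q / d.
Definition tpar : C := a / spar.
Definition kpar : C := b * c / (a * spar).

Lemma spar_neq_0 : spar <> 0.
Proof.
intros E; apply (q_C_neq_0 q Hq); replace (RtoC q) with (spar * d) by (unfold spar; field; auto).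
rewrite E; ring.
Qed.

Lemma tpar_neq_0 : tpar <> 0.
Proof.
pose proof spar_neq_0; intros E; apply Ha0; replace a with (tpar * spar) by (unfold tpar; field; auto).
rewrite E; ring.
Qed.

(** The two-term formula with d replaced by d tau, as a function of p and zeta. *)
Definition v_at (tau p z : C) : C :=
  vsum q b c p (kpar * tau) (zsym z) a (spar / tau) (tpar * tau) / (theta_fun q (tpar * tau) * v_const q a b c).

Lemma Cmod_prod_lt x y : (Cmod x < 1)%R -> (Cmod y < 1)%R -> (Cmod (x * y) < 1)%R.
Proof.
intros Hx Hy; rewrite Cmod_mult; pose proof (Cmod_ge_0 x); pose proof (Cmod_ge_0 y); nra.
Qed.

Definition spectral (d' nu : C) : C := (qpow q (- nu) + a * b * c * d' * qpow q (nu - 1)) / a.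

Lemma v_formula_Vt (nu z d' tau : C) : tau <> 0 -> d' = d * tau -> (Cmod (spar / tau) < 1)%R ->
  theta_fun q (tpar * tau) <> 0 ->
  v_formula q nu z a b c d' = v_at tau (spectral d' nu) (qpow q z).
Proof.
intros Ht Ed Hst Hth; pose proof spar_neq_0; pose proof (q_C_neq_0 q Hq).
assert (Hd' : d' <> 0) by (rewrite Ed; now apply Cmult_neq_0).
unfold v_at; apply v_formula_vsum; auto; try (apply Cmod_prod_lt; auto; fail).
- rewrite Ed; unfold spar; field; auto.
- unfold tpar; field; auto.
- unfold kpar; field; auto.
Qed.

Lemma aw_op_Vt (tau p z : C) : tau <> 0 -> (Cmod (spar / tau) < 1)%R -> Cmod z = 1%R -> z * z <> 1 ->
  aw_op q a b c (spar / tau) (eigval a p (kpar * tau)) (v_at tau p) z = 0.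
Proof.
intros Ht Hst Hz Hz1; pose proof spar_neq_0 as Hs0.
assert (Hst0 : spar / tau <> 0).
{ intros E; apply Hs0; replace spar with (spar / tau * tau) by (field; auto); rewrite E; ring. }
rewrite (aw_op_ext q a b c (spar / tau) (eigval a p (kpar * tau)) _ (fun w =>
   / (theta_fun q (tpar * tau) * v_const q a b c) *
   vsum q b c p (kpar * tau) (zsym w) a (spar / tau) (tpar * tau)))
  by (intros w; unfold v_at, Cdiv; ring).
rewrite aw_op_scal, aw_op_vsum; auto; try ring.
- unfold kpar; field; auto.
- unfold tpar; field; auto.
Qed.

Definition LaurQ : FunAlg C := Laur q (/ q).
Definition JetQ : FunAlg (C * C) := Jet LaurQ 1 one_01.

Lemma nb_zsym : nb LaurQ zsym (/ q + / q).
Proof. apply (nb_plus LaurQ (fun z => z) (fun z => / z)); [apply nb_id|apply nb_cinv]; try lra.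
left; apply Rinv_0_lt_compat; lra. Qed.

Lemma nb_p p0 : nb JetQ (fun x => p0 + fst x) (Cmod p0 + 1).
Proof. apply nb_plus; [apply nb_const|apply nb_jet_h]. Qed.

Lemma nb_yyJ : nb JetQ (fun x => zsym (snd x)) (/ q + / q).
Proof. apply (nb_jet_lift LaurQ 1 one_01 zsym), nb_zsym. Qed.

(** An extension V of v to all values of p: analytic in p with values in the Laurent
algebra, even in zeta, a solution of the q-difference equation, and equal to v at the p of
nu.  The annulus contains the unit circle, its images under q and 1/q, alpha and alpha/q. *)
Definition regular (V : C -> C -> C) : Prop :=
  (forall p0, exists M, nb JetQ (fun x => V (p0 + fst x) (snd x)) M) /\
  (forall p z : C, z <> 0 -> V p (/ z) = V p z) /\
  (forall p z : C, Cmod z = 1%R -> z * z <> 1 -> aw_op q a b c spar (eigval a p kpar) (V p) z = 0) /\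
  (forall nu z : C, annulus q (/ q) (qpow q z) -> v q nu z a b c d = V (spectral d nu) (qpow q z)).

(** Past the first N factors the argument is smaller than 1 in modulus, where the product
does not vanish. *)
Lemma qi_zero (x : C) : qpoch_inf q x = 0 -> exists j, x * q ^ j = 1.
Proof.
intros H; destruct (classic (exists j, x * q ^ j = 1)) as [E|E]; auto; exfalso.
assert (Hn : forall n, qpoch q x n <> 0).
{ induction n as [|n IH]; simpl; [apply C1_nz|]. apply Cmult_neq_0; auto.
  intros E1; apply E; exists n; replace (x * q ^ n) with (1 - (1 - x * q ^ n)) by ring.
  rewrite E1; ring. }
destruct (proj1 (Cto_eps eventually _ _) (Cto_scal eventually _ x _ (qn_to_0 q Hq))
            (mkposreal 1 Rlt_0_1)) as [N HN].
specialize (HN N (le_n N)); simpl in HN.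
replace (x * q ^ N - x * 0) with (x * q ^ N) in HN by ring.
rewrite (qi_shift q Hq x N) in H.
apply (qi_neq_0 q Hq _ HN).
replace (qpoch_inf q (x * q ^ N))
  with (qpoch q x N * qpoch_inf q (x * q ^ N) / qpoch q x N) by (field; auto).
rewrite H; unfold Cdiv; ring.
Qed.

Lemma q_ad : a * d = q * tpar.
Proof. pose proof (q_C_neq_0 q Hq); unfold tpar, spar; field; auto. Qed.

Lemma RtoC_powerRZ_nat n : RtoC (powerRZ q (Z.of_nat n)) = q ^ n.
Proof. rewrite <- pow_powerRZ; apply RtoC_pow. Qed.

Lemma theta_fun_generic : ~ (exists k : Z, a * d = powerRZ q k) -> theta_fun q tpar <> 0.
Proof.
intros Hn; pose proof (q_C_neq_0 q Hq) as Hq0; pose proof tpar_neq_0 as Ht0.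
apply Cmult_neq_0; intros E; apply qi_zero in E; destruct E as [j E]; apply Hn;
  pose proof (Cpow_nz q j Hq0) as Hj.
(* From t q^j = 1: a d = q t = q^(1 - j). *)
- exists (1 - Z.of_nat j)%Z; rewrite q_ad.
  unfold Zminus; rewrite powerRZ_add, RtoC_mult, powerRZ_neg', RtoC_inv, RtoC_powerRZ_nat by (lra || (apply powerRZ_NOR; lra)).
  rewrite powerRZ_1. replace tpar with (tpar * q ^ j / q ^ j) by (field; auto).
  rewrite E; field; auto.
(* From (q/t) q^j = 1: a d = q t = q^(2 + j). *)
- exists (2 + Z.of_nat j)%Z; rewrite q_ad.
  rewrite powerRZ_add, RtoC_mult, RtoC_powerRZ_nat by lra.
  change 2%Z with (Z.of_nat 2); rewrite RtoC_powerRZ_nat.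
  transitivity (q * tpar * (q / tpar * q ^ j)); [rewrite E; ring|field; auto].
Qed.

Lemma regular_generic : ~ (exists k : Z, a * d = powerRZ q k) -> exists V, regular V.
Proof.
intros Hn; pose proof (theta_fun_generic Hn) as Hth; pose proof spar_neq_0 as Hs0.
assert (Es : spar / 1 = spar) by (field).
assert (Ek : kpar * 1 = kpar) by ring. assert (Et : tpar * 1 = tpar) by ring.
exists (v_at 1); split; [|split; [|split]].
- intros p0.
  destruct (nb_vsum q Hq JetQ b c (fun x => p0 + fst x) (fun _ => kpar) (fun x => zsym (snd x))
    (fun _ => a) (fun _ => spar) (fun _ => tpar) _ _ _ _ _ _ _
    (nb_p p0) (nb_const _ kpar) nb_yyJ (nb_const _ a) (nb_const _ spar) (nb_const _ tpar)
    (nb_const _ (/ tpar))) as [M HM].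
  exists (Cmod (/ (theta_fun q tpar * v_const q a b c)) * M)%R.
  apply (nb_ext JetQ (fun x => / (theta_fun q tpar * v_const q a b c)
     * vsum q b c (p0 + fst x) kpar (zsym (snd x)) a spar tpar)); [|now apply nb_scal].
  intros x _; unfold v_at; rewrite Es, Ek, Et; unfold Cdiv; ring.
- intros p z Hz; unfold v_at; now rewrite zsym_inv.
- intros p z Hz Hz1.
  pose proof (aw_op_Vt 1 p z C1_nz) as H; rewrite Es, Ek in H; apply H; auto.
- intros nu z _; unfold v.
  destruct (excluded_middle_informative _) as [E|E]; [now exfalso|].
  apply v_formula_Vt; [apply C1_nz|ring|rewrite Es; exact Hs|now rewrite Et].
Qed.

Lemma resonant_pow (k : Z) : a * d = powerRZ q k -> exists n, tpar = q ^ n \/ tpar = / q ^ n.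
Proof.
intros H; pose proof (q_C_neq_0 q Hq) as Hq0.
assert (Et : tpar = powerRZ q (k - 1)).
{ replace tpar with (q * tpar / q) by (field; auto); rewrite <- q_ad, H.
  unfold Zminus; rewrite powerRZ_add, RtoC_mult by lra.
  replace (powerRZ q (- (1))) with (/ q)%R by (simpl; rewrite Rmult_1_r; easy).
  rewrite RtoC_inv by lra; easy. }
rewrite Et; destruct (Z.le_gt_cases 0 (k - 1)) as [Hk|Hk].
- exists (Z.to_nat (k - 1)); left; rewrite <- RtoC_powerRZ_nat, Z2Nat.id; auto.
- exists (Z.to_nat (- (k - 1))); right; rewrite <- RtoC_powerRZ_nat, Z2Nat.id by lia.
  rewrite powerRZ_neg', RtoC_inv by (apply powerRZ_NOR; lra).
  replace (powerRZ q (k - 1)) with (powerRZ q (k - 1)) by easy.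
  assert (RtoC (powerRZ q (k - 1)) <> 0)
    by (intros E; apply RtoC_inj in E; revert E; apply powerRZ_NOR; lra).
  field; auto.
Qed.

(** At resonance the numerator of the two-term formula vanishes for all p and all zeta. *)
Lemma vsum_res_0 p k y : (exists n, tpar = q ^ n \/ tpar = / q ^ n) -> vsum q b c p k y a spar tpar = 0.
Proof.
pose proof spar_neq_0 as Hs0; intros [n [E|E]].
- replace a with (spar * q ^ n) at 1 by (rewrite <- E; unfold tpar; field; auto).
  rewrite E; now apply vsum_resonance_pos.
- pose proof (Cpow_nz q n (q_C_neq_0 q Hq)) as Hn.
  replace spar with (a * q ^ n).
  + rewrite E; now apply vsum_resonance_neg.
  + replace (q ^ n) with (/ tpar) by (rewrite E; field; auto). unfold tpar; field; auto.
Qed.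

Lemma theta_fun_step (t : C) : t <> 0 -> t * theta_fun q (q * t) = - theta_fun q t.
Proof.
intros Ht; pose proof (q_C_neq_0 q Hq); unfold theta_fun.
replace (q / (q * t)) with (/ t) by (field; auto).
rewrite (qi_step q Hq t), (qi_step q Hq (/ t)).
replace (/ t * q) with (q / t) by (unfold Cdiv; ring).
replace (t * q) with (q * t) by ring; field; auto.
Qed.

Lemma Cto_1h : Cto (pnbhd 0) (fun h => 1 + h) 1.
Proof.
pose proof (Cto_plus (pnbhd 0) (fun _ => 1) (fun h => h) 1 0 (Cto_const _ 1) (Cto_id 0)) as H.
now rewrite Cplus_0_r in H.
Qed.

Lemma theta_fun_base : exists l : C, l <> 0 /\ Cto (pnbhd 0) (fun h => theta_fun q (1 + h) / h) l.
Proof.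
assert (Nq : qpoch_inf q q <> 0) by (apply qi_neq_0; auto; rewrite Cmod_q by auto; lra).
exists (- (qpoch_inf q (1 * q) * qpoch_inf q (q * / 1))); split.
- replace (q * / 1) with (RtoC q) by field; rewrite Cmult_1_l.
  intros E; apply (Cmult_neq_0 _ _ Nq Nq).
  replace (qpoch_inf q q * qpoch_inf q q) with (- - (qpoch_inf q q * qpoch_inf q q)) by ring.
  rewrite E; ring.
- pose proof Cto_1h as H1.
  apply Cto_ext with (fun h => (-1) * (qpoch_inf q ((1 + h) * q) * qpoch_inf q (q * / (1 + h)))).
  + filt.
  + generalize (pnbhd_small 0 (1 / 2) ltac:(lra)); apply filter_imp; intros h [Hh Hh0].
    unfold theta_fun; rewrite (qi_step q Hq (1 + h)); unfold Cdiv. field; auto.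
  + replace (- (qpoch_inf q (1 * q) * qpoch_inf q (q * / 1)))
      with ((-1) * (qpoch_inf q (1 * q) * qpoch_inf q (q * / 1))) by ring.
    apply Cto_scal; [filt|].
    apply Cto_mult; [filt| |]; apply (qi_cont q Hq); try filt.
    * apply Cto_mult; [filt|exact H1|apply Cto_const, pnbhd_filter].
    * apply Cto_scal; [filt|].
      apply Cto_inv; [filt|apply C1_nz|exact H1].
Qed.

(** The zero is simple at tau = 1 for t = 1, and [theta_fun_step] carries this to every integer
power of q. *)
Lemma theta_fun_res (t : C) : (exists n, t = q ^ n \/ t = / q ^ n) ->
  exists l : C, l <> 0 /\ Cto (pnbhd 0) (fun h => theta_fun q (t * (1 + h)) / h) l.
Proof.
pose proof (q_C_neq_0 q Hq) as Hq0.
intros [n H]; revert t H; induction n as [|n IH]; intros t H.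
- destruct theta_fun_base as [l [Hl H0]]; exists l; split; auto.
  apply Cto_ext with (fun h => theta_fun q (1 + h) / h); [filt|apply filter_forall|exact H0].
  intros h; destruct H as [->| ->]; simpl; f_equal; f_equal; field.
- pose proof (Cpow_nz q n Hq0) as Hn.
  destruct H as [E|E].
  + destruct (IH (q ^ n) (or_introl eq_refl)) as [l [Hl H0]].
    exists (- / q ^ n * / 1 * l); split.
    * replace (- / q ^ n * / 1 * l) with (- l / q ^ n) by (field; auto).
      intros E1; apply Hl; replace l with (- (- l / q ^ n) * q ^ n) by (field; auto).
      rewrite E1; ring.
    * apply Cto_ext with (fun h => - / q ^ n * / (1 + h) * (theta_fun q (q ^ n * (1 + h)) / h)).
      -- filt.
      -- generalize (pnbhd_small 0 (1 / 2) ltac:(lra)); apply filter_imp; intros h [Hh Hh0].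
         replace (h - 0) with h in Hh by ring.
         pose proof (one_plus_neq_0 h ltac:(lra)) as H1.
         assert (Hx : q ^ n * (1 + h) <> 0) by now apply Cmult_neq_0.
         pose proof (theta_fun_step _ Hx) as Hst.
         rewrite E, Cpow_S.
         replace (q * q ^ n * (1 + h)) with (q * (q ^ n * (1 + h))) by ring.
         replace (theta_fun q (q ^ n * (1 + h))) with (- - theta_fun q (q ^ n * (1 + h))) by ring.
         rewrite <- Hst; field; auto.
      -- apply Cto_mult; [filt| |exact H0].
         apply Cto_scal; [filt|].
         apply Cto_inv; [filt|apply C1_nz|apply Cto_1h].
  + destruct (IH (/ q ^ n) (or_intror eq_refl)) as [l [Hl H0]].
    exists (- t * 1 * l).
    assert (Ht : t <> 0).
    { rewrite E; intros E1; apply C1_nz; rewrite <- (Cinv_r (q ^ S n)) by now apply Cpow_nz.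
      rewrite E1; ring. }
    split.
    * replace (- t * 1 * l) with (- (t * l)) by ring.
      intros E1; apply (Cmult_neq_0 _ _ Ht Hl).
      replace (t * l) with (- - (t * l)) by ring; rewrite E1; ring.
    * apply Cto_ext with (fun h => - t * (1 + h) * (theta_fun q (/ q ^ n * (1 + h)) / h)).
      -- filt.
      -- generalize (pnbhd_small 0 (1 / 2) ltac:(lra)); apply filter_imp; intros h [Hh Hh0].
         replace (h - 0) with h in Hh by ring.
         pose proof (one_plus_neq_0 h ltac:(lra)) as H1.
         assert (Hx : t * (1 + h) <> 0) by now apply Cmult_neq_0.
         pose proof (theta_fun_step _ Hx) as Hst.
         replace (/ q ^ n * (1 + h)) with (q * (t * (1 + h)))
           by (rewrite E, Cpow_S; field; auto).
         replace (theta_fun q (t * (1 + h))) with (- - theta_fun q (t * (1 + h))) by ring.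
         rewrite <- Hst; field; auto.
      -- apply Cto_mult; [filt| |exact H0].
         apply Cto_scal; [filt|apply Cto_1h].
Qed.

End Reg.

Lemma Cto_squeeze (f : C -> C) (l : C) K r : (0 < r)%R ->
  (forall h : C, (Cmod h < r)%R -> h <> 0 -> (Cmod (f h - l) <= K * Cmod h)%R) ->
  Cto (pnbhd 0) f l.
Proof.
intros Hr H; apply Cto_eps; [filt|]; intros [eps He]; simpl.
assert (HK : (0 < Rabs K + 1)%R) by (pose proof (Rabs_pos K); lra).
assert (Hd : (0 < Rmin r (eps / (Rabs K + 1)))%R)
  by (apply Rmin_pos; [lra|now apply Rdiv_lt_0_compat]).
generalize (pnbhd_small 0 _ Hd); apply filter_imp; intros h [Hh Hh0].
replace (h - 0) with h in Hh by ring.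
assert (H1 := Rlt_le_trans _ _ _ Hh (Rmin_l _ _)).
assert (H2 := Rlt_le_trans _ _ _ Hh (Rmin_r _ _)).
eapply Rle_lt_trans; [now apply H|].
apply Rle_lt_trans with ((Rabs K + 1) * Cmod h)%R.
- apply Rmult_le_compat_r; [apply Cmod_ge_0|pose proof (Rle_abs K); lra].
- apply Rmult_lt_compat_l with (r := (Rabs K + 1)%R) in H2; auto.
  replace ((Rabs K + 1) * (eps / (Rabs K + 1)))%R with eps in H2 by (field; lra); exact H2.
Qed.

Lemma pnbhd_change (P : C -> Prop) (d : C) : d <> 0 -> pnbhd 0 P ->
  pnbhd d (fun d' => P ((d' - d) / d)).
Proof.
intros Hd He; apply pnbhd_iff in He; destruct He as [[r Hr] He]; simpl in He.
assert (Hd' : (0 < Cmod d)%R) by now apply Cmod_gt_0.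
apply pnbhd_iff; exists (mkposreal (r * Cmod d) (Rmult_lt_0_compat _ _ Hr Hd')); simpl.
intros y Hy Hyd; apply He.
- replace ((y - d) / d - 0) with ((y - d) / d) by ring.
  rewrite Cmod_div by auto; apply Rmult_lt_reg_r with (Cmod d); auto.
  replace (Cmod (y - d) / Cmod d * Cmod d)%R with (Cmod (y - d)) by (field; lra); exact Hy.
- intros E; apply Hyd; replace y with ((y - d) / d * d + d) by (field; auto); rewrite E; ring.
Qed.

Lemma Cto_change (f : C -> C) (l d : C) : d <> 0 -> Cto (pnbhd 0) f l ->
  Cto (pnbhd d) (fun d' => f ((d' - d) / d)) l.
Proof. intros Hd H P HP; exact (pnbhd_change _ d Hd (H P HP)). Qed.

(** * The removable singularity *)

Section Res.
Variable q : R.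
Hypothesis Hq : (0 < q < 1)%R.
Variables a b c d : C.
Hypotheses (Ha0 : a <> 0) (Hb0 : b <> 0) (Hc0 : c <> 0) (Hd0 : d <> 0).
Hypotheses (Ha : (Cmod a < 1)%R) (Hb : (Cmod b < 1)%R) (Hc : (Cmod c < 1)%R)
  (Hs : (Cmod (q / d) < 1)%R).

Notation s0 := (spar q d).
Notation t0 := (tpar q a d).
Notation k0 := (kpar q a b c d).
Notation Vt := (v_at q a b c d).
Notation JQ := (JetQ q).

Hypothesis Hres : exists n, t0 = q ^ n \/ t0 = / q ^ n.

Definition vsum_at (p h z : C) : C :=
  vsum q b c p (k0 * (1 + h)) (zsym z) a (s0 * / (1 + h)) (t0 * (1 + h)).

(** The series [vsum] is expanded in h = tau - 1, with coefficients that are themselves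
expansions in p; its constant coefficient is zero by [vsum_res_0], which leaves the factor h.
*)
Lemma resonant_jet p0 : exists (g : C * C -> C) (r : C -> C * C -> C) Mg Mr,
  nb JQ g Mg /\ (forall h, (Cmod h <= 1 / 2)%R -> nb JQ (r h) Mr) /\
  forall h h2 z, (Cmod h <= 1 / 2)%R -> (Cmod h2 <= 1)%R -> annulus q (/ q) z ->
    vsum_at (p0 + h2) h z = h * (g (h2, z) + h * r h (h2, z)).
Proof.
pose (B := Jet JQ (1 / 2) half_01).
assert (H1h : nb B (fun x => 1 + fst x) (1 + 1)).
{ apply nb_plus; [apply nb_one|apply nb_jet_h]. }
assert (Hp : nb B (fun x => p0 + fst (snd x)) (Cmod p0 + 1))
  by (exact (nb_jet_lift JQ _ half_01 (fun x => p0 + fst x) _ (nb_p q p0))).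
assert (Hy : nb B (fun x => zsym (snd (snd x))) (/ q + / q))
  by (exact (nb_jet_lift JQ _ half_01 (fun x => zsym (snd x)) _ (nb_yyJ q Hq))).
assert (Hi : nb B (fun x => / (1 + fst x)) (1 + 1 + 2)) by apply nb_jet_inv.
assert (Hti : nb B (fun x => / (t0 * (1 + fst x))) (Cmod (/ t0) * (1 + 1 + 2))).
{ apply (nb_ext B (fun x => / t0 * / (1 + fst x))); [|now apply nb_scal].
  intros [h x] [Hh _]; simpl in Hh |- *; pose proof (one_plus_neq_0 h Hh).
  pose proof (tpar_neq_0 q Hq a d Ha0 Hd0). field; auto. }
destruct (nb_vsum q Hq B b c (fun x => p0 + fst (snd x)) (fun x => k0 * (1 + fst x))
  (fun x => zsym (snd (snd x))) (fun _ => a) (fun x => s0 * / (1 + fst x))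
  (fun x => t0 * (1 + fst x)) _ _ _ _ _ _ _ Hp (nb_scal B k0 _ _ H1h) Hy (nb_const B a)
  (nb_scal B s0 _ _ Hi) (nb_scal B t0 _ _ H1h) Hti) as [M [w [J0 J1 J2 JN JE]]].
exists (j1 w), (j2 w), (n1 w), (n2 w); split; [auto|split; [auto|]].
intros h h2 z Hh Hh2 Hz.
assert (Hdom : dom JQ (h2, z)) by (split; auto).
assert (E0 : j0 w (h2, z) = 0).
{ pose proof (JE 0 (h2, z)) as E; rewrite Cmod_0 in E; specialize (E ltac:(lra) Hdom).
  simpl in E.
  replace (k0 * (1 + 0)) with k0 in E by ring; replace (t0 * (1 + 0)) with t0 in E by ring.
  replace (s0 * / (1 + 0)) with s0 in E by (field; rewrite Cplus_0_r; apply C1_nz).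
  rewrite (vsum_res_0 q Hq a b c d Ha0 Hd0) in E by auto.
  replace (j0 w (h2, z))
    with (j0 w (h2, z) + 0 * (j1 w (h2, z) + 0 * j2 w 0 (h2, z))) by ring.
  now rewrite <- E. }
pose proof (JE h (h2, z) Hh Hdom) as E; simpl in E; unfold vsum_at; rewrite E, E0; ring.
Qed.

Lemma Vt_vsum_at h p z : Vt (1 + h) p z = vsum_at p h z / (theta_fun q (t0 * (1 + h)) * v_const q a b c).
Proof. reflexivity. Qed.

Lemma v_const_neq_0 : v_const q a b c <> 0.
Proof.
unfold v_const; repeat apply Cmult_neq_0; apply qi_neq_0; auto;
  try (apply Cmod_prod_lt; auto; fail).
rewrite Cmod_q by auto; lra.
Qed.

Lemma theta_fun_near (l : C) : l <> 0 -> Cto (pnbhd 0) (fun h => theta_fun q (t0 * (1 + h)) / h) l ->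
  pnbhd 0 (fun h => theta_fun q (t0 * (1 + h)) <> 0).
Proof.
intros Hl H.
assert (Hp : (0 < Cmod l)%R) by now apply Cmod_gt_0.
generalize (proj1 (Cto_eps _ _ _) H (mkposreal _ Hp)); simpl.
apply filter_imp; intros h Hh E; rewrite E in Hh.
replace (0 / h - l) with (- l) in Hh by (unfold Cdiv; ring).
rewrite Cmod_opp in Hh; lra.
Qed.

(** The factor h of the numerator cancels the simple zero of the denominator. *)
Lemma Vt_lim p0 (g : C * C -> C) (r : C -> C * C -> C) Mr (l z : C) (u : C -> C) (G : C) :
  l <> 0 -> Cto (pnbhd 0) (fun h => theta_fun q (t0 * (1 + h)) / h) l ->
  (forall h, (Cmod h <= 1 / 2)%R -> nb JQ (r h) Mr) ->
  (forall h h2 z, (Cmod h <= 1 / 2)%R -> (Cmod h2 <= 1)%R -> annulus q (/ q) z ->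
    vsum_at (p0 + h2) h z = h * (g (h2, z) + h * r h (h2, z))) ->
  annulus q (/ q) z ->
  pnbhd 0 (fun h => (Cmod (u h) <= 1)%R) ->
  Cto (pnbhd 0) (fun h => g (u h, z)) G ->
  Cto (pnbhd 0) (fun h => Vt (1 + h) (p0 + u h) z) (G / (l * v_const q a b c)).
Proof.
intros Hl Hth Hr Hg Hz Hu HG.
pose proof v_const_neq_0 as HD.
apply Cto_ext with (fun h => / v_const q a b c * (/ (theta_fun q (t0 * (1 + h)) / h)
  * (g (u h, z) + (if Rle_dec (Cmod (u h)) 1 then
                    (if Rle_dec (Cmod h) (1 / 2) then h * r h (u h, z) else 0) else 0)))).
- filt.
- generalize (filter_and (F := pnbhd 0) _ _ (filter_and (F := pnbhd 0) _ _ (pnbhd_small 0 (1 / 2) ltac:(lra)) Hu)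
               (theta_fun_near l Hl Hth)).
  apply filter_imp; intros h [[[Hh Hh0] Hu1] Hn].
  replace (h - 0) with h in Hh by ring.
  destruct (Rle_dec (Cmod (u h)) 1) as [_|n]; [|contradiction].
  destruct (Rle_dec (Cmod h) (1 / 2)) as [_|n]; [|lra].
  rewrite Vt_vsum_at, Hg by (auto; lra).
  field; auto.
- replace (G / (l * v_const q a b c)) with (/ v_const q a b c * (/ l * (G + 0))) by (field; auto).
  apply Cto_scal; [filt|].
  apply Cto_mult; [filt|apply Cto_inv; auto; filt|].
  apply Cto_plus; [filt|exact HG|].
  apply (Cto_squeeze _ _ Mr (1 / 2)); [lra|].
  intros h Hh _.
  assert (HMr : (0 <= Mr)%R) by (apply (nb_pos JQ (r h)); apply Hr; lra).
  pose proof (Cmod_ge_0 h).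
  match goal with |- Rle (Cmod (Cminus ?x _)) _ => replace (x - 0) with x by ring end.
  destruct (Rle_dec (Cmod (u h)) 1) as [Hu1|_]; [|rewrite Cmod_0; nra].
  destruct (Rle_dec (Cmod h) (1 / 2)) as [Hh1|_]; [|rewrite Cmod_0; nra].
  rewrite Cmod_mult, Rmult_comm; apply Rmult_le_compat_r; auto.
  apply (nb_bound JQ (r h) Mr (Hr h Hh1)); split; auto.
Qed.

Definition v_res (p z : C) : C := Clim (pnbhd 0) (fun h => Vt (1 + h) p z).

(** The first limit identifies the extension at p0 + h2; the second, along p = p0 + h eta,
is needed because the p of a fixed nu moves with d. *)
Lemma v_res_facts p0 : exists (g : C * C -> C) Mg l,
  nb JQ g Mg /\
  (forall h2 z, (Cmod h2 <= 1)%R -> annulus q (/ q) z ->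
    Cto (pnbhd 0) (fun h => Vt (1 + h) (p0 + h2) z) (g (h2, z) / (l * v_const q a b c))) /\
  (forall eta z, annulus q (/ q) z ->
    Cto (pnbhd 0) (fun h => Vt (1 + h) (p0 + h * eta) z) (g (RtoC 0, z) / (l * v_const q a b c))).
Proof.
destruct (resonant_jet p0) as [g [r [Mg [Mr [Hg [Hr HW]]]]]].
destruct (theta_fun_res q Hq t0 Hres) as [l [Hl Hth]].
exists g, Mg, l; split; [auto|split].
- intros h2 z Hh2 Hz.
  apply (Vt_lim p0 g r Mr l z (fun _ => h2)); auto.
  + now apply filter_forall.
  + apply Cto_const, pnbhd_filter.
- intros eta z Hz.
  assert (He : (0 < / (Cmod eta + 1))%R)
    by (apply Rinv_0_lt_compat; pose proof (Cmod_ge_0 eta); lra).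
  assert (Hsm : forall h, (Cmod h < / (Cmod eta + 1))%R -> (Cmod (h * eta) <= 1)%R).
  { intros h Hh; rewrite Cmod_mult; pose proof (Cmod_ge_0 eta); pose proof (Cmod_ge_0 h).
    apply Rle_trans with (/ (Cmod eta + 1) * (Cmod eta + 1))%R;
      [apply Rmult_le_compat; lra|rewrite Rinv_l; lra]. }
  apply (Vt_lim p0 g r Mr l z (fun h => h * eta)); auto.
  + generalize (pnbhd_small 0 _ He); apply filter_imp; intros h [Hh _].
    replace (h - 0) with h in Hh by ring; auto.
  + apply (Cto_squeeze _ _ (Mg * Cmod eta) (/ (Cmod eta + 1))); auto.
    intros h Hh _; rewrite Rmult_assoc, (Rmult_comm (Cmod eta)), <- Cmod_mult.
    apply (jet_cont (LaurQ q) 1 one_01); auto.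
Qed.

Lemma v_res_lim p z : annulus q (/ q) z -> Cto (pnbhd 0) (fun h => Vt (1 + h) p z) (v_res p z).
Proof.
intros Hz; destruct (v_res_facts p) as [g [Mg [l [_ [H _]]]]].
specialize (H 0 z ltac:(rewrite Cmod_0; lra) Hz); rewrite Cplus_0_r in H.
unfold v_res; now rewrite (Cto_Clim _ _ _ H).
Qed.

Lemma annulus_1 z : Cmod z = 1%R -> annulus q (/ q) z.
Proof.
intros Hz; unfold annulus; rewrite Hz; split; [lra|].
rewrite <- Rinv_1; apply Rinv_le_contravar; lra.
Qed.

Lemma annulus_q z : Cmod z = 1%R -> annulus q (/ q) (q * z).
Proof.
intros Hz; unfold annulus; rewrite Cmod_mult, Hz, Cmod_q, Rmult_1_r by auto; split; [lra|].
assert (1 < / q)%R by (rewrite <- Rinv_1; apply Rinv_lt_contravar; lra); lra.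
Qed.

Lemma s_near : pnbhd 0 (fun h => (Cmod (s0 / (1 + h)) < 1)%R).
Proof.
assert (H : Cto (pnbhd 0) (fun h => s0 * / (1 + h)) (s0 * / 1)).
{ apply Cto_scal; [filt|].
  apply Cto_inv; [filt|apply C1_nz|apply Cto_1h]. }
assert (He : (0 < 1 - Cmod s0)%R) by (unfold spar; lra).
generalize (proj1 (Cto_eps _ _ _) H (mkposreal _ He)); simpl.
apply filter_imp; intros h Hh.
replace (s0 * / 1) with s0 in Hh by field.
pose proof (Cmod_tri_inv (s0 * / (1 + h)) s0); unfold Cdiv; lra.
Qed.

Lemma shift_coef_lim x : Cto (pnbhd 0) (fun h => shift_coef q a b c (s0 / (1 + h)) x) (shift_coef q a b c s0 x).
Proof.
pose proof (spar_neq_0 q Hq d Hd0) as Hs0.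
set (I := / ((1 - x * x) * (1 - x * x * q))).
set (K := - (q * x / s0) * ((1 - a * x) * (1 - b * x) * (1 - c * x)) * I).
apply Cto_ext with (fun h => K * ((1 + h) * (1 - s0 * x * / (1 + h)))).
- filt.
- generalize (pnbhd_small 0 (1 / 2) ltac:(lra)); apply filter_imp; intros h [Hh Hh0].
  replace (h - 0) with h in Hh by ring; pose proof (one_plus_neq_0 h ltac:(lra)).
  unfold K, shift_coef, Cdiv at 2; fold I; field; auto.
- replace (shift_coef q a b c s0 x) with (K * (1 * (1 - s0 * x * / 1)))
    by (unfold K, shift_coef, Cdiv at 2; fold I; field; auto).
  apply Cto_scal; [filt|].
  apply Cto_mult; [filt|apply Cto_1h|].
  apply Cto_minus; [filt|apply Cto_const, pnbhd_filter|].
  apply Cto_scal; [filt|].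
  apply Cto_inv; [filt|apply C1_nz|apply Cto_1h].
Qed.

Lemma diag_coef_lim x : Cto (pnbhd 0) (fun h => diag_coef q a b c (s0 / (1 + h)) x) (diag_coef q a b c s0 x).
Proof.
pose proof (spar_neq_0 q Hq d Hd0) as Hs0.
set (I := / ((1 - x * x) * (1 - x * x * q))).
set (K := ((1 - a * x) * (1 - b * x) * (1 - c * x)) * I).
apply Cto_ext with (fun h => K * (1 - q * x / s0 * (1 + h))).
- filt.
- generalize (pnbhd_small 0 (1 / 2) ltac:(lra)); apply filter_imp; intros h [Hh Hh0].
  replace (h - 0) with h in Hh by ring; pose proof (one_plus_neq_0 h ltac:(lra)).
  unfold K, diag_coef, Cdiv at 2; fold I; field; auto.
- replace (diag_coef q a b c s0 x) with (K * (1 - q * x / s0 * 1))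
    by (unfold K, diag_coef, Cdiv at 2; fold I; field; auto).
  apply Cto_scal; [filt|].
  apply Cto_minus; [filt|apply Cto_const, pnbhd_filter|].
  apply Cto_scal; [filt|apply Cto_1h].
Qed.

Lemma aw_op_v_res p z : Cmod z = 1%R -> z * z <> 1 ->
  aw_op q a b c s0 (eigval a p k0) (v_res p) z = 0.
Proof.
intros Hz Hz1.
assert (HL : Cto (pnbhd 0) (fun h => eigval a p (k0 * (1 + h))) (eigval a p k0)).
{ apply Cto_ext with (fun h => - (1 - a * p) - (a * a * k0) * (1 + h)).
  - filt.
  - apply filter_forall; intros h; unfold eigval; ring.
  - replace (eigval a p k0) with (- (1 - a * p) - (a * a * k0) * 1) by (unfold eigval; ring).
    apply Cto_minus; [filt|apply Cto_const, pnbhd_filter|].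
    apply Cto_scal; [filt|apply Cto_1h]. }
apply (Cto_unique (pnbhd 0)
  (fun h => aw_op q a b c (s0 / (1 + h)) (eigval a p (k0 * (1 + h))) (Vt (1 + h) p) z)).
- pose proof (pnbhd_filter 0) as HF; destruct HF as [_ HF].
  unfold aw_op; exact (Cto_minus _ _ _ _ _
    (Cto_plus _ _ _ _ _
      (Cto_mult _ _ _ _ _ (shift_coef_lim z) (v_res_lim p (q * z) (annulus_q z Hz)))
      (Cto_mult _ _ _ _ _ (shift_coef_lim (/ z))
         (v_res_lim p (q * / z) (annulus_q (/ z) (unit_inv z Hz)))))
    (Cto_mult _ _ _ _ _
      (Cto_plus _ _ _ _ _ (Cto_plus _ _ _ _ _ HL (diag_coef_lim z)) (diag_coef_lim (/ z)))
      (v_res_lim p z (annulus_1 z Hz)))).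
- apply Cto_ext with (fun _ => 0); [filt| |apply Cto_const, pnbhd_filter].
  generalize (filter_and (F := pnbhd 0) _ _ s_near (pnbhd_small 0 (1 / 2) ltac:(lra))).
  apply filter_imp; intros h [Hsh [Hh Hh0]].
  replace (h - 0) with h in Hh by ring; pose proof (one_plus_neq_0 h ltac:(lra)).
  symmetry; now apply aw_op_Vt.
Qed.

(** The properties of the two-term formula at d tau pass to the limit tau -> 1. *)
Lemma regular_resonant : (exists k : Z, a * d = powerRZ q k) -> exists V, regular q a b c d V.
Proof.
intros Hk; exists v_res; split; [|split; [|split]].
- intros p0; destruct (v_res_facts p0) as [g [Mg [l [Hg [H _]]]]].
  exists (Cmod (/ (l * v_const q a b c)) * Mg)%R.
  apply (nb_ext JQ (fun x => / (l * v_const q a b c) * g x)); [|now apply nb_scal].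
  intros [h2 z] [Hh2 Hz]; simpl in Hh2, Hz |- *.
  rewrite (Cto_unique _ _ _ _ (v_res_lim (p0 + h2) z Hz) (H h2 z Hh2 Hz)).
  unfold Cdiv; ring.
- intros p z Hz; unfold v_res, v_at; now rewrite zsym_inv.
- intros p z Hz Hz1; now apply aw_op_v_res.
- intros nu z Hz; unfold v.
  destruct (excluded_middle_informative _) as [E|E]; [clear E|contradiction].
  apply (Cto_Clim (pnbhd d)).
  set (eta := b * c * d * qpow q (nu - 1)).
  destruct (v_res_facts (spectral q a b c d nu)) as [g [Mg [l [Hg [H H']]]]].
  specialize (H 0 (qpow q z) ltac:(rewrite Cmod_0; lra) Hz); rewrite Cplus_0_r in H.
  rewrite (Cto_unique _ _ _ _ (v_res_lim _ _ Hz) H).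
  destruct (theta_fun_res q Hq t0 Hres) as [l' [Hl' Hth]].
  apply Cto_ext with (fun d' => Vt (1 + (d' - d) / d)
     (spectral q a b c d nu + (d' - d) / d * eta) (qpow q z)).
  + filt.
  + assert (Hnear : pnbhd 0 (fun h => 1 + h <> 0 /\ (Cmod (s0 / (1 + h)) < 1)%R
                               /\ theta_fun q (t0 * (1 + h)) <> 0)).
    { generalize (filter_and (F := pnbhd 0) _ _ (filter_and (F := pnbhd 0) _ _ s_near (pnbhd_small 0 (1 / 2) ltac:(lra)))
                    (theta_fun_near l' Hl' Hth)).
      apply filter_imp; intros h [[Hsh [Hh Hh0]] Hn].
      replace (h - 0) with h in Hh by ring; split; auto; apply one_plus_neq_0; lra. }
    generalize (pnbhd_change _ d Hd0 Hnear); apply filter_imp; intros y [N1 [N2 N3]].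
    symmetry; transitivity (Vt (1 + (y - d) / d) (spectral q a b c y nu) (qpow q z)).
    * apply v_formula_Vt; auto; field; auto.
    * f_equal; unfold spectral, eta; field; auto.
  + apply (Cto_change (fun h => Vt (1 + h) (spectral q a b c d nu + h * eta) (qpow q z))); auto.
Qed.

End Res.

Lemma regular_exists (q : R) (a b c d : C) : (0 < q < 1)%R ->
  a <> 0 -> b <> 0 -> c <> 0 -> d <> 0 ->
  (Cmod a < 1)%R -> (Cmod b < 1)%R -> (Cmod c < 1)%R -> (Cmod (q / d) < 1)%R ->
  exists V, regular q a b c d V.
Proof.
intros Hq Ha0 Hb0 Hc0 Hd0 Ha Hb Hc Hs.
destruct (classic (exists k : Z, a * d = powerRZ q k)) as [E|E].
- apply regular_resonant; auto.
  destruct E as [k E]; exact (resonant_pow q Hq a d Hd0 k E).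
- now apply regular_generic.
Qed.

(** * The two integrals *)

(** A quadratic bound on the remainder, which [Jet] provides, gives the derivative. *)
Lemma is_derive_quadratic (G : C -> C) (x D : C) (r M : R) : (0 < r)%R ->
  (forall k : C, (Cmod k <= r)%R -> (Cmod (G (x + k)%C - G x - k * D) <= M * (Cmod k * Cmod k))%R) ->
  is_derive (K := C_AbsRing) (V := C_NormedModule) G x D.
Proof.
intros Hr H; split; [apply is_linear_scal_l|].
intros x0 Hx0; apply (is_filter_lim_locally_unique (V := AbsRing_NormedModule C_AbsRing)) in Hx0.
rewrite <- Hx0.
intros [eps He]; simpl.
assert (HK : (0 < Rabs M + 1)%R) by (pose proof (Rabs_pos M); lra).
assert (Hd : (0 < Rmin r (eps / (Rabs M + 1)))%R)
  by (apply Rmin_pos; [lra|now apply Rdiv_lt_0_compat]).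
assert (Hall : forall y : C, (Cmod (y - x) < Rmin r (eps / (Rabs M + 1)))%R ->
  (Cmod (G y - G x - (y - x) * D) <= eps * Cmod (y - x))%R).
{ intros y Hy.
  assert (H1 := Rlt_le_trans _ _ _ Hy (Rmin_l _ _)).
  assert (H2 := Rlt_le_trans _ _ _ Hy (Rmin_r _ _)).
  specialize (H (y - x) ltac:(lra)); replace (x + (y - x)) with y in H by ring.
  eapply Rle_trans; [exact H|].
  rewrite <- Rmult_assoc; apply Rmult_le_compat_r; [apply Cmod_ge_0|].
  apply Rle_trans with ((Rabs M + 1) * Cmod (y - x))%R.
  - apply Rmult_le_compat_r; [apply Cmod_ge_0|pose proof (Rle_abs M); lra].
  - apply Rmult_lt_compat_l with (r := (Rabs M + 1)%R) in H2; auto.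
    replace ((Rabs M + 1) * (eps / (Rabs M + 1)))%R with eps in H2 by (field; lra); lra. }
generalize (locally_ball_norm (K := C_AbsRing) (V := AbsRing_NormedModule C_AbsRing) x
              (mkposreal _ Hd)).
apply filter_imp; intros y Hy; exact (Hall y Hy).
Qed.

Section Final.
Variable q : R.
Hypothesis Hq : (0 < q < 1)%R.
Variables a b c d alpha0 : C.
Hypotheses (Ha0 : a <> 0) (Hb0 : b <> 0) (Hc0 : c <> 0) (Hd0 : d <> 0).
Hypotheses (Ha : (Cmod a < 1)%R) (Hb : (Cmod b < 1)%R) (Hc : (Cmod c < 1)%R)
  (Hs : (Cmod (q / d) < 1)%R) (Hal : (0 < Re alpha0 < 1 / 2)%R).

Let s := q / d.
Let al := qpow q alpha0.

Lemma s_lt_1 : (Cmod s < 1)%R. Proof. exact Hs. Qed.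
Lemma s_neq_0 : s <> 0. Proof. exact (spar_neq_0 q Hq d Hd0). Qed.

Lemma ln_q_neg : (ln q < 0)%R.
Proof. rewrite <- ln_1; apply ln_increasing; lra. Qed.

Lemma al_lt_1 : (Cmod al < 1)%R.
Proof.
unfold al; rewrite Cmod_qpow, <- exp_0; apply exp_increasing; pose proof ln_q_neg; nra.
Qed.

Lemma al_sq_gt : (q < Cmod al * Cmod al)%R.
Proof.
unfold al; rewrite Cmod_qpow, <- exp_plus; rewrite <- (exp_ln q) at 1 by lra.
apply exp_increasing; pose proof ln_q_neg; nra.
Qed.

Lemma al_q : (q < Cmod al)%R.
Proof. pose proof al_sq_gt; pose proof al_lt_1; pose proof (Cmod_ge_0 al); nra. Qed.

Lemma al_nz : al <> 0. Proof. apply qpow_neq_0; auto. Qed.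

Lemma al_annulus : annulus q (/ q) al.
Proof.
pose proof al_q; pose proof al_lt_1; split; [lra|].
assert (1 < / q)%R by (rewrite <- Rinv_1; apply Rinv_lt_contravar; lra); lra.
Qed.

Lemma al_div_q_annulus : annulus q (/ q) (al / q).
Proof.
pose proof al_q; pose proof al_lt_1; unfold annulus.
rewrite Cmod_div, Cmod_q by (auto; apply q_C_neq_0; auto); split.
- apply Rle_trans with (Cmod al / 1)%R; [unfold Rdiv; rewrite Rinv_1; lra|].
  apply Rmult_le_compat_l; [lra|apply Rinv_le_contravar; lra].
- unfold Rdiv; assert (0 < / q)%R by (apply Rinv_0_lt_compat; lra); nra.
Qed.

Lemma weight_wfun theta : weight q a b c d al theta = wfun q a b c s al (expi theta).
Proof.
unfold weight, wfun, wfac, qpochs_inf; simpl fold_right.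
pose proof al_nz as Hal0.
replace (expi (2 * theta)) with (expi theta * expi theta)
  by (rewrite <- expi_plus; f_equal; ring).
replace (expi (- (2 * theta))) with (/ expi theta * / expi theta)
  by (rewrite <- expi_neg, <- expi_plus; f_equal; ring).
rewrite expi_neg.
replace (q * expi theta / d) with (s * expi theta) by (unfold s, Cdiv; ring).
replace (q * / expi theta / d) with (s * / expi theta) by (unfold s, Cdiv; ring).
replace (q * expi theta / al) with (q / al * expi theta) by (unfold Cdiv; ring).
replace (q * / expi theta / al) with (q / al * / expi theta) by (unfold Cdiv; ring).
unfold Cdiv; f_equal; [ring|f_equal; ring].
Qed.

Lemma nb_wfun : exists M, nb (Laur 1 1) (wfun q a b c s al) M.
Proof.
assert (Hz : nb (Laur 1 1) (fun z => z) 1) by (apply nb_id; lra).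
assert (Hi : nb (Laur 1 1) (fun z => / z) 1)
  by (apply (nb_le _ _ (/ 1)); [apply nb_cinv; lra|rewrite Rinv_1; lra]).
assert (Hn : forall e, (Cmod e < 1)%R -> exists M, nb (Laur 1 1) (fun z => / wfac q e z) M).
{ intros e He; eexists.
  apply (nb_ext _ (fun z => / qpoch_inf q (e * z) * / qpoch_inf q (e * / z))).
  - intros z [Z1 Z2]; assert (Hz1 : Cmod z = 1%R) by lra.
    unfold wfac; field; split; apply qi_neq_0; auto; apply circ_e; auto; now apply unit_inv.
  - apply nb_mult.
    + apply (nb_qi_inv q Hq _ (fun z => e * z) (Cmod e)); auto.
      apply (nb_le _ _ (Cmod e * 1)); [now apply nb_scal|lra].
    + apply (nb_qi_inv q Hq _ (fun z => e * / z) (Cmod e)); auto.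
      apply (nb_le _ _ (Cmod e * 1)); [now apply nb_scal|lra]. }
assert (Hwn : forall e z, (Cmod e < 1)%R -> Cmod z = 1%R -> wfac q e z <> 0).
{ intros e z He Hz1; apply Cmult_neq_0; apply qi_neq_0; auto; apply circ_e; auto; now apply unit_inv. }
pose proof (al'_lt_1 q Hq al al_sq_gt al_lt_1) as Hal'.
destruct (Hn a Ha) as [Ma Na]; destruct (Hn b Hb) as [Mb Nb]; destruct (Hn c Hc) as [Mc Nc'].
destruct (Hn s s_lt_1) as [Ms Ns]; destruct (Hn al al_lt_1) as [Mal Nal].
destruct (Hn (q / al) Hal') as [Mal' Nal'].
eexists.
apply (nb_ext _ (fun z => (qpoch_inf q (z * z) * qpoch_inf q (/ z * / z)) *
  (/ wfac q a z * / wfac q b z * / wfac q c z * / wfac q s z * / wfac q al z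
   * / wfac q (q / al) z))).
- intros z [Z1 Z2]; assert (Hz1 : Cmod z = 1%R) by lra.
  pose proof (Hwn a z Ha Hz1); pose proof (Hwn b z Hb Hz1); pose proof (Hwn c z Hc Hz1).
  pose proof (Hwn s z s_lt_1 Hz1); pose proof (Hwn al z al_lt_1 Hz1); pose proof (Hwn (q / al) z Hal' Hz1).
  unfold wfun; pose proof al_nz.
  generalize dependent (wfac q (q / al) z); intros.
  field; auto 20.
- apply nb_mult; [apply nb_mult|].
  + apply (nb_qi q Hq _ (fun z => z * z)); exact (nb_mult _ (fun z => z) (fun z => z) _ _ Hz Hz).
  + apply (nb_qi q Hq _ (fun z => / z * / z)); exact (nb_mult _ (fun z => / z) (fun z => / z) _ _ Hi Hi).
  + repeat (apply nb_mult; [|eassumption]); eassumption.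
Qed.

Variable V : C -> C -> C.
Hypothesis HV : regular q a b c d V.

Notation pn := (spectral q a b c d).
Let k0 := kpar q a b c d.
Let L p := eigval a p k0.

Lemma V_Laur p : exists M, nb (Laur q (/ q)) (V p) M.
Proof.
destruct HV as [H _]; destruct (H p) as [M [w [J0 J1 J2 JN JE]]]; exists (n0 w).
apply (nb_ext _ (j0 w)); [|exact J0].
intros z Hz; pose proof (JE 0 z ltac:(rewrite Cmod_0; lra) Hz) as E; simpl in E.
rewrite Cplus_0_r in E; rewrite E; ring.
Qed.

Lemma V_eq p z : Cmod z = 1%R -> z * z <> 1 ->
  shift_coef q a b c s z * V p (q * z) + shift_coef q a b c s (/ z) * V p (q * / z)
  = (L p + (diag_coef q a b c s z + diag_coef q a b c s (/ z))) * V p z.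
Proof.
intros Hz Hz1; destruct HV as [_ [_ [H _]]]; specialize (H p z Hz Hz1).
unfold aw_op in H; fold k0 in H; fold (L p) in H; change (spar q d) with s in H.
match type of H with ?x - ?y = _ => replace x with (x - y + y) by ring; rewrite H end; ring.
Qed.

Definition denom_prod : C := qpochs_inf q [RtoC q; RtoC q; al * a; q * a / al; al * b; q * b / al;
   al * c; q * c / al; q * al / d; q ^ 2 / (al * d)].

Lemma e_bounds e : (Cmod e < 1)%R ->
  qpoch_inf q (e * / al * q) <> 0 /\ qpoch_inf q (e * / / al) <> 0.
Proof.
intros He; pose proof al_q; pose proof al_lt_1; pose proof al_nz.
replace (/ / al) with al by (field; auto).
split; apply qi_neq_0; auto; rewrite ?Cmod_mult, ?Cmod_inv, ?Cmod_q by auto.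
- pose proof (Cmod_ge_0 e).
  assert (/ Cmod al * q < 1)%R by (apply Rmult_lt_reg_l with (Cmod al); [lra|field_simplify; lra]).
  assert (0 <= / Cmod al * q)%R
    by (apply Rmult_le_pos; [left; apply Rinv_0_lt_compat|]; lra).
  rewrite Rmult_assoc; nra.
- pose proof (Cmod_ge_0 e); nra.
Qed.

Lemma denom_prod_neq_0 : denom_prod <> 0.
Proof.
pose proof al_nz as Hn.
assert (N : qpoch_inf q q <> 0) by (apply qi_neq_0; auto; rewrite Cmod_q; auto; lra).
assert (H : forall e, (Cmod e < 1)%R -> qpoch_inf q (al * e) <> 0 /\ qpoch_inf q (q * e / al) <> 0).
{ intros e He; destruct (e_bounds e He) as [E1 E2].
  replace (al * e) with (e * / / al) by (field; auto).
  replace (q * e / al) with (e * / al * q) by (field; auto); auto. }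
destruct (H a Ha); destruct (H b Hb); destruct (H c Hc); destruct (H s s_lt_1).
unfold denom_prod, qpochs_inf; simpl fold_right.
replace (q * al / d) with (al * s) by (unfold s; field; auto).
replace (q * (q * 1) / (al * d)) with (q * s / al) by (unfold s; field; auto).
repeat apply Cmult_neq_0; auto using C1_nz.
Qed.

(** At z = 1/alpha the factors (alpha^2, q^2/alpha^2; q)_oo cancel. *)
Lemma flux_coef_al : flux_coef q a b c s al (/ al) = - d / (al * denom_prod).
Proof.
pose proof al_nz as Hn; pose proof (q_C_neq_0 q Hq) as Hq0.
pose proof al_sq_gt; pose proof al_lt_1; pose proof al_q.
assert (N1 : qpoch_inf q q <> 0) by (apply qi_neq_0; auto; rewrite Cmod_q; auto; lra).
destruct (e_bounds a Ha); destruct (e_bounds b Hb); destruct (e_bounds c Hc); destruct (e_bounds s s_lt_1).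
assert (N2 : qpoch_inf q (al * al) <> 0)
  by (apply qi_neq_0; auto; rewrite Cmod_mult; nra).
assert (N3 : qpoch_inf q (/ al * / al * q * q) <> 0).
{ replace (/ al * / al * q * q) with ((q / al) * (q / al)) by (field; auto).
  pose proof (al'_lt_1 q Hq al al_sq_gt al_lt_1).
  apply qi_neq_0; auto; rewrite Cmod_mult.
  pose proof (Cmod_ge_0 (q / al)); nra. }
unfold flux_coef, nfac, denom_prod, qpochs_inf; simpl fold_right.
replace (al * / al * q) with (RtoC q) by (field; auto).
replace (q / al * / / al) with (RtoC q) by (field; auto).
replace (q / al * / al * q) with (/ al * / al * q * q) by (field; auto).
replace (/ / al * / / al) with (al * al) by (field; auto).
replace (al * / / al) with (al * al) by (field; auto).
replace (al * a) with (a * / / al) by (field; auto).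
replace (al * b) with (b * / / al) by (field; auto).
replace (al * c) with (c * / / al) by (field; auto).
replace (q * al / d) with (s * / / al) by (unfold s; field; auto).
replace (q * a / al) with (a * / al * q) by (field; auto).
replace (q * b / al) with (b * / al * q) by (field; auto).
replace (q * c / al) with (c * / al * q) by (field; auto).
replace (q * (q * 1) / (al * d)) with (s * / al * q) by (unfold s; field; auto).
replace (- (q / s)) with (- d) by (unfold s; field; auto).
repeat match goal with H : qpoch_inf q ?x <> 0 |- _ => revert H; generalize (qpoch_inf q x) end.
intros; field; auto 20.
Qed.

Lemma den_nz : 1 - q / (al * al) <> 0.
Proof.
apply one_minus_neq_0; pose proof al_sq_gt.
rewrite Cmod_div by (apply Cmult_neq_0; apply al_nz).
rewrite Cmod_q, Cmod_mult by auto; apply Rmult_lt_reg_r with (Cmod al * Cmod al)%R; [lra|].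
unfold Rdiv; rewrite Rmult_assoc, Rinv_l by lra; lra.
Qed.

(** [casorati_integral] for the extension of v, with q/alpha replaced by alpha/q since V is even. *)
Lemma V_star p1 p2 :
  cRInt (fun t => (L p1 - L p2) * (V p1 (expi t) * V p2 (expi t) * wfun q a b c s al (expi t))) 0 PI
    (2 * PI * (- d / (al * denom_prod) * (V p1 (al / q) * V p2 al - V p1 al * V p2 (al / q))
               / (1 - q / (al * al)))).
Proof.
destruct (V_Laur p1) as [M1 N1]; destruct (V_Laur p2) as [M2 N2].
pose proof (casorati_integral q Hq a b c s al Ha Hb Hc s_lt_1 s_neq_0 al_sq_gt al_lt_1 (V p1) (V p2) M1 M2
  (L p1) (L p2) (fun z => diag_coef q a b c s z + diag_coef q a b c s (/ z)) N1 N2) as H.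
rewrite flux_coef_al in H; unfold casorati in H.
destruct HV as [_ [Hev _]]; pose proof al_nz as Hn; pose proof (q_C_neq_0 q Hq) as Hq0.
replace (q * / al) with (/ (al / q)) in H by (field; auto).
assert (Hnq : al / q <> 0)
  by (intros E; apply Hn; replace al with (al / q * q) by (field; auto); rewrite E; ring).
rewrite !Hev in H by auto.
apply H; auto; intros z; apply V_eq.
Qed.

Lemma eigval_pn nu : L (pn nu) = - ((1 - qpow q (- nu)) * (1 - a * b * c * d * qpow q (nu - 1))).
Proof.
pose proof (qpow_neq_0 q nu); pose proof (q_C_neq_0 q Hq).
unfold L, eigval, spectral, k0, kpar, spar.
rewrite qpow_neg, qpow_minus_1 by auto; field; auto.
Qed.

Definition lam_const : C := 4 * Rpower q (3 / 2) / (1 - q) ^ 2.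

Lemma lambda_L nu : lambda q a b c d nu = - lam_const * L (pn nu).
Proof. rewrite eigval_pn; unfold lambda, lam_const; ring. Qed.

Lemma lam_const_neq_0 : lam_const <> 0.
Proof.
assert (1 - RtoC q <> 0)
  by (rewrite <- RtoC_minus; intros E; apply RtoC_inj in E; lra).
assert (RtoC (Rpower q (3 / 2)) <> 0)
  by (intros E; apply RtoC_inj in E; unfold Rpower in E; pose proof (exp_pos (3 / 2 * ln q)); lra).
assert (RtoC 4 <> 0) by (intros E; apply RtoC_inj in E; lra).
unfold lam_const, Cdiv; repeat apply Cmult_neq_0; auto.
intros E; apply C1_nz; rewrite <- (Cinv_r ((1 - q) ^ 2)) by now apply Cpow_nz.
rewrite E; ring.
Qed.

Lemma v_theta nu t : v q nu (z_of_theta q t) a b c d = V (pn nu) (expi t).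
Proof.
destruct HV as [_ [_ [_ H]]]; rewrite H, qpow_z_of_theta; auto.
apply annulus_1; auto; rewrite qpow_z_of_theta by auto; apply Cmod_expi.
Qed.

Lemma v_al nu : v q nu alpha0 a b c d = V (pn nu) al.
Proof. destruct HV as [_ [_ [_ H]]]; apply H, al_annulus. Qed.

Lemma v_al_1 nu : v q nu (alpha0 - 1) a b c d = V (pn nu) (al / q).
Proof.
destruct HV as [_ [_ [_ H]]]; unfold al; rewrite <- qpow_minus_1 by auto; apply H.
rewrite qpow_minus_1 by auto; apply al_div_q_annulus.
Qed.

Theorem orthogonality mu nu : v q mu alpha0 a b c d = 0 -> v q nu alpha0 a b c d = 0 ->
  lambda q a b c d mu <> lambda q a b c d nu ->
  cRInt (fun theta => v q mu (z_of_theta q theta) a b c d * v q nu (z_of_theta q theta) a b c d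
                     * weight q a b c d al theta) 0 PI (RtoC 0).
Proof.
intros Hmu Hnu Hne; rewrite v_al in Hmu, Hnu.
assert (HL : L (pn mu) - L (pn nu) <> 0).
{ intros E; apply Hne; rewrite !lambda_L; f_equal.
  replace (L (pn mu)) with (L (pn mu) - L (pn nu) + L (pn nu)) by ring; rewrite E; ring. }
pose proof (V_star (pn mu) (pn nu)) as H; rewrite Hmu, Hnu in H.
apply (cRInt_scal (/ (L (pn mu) - L (pn nu)))) in H.
replace (RtoC 0) with (/ (L (pn mu) - L (pn nu)) *
  (2 * PI * (- d / (al * denom_prod) * (V (pn mu) (al / q) * 0 - 0 * V (pn nu) (al / q))
               / (1 - q / (al * al))))) by (unfold Cdiv; ring).
refine (cRInt_ext _ _ _ _ _ _ H); intros t; simpl.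
rewrite !v_theta, weight_wfun; field; auto.
Qed.

Lemma Laur_cRInt f M : nb (Laur 1 1) f M -> exists l, cRInt (fun t => f (expi t)) 0 PI l.
Proof.
intros Hf; apply cRInt_ex; intros t.
pose proof (Laur_cont 1 1 f M 1 t Hf ltac:(lra) ltac:(lra)) as H.
assert (E : forall x, circ 1 x = expi x) by (intros x; unfold circ; ring).
rewrite E in H.
apply Cto_ext with (f := fun x => f (circ 1 x)); [filt| |exact H].
apply filter_forall; intros x; now rewrite E.
Qed.

Lemma Rpower_32 : Rpower q (3 / 2) = (q * Rpower q (1 / 2))%R.
Proof.
replace (3 / 2)%R with (1 + 1 / 2)%R by field; rewrite Rpower_plus, Rpower_1 by lra; easy.
Qed.

(** The extension V has the expansion V(p0 + h) = V(p0) + h (j1 + h j2) at p0, the p of nu.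
As V(p0) vanishes at alpha, [V_star] for p0 + h and p0 has the factor h on both sides;
dividing it out and letting h tend to 0 gives the integral as a multiple of j1 at alpha,
that is of the derivative in p. *)
Theorem squared_norm nu : v q nu alpha0 a b c d = 0 ->
  exists D : C,
     is_derive_lambda q a b c d (fun eps => v q eps alpha0 a b c d) nu D /\
     cRInt (fun theta => (v q nu (z_of_theta q theta) a b c d) ^ 2 * weight q a b c d al theta)
       0 PI
       (1 / denom_prod * (- (4) * PI * Rpower q (1 / 2) * d / (1 - q)) * D
        * nabla_x q (fun z => v q nu z a b c d) alpha0).
Proof.
intros Hnu; rewrite v_al in Hnu.
set (p0 := pn nu) in *.
pose proof lam_const_neq_0 as Hlc.
destruct HV as [Hjet _]; destruct (Hjet p0) as [M [w [J0 J1 J2 JN JE]]].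
assert (HL : forall p, L p = - (1 + a * a * k0) + a * p) by (intros p; unfold L, eigval; ring).
assert (JA : forall h z, (Cmod h <= 1)%R -> annulus q (/ q) z ->
   V (p0 + h) z = V p0 z + h * (j1 w z + h * j2 w h z)).
{ intros h z Hh Hz; pose proof (JE h z Hh Hz) as E; pose proof (JE 0 z ltac:(rewrite Cmod_0; lra) Hz) as E0.
  simpl in E, E0; rewrite Cplus_0_r in E0; rewrite E, E0; ring. }
(* lambda = - lam_const L and L has slope a in p, so d p / d lambda = - 1/(lam_const a). *)
set (D := - (j1 w al / (lam_const * a))).
exists D; split.
- exists (fun x => V ((- x / lam_const + (1 + a * a * k0)) / a) al); split.
  + intros eps; rewrite v_al, lambda_L, HL; f_equal; field; auto.
  + assert (Hla : (0 < Cmod (lam_const * a))%R) by (apply Cmod_gt_0; now apply Cmult_neq_0).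
    apply (is_derive_quadratic _ _ _ (Cmod (lam_const * a)) (n2 w / (Cmod (lam_const * a) * Cmod (lam_const * a)))%R); auto.
    intros k Hk; rewrite lambda_L, HL.
    replace ((- (- lam_const * (- (1 + a * a * k0) + a * pn nu)) / lam_const + (1 + a * a * k0)) / a)
      with p0 by (unfold p0; field; auto).
    set (h := - (k / (lam_const * a))).
    replace ((- (- lam_const * (- (1 + a * a * k0) + a * pn nu) + k) / lam_const + (1 + a * a * k0)) / a)
      with (p0 + h) by (unfold h, p0; field; auto).
    assert (Eh : (Cmod h = Cmod k / Cmod (lam_const * a))%R)
      by (unfold h; rewrite Cmod_opp, Cmod_div; auto; now apply Cmult_neq_0).
    assert (Hh : (Cmod h <= 1)%R).
    { rewrite Eh; apply Rmult_le_reg_r with (Cmod (lam_const * a)); auto.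
      unfold Rdiv; rewrite Rmult_assoc, Rinv_l by lra; lra. }
    rewrite JA by (auto; apply al_annulus).
    replace (V p0 al + h * (j1 w al + h * j2 w h al) - V p0 al - k * D)
      with (h * h * j2 w h al) by (unfold D, h; field; auto).
    rewrite (Cmod_mult (h * h)), (Cmod_mult h), Eh.
    set (m := Cmod (lam_const * a)) in *.
    replace (n2 w / (m * m) * (Cmod k * Cmod k))%R with (Cmod k / m * (Cmod k / m) * n2 w)%R
      by (field; lra).
    apply Rmult_le_compat_l; [apply Rle_0_sqr|].
    apply (nb_bound _ _ _ (J2 h Hh)), al_annulus.
- destruct nb_wfun as [Mw Nw].
  assert (Hres : forall f K, nb (LaurQ q) f K -> nb (Laur 1 1) f K).
  { intros f K; apply nb_restrict; [lra|].
    rewrite <- Rinv_1; apply Rinv_le_contravar; lra. }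
  destruct (V_Laur p0) as [Mv Nv]; pose proof (Hres _ _ Nv) as Nv'.
  assert (N0 : nb (Laur 1 1) (fun z => V p0 z * V p0 z * wfun q a b c s al z) (Mv * Mv * Mw)).
  { apply nb_mult; auto; now apply nb_mult. }
  destruct (Laur_cRInt _ _ N0) as [I0 HI0].
  (* The factor of j1 in [V_star] after division by L(p0 + h) - L(p0) = a h. *)
  set (Kq := 2 * PI * (d / (al * denom_prod) * V p0 (al / q) / (1 - q / (al * al))) / a).
  assert (HK : forall h : C, (0 < Cmod h <= 1)%R ->
    (Cmod (I0 - Kq * j1 w al) <= (PI * ((n1 w + n2 w) * Mv * Mw) + Cmod Kq * n2 w) * Cmod h)%R).
  { intros h [Hh0 Hh].
    assert (Hhn : h <> 0) by now apply Cmod_gt_0.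
    assert (NE : nb (Laur 1 1) (fun z => (j1 w z + h * j2 w h z) * V p0 z * wfun q a b c s al z)
                   ((n1 w + n2 w) * Mv * Mw)).
    { apply nb_mult; auto; apply nb_mult; auto.
      pose proof (nb_pos _ _ _ (J2 h Hh)).
      apply (nb_le _ _ (n1 w + Cmod h * n2 w)); [|nra].
      apply nb_plus; [now apply Hres|apply nb_scal]; apply Hres, J2, Hh. }
    destruct (Laur_cRInt _ _ NE) as [E HE].
    pose proof (V_star (p0 + h) p0) as HS.
    assert (E1 : (L (p0 + h) - L p0) * (I0 + h * E)
      = 2 * PI * (- d / (al * denom_prod) * (V (p0 + h) (al / q) * V p0 al - V (p0 + h) al * V p0 (al / q))
               / (1 - q / (al * al)))).
    { refine (cRInt_unique _ _ _ _ _ _ HS).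
      refine (cRInt_ext _ _ _ _ _ _ (cRInt_scal (L (p0 + h) - L p0) _ _ _ _
        (cRInt_plus _ _ _ _ _ _ HI0 (cRInt_scal h _ _ _ _ HE)))).
      intros t; simpl; rewrite (JA h (expi t)) by (auto; apply annulus_1; auto; apply Cmod_expi).
      ring. }
    rewrite (JA h al Hh al_annulus), Hnu in E1.
    rewrite !HL in E1.
    assert (E2 : I0 + h * E = Kq * (j1 w al + h * j2 w h al)).
    { pose proof al_nz; pose proof denom_prod_neq_0.
      assert (Hden : al * al - q <> 0).
      { intros E'; apply den_nz; replace (1 - q / (al * al)) with ((al * al - q) / (al * al)) by (field; auto).
        rewrite E'; field; auto. }
      replace (I0 + h * E) with (/ (a * h) *
        ((- (1 + a * a * k0) + a * (p0 + h) - (- (1 + a * a * k0) + a * p0)) * (I0 + h * E)))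
        by (field; auto).
      rewrite E1; unfold Kq; field; auto 10. }
    replace (I0 - Kq * j1 w al) with (h * (Kq * j2 w h al) + - (h * E)).
    - eapply Rle_trans; [apply Cmod_triangle|]; rewrite Cmod_opp, !Cmod_mult.
      assert (B1 : (Cmod (j2 w h al) <= n2 w)%R)
        by (apply (nb_bound _ _ _ (J2 h Hh)), al_annulus).
      assert (B2 : (Cmod E <= PI * ((n1 w + n2 w) * Mv * Mw))%R).
      { replace PI with (PI - 0)%R at 1 by ring.
        apply (cRInt_bound (fun t => (j1 w (expi t) + h * j2 w h (expi t)) * V p0 (expi t) * wfun q a b c s al (expi t))); auto.
        - pose proof PI_RGT_0; lra.
        - intros t; apply (nb_bound _ _ _ NE); simpl; unfold annulus; rewrite Cmod_expi; lra. }
      pose proof (Cmod_ge_0 Kq); pose proof (Cmod_ge_0 h).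
      assert (Cmod Kq * Cmod (j2 w h al) <= Cmod Kq * n2 w)%R by (apply Rmult_le_compat_l; auto).
      nra.
    - replace I0 with (Kq * (j1 w al + h * j2 w h al) - h * E) by (rewrite <- E2; ring); ring. }
  set (K0 := (PI * ((n1 w + n2 w) * Mv * Mw) + Cmod Kq * n2 w)%R) in *.
  assert (EI : I0 - Kq * j1 w al = 0).
  { apply (eps_zero _ (Rabs K0)); intros eps He.
    destruct (Rle_lt_dec eps 1) as [H1|H1].
    - assert (Hm : Cmod (RtoC eps) = eps) by (rewrite Cmod_R, Rabs_pos_eq; lra).
      specialize (HK (RtoC eps)); rewrite Hm in HK; specialize (HK ltac:(lra)).
      pose proof (Rle_abs K0); nra.
    - specialize (HK 1); rewrite Cmod_1 in HK; specialize (HK ltac:(lra)).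
      pose proof (Rle_abs K0); pose proof (Rabs_pos K0); nra. }
  assert (EI' : I0 = Kq * j1 w al)
    by (replace I0 with (I0 - Kq * j1 w al + Kq * j1 w al) by ring; rewrite EI; ring).
  match goal with |- cRInt _ _ _ ?l => replace l with I0 end.
  + refine (cRInt_ext _ _ _ _ _ _ HI0); intros t; simpl.
    rewrite v_theta, weight_wfun; fold p0; ring.
  + rewrite EI'; unfold nabla_x; rewrite v_al, v_al_1; fold p0; rewrite Hnu.
    unfold qx; rewrite !qpow_neg, qpow_minus_1 by auto; fold al.
    pose proof al_nz as Hn; pose proof denom_prod_neq_0 as HP; pose proof (q_C_neq_0 q Hq) as Hq0.
    assert (Hden : al * al - q <> 0).
    { intros E'; apply den_nz; replace (1 - q / (al * al)) with ((al * al - q) / (al * al)) by (field; auto).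
      rewrite E'; field; auto. }
    unfold Kq, D, lam_const; rewrite Rpower_32, RtoC_mult.
    assert (Hr : RtoC (Rpower q (1 / 2)) <> 0)
      by (intros E; apply RtoC_inj in E; unfold Rpower in E; pose proof (exp_pos (1 / 2 * ln q)); lra).
    assert (H1q : 1 - RtoC q <> 0)
      by (rewrite <- RtoC_minus; intros E; apply RtoC_inj in E; lra).
    assert (Hx : (al + / al) / 2 - (al / q + / (al / q)) / 2
                 = - ((1 - q) * (al * al - q) / (2 * q * al))).
    { field; auto. }
    rewrite Hx; clear Hx.
    generalize dependent (RtoC (Rpower q (1 / 2))); intros r Hr.
    field; repeat split; auto.
Qed.

End Final.

Theorem mainTheorem1 (q : R) (a b c d alpha0 mu nu : C) :
  (0 < q < 1)%R ->
  a <> 0 -> b <> 0 -> c <> 0 -> d <> 0 ->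
  (Rmax (Rmax (Cmod a) (Cmod b)) (Rmax (Cmod c) (Cmod (q / d))) < 1)%R ->
  (0 < Re alpha0 < 1 / 2)%R ->
  let alpha := qpow q alpha0 in
  v q mu alpha0 a b c d = 0 ->
  v q nu alpha0 a b c d = 0 ->
  (lambda q a b c d mu <> lambda q a b c d nu ->
   is_RInt (V := C_R_NormedModule)
     (fun theta => v q mu (z_of_theta q theta) a b c d
                   * v q nu (z_of_theta q theta) a b c d
                   * weight q a b c d alpha theta)
     0 PI (RtoC 0))
  /\
  (mu = nu ->
   exists D : C,
     is_derive_lambda q a b c d (fun eps => v q eps alpha0 a b c d) nu D /\
     is_RInt (V := C_R_NormedModule)
       (fun theta => (v q nu (z_of_theta q theta) a b c d) ^ 2
                     * weight q a b c d alpha theta)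
       0 PI
       (1 / qpochs_inf q [RtoC q; RtoC q; alpha * a; q * a / alpha; alpha * b; q * b / alpha;
                          alpha * c; q * c / alpha; q * alpha / d; q ^ 2 / (alpha * d)]
        * (- (4) * PI * Rpower q (1 / 2) * d / (1 - q))
        * D
        * nabla_x q (fun z => v q nu z a b c d) alpha0)).
Proof.
intros Hq Ha0 Hb0 Hc0 Hd0 Hm Hal alpha Hmu Hnu.
pose proof (Rmax_l (Rmax (Cmod a) (Cmod b)) (Rmax (Cmod c) (Cmod (q / d)))).
pose proof (Rmax_r (Rmax (Cmod a) (Cmod b)) (Rmax (Cmod c) (Cmod (q / d)))).
pose proof (Rmax_l (Cmod a) (Cmod b)); pose proof (Rmax_r (Cmod a) (Cmod b)).
pose proof (Rmax_l (Cmod c) (Cmod (q / d))); pose proof (Rmax_r (Cmod c) (Cmod (q / d))).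
assert (Ha : (Cmod a < 1)%R) by lra; assert (Hb : (Cmod b < 1)%R) by lra.
assert (Hc : (Cmod c < 1)%R) by lra; assert (Hs : (Cmod (q / d) < 1)%R) by lra.
destruct (regular_exists q a b c d Hq Ha0 Hb0 Hc0 Hd0 Ha Hb Hc Hs) as [V HV].
split.
- intros Hne; eapply orthogonality; eauto.
- intros _; eapply squared_norm; eauto.
Qed.
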